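(* Let $\nu$ be the middle-thirds Cantor measure affinely rescaled to $[0.5,2.0]$, let $d=\log2/\log3$, and let $L(s)=\sum_{n\ge1}\hat\nu(n)n^{-s}$, continued to an entire function. Then, as $T\to\infty$, $$\int_T^{2T}\bigl|L(\tfrac12+it)\bigr|^2\,dt=C_\nu\,T+O\bigl(T^{1-d/2}\bigr),\qquad C_\nu=\sum_{n\ge1}\frac{|\hat\nu(n)|^2}{n}\approx1.156.$$
   Context: $\nu$ is the probability measure on $[0.5,2.0]\subset(0,2\pi)$ obtained from the middle-thirds Cantor measure by an affine map, and $\hat\nu(n)=\int e^{in\theta}\,d\nu(\theta)$. The entire continuation is $L(s)=\int F(\theta,s)\,d\nu(\theta)$ with $F(\theta,s)=\sum_{n\ge1}e^{in\theta}n^{-s}$ the periodic zeta function (continued analytically). The series defining $C_\nu$ converges. *)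

(* Defs.v *)
From HB Require Import structures.
From mathcomp Require Import all_boot all_order all_algebra.
From mathcomp Require Import all_classical all_reals all_analysis.
From mathcomp Require Import measurable_realfun complex.

Set Implicit Arguments.
Unset Strict Implicit.
Unset Printing Implicit Defensive.

Import Order.TTheory GRing.Theory Num.Theory.
Import numFieldNormedType.Exports.

Local Open Scope classical_set_scope.
Local Open Scope ring_scope.
Local Open Scope complex_scope.

Section cantor_measure.
Variable R : realType.

(* For x in [0, 1), the coefficient of 2^-(k+1) in the binary expansion of x.
   Under the uniform law on [0, 1] these digits are independent fair bits. *)
Definition binary_digit (k : nat) (x : R) : R :=
  (Num.floor (2 ^+ k.+1 * x))%:~R - 2 * (Num.floor (2 ^+ k * x))%:~R.

Definition cantor_map (x : measurableTypeR R) : R :=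
  limn (series (fun k => 2 * binary_digit k x / 3 ^+ k.+1)).

Lemma binary_digit_itv k x : 0 <= binary_digit k x <= 1.
Proof.
rewrite /binary_digit exprS -mulrA; set y := 2 ^+ k * x.
have /andP[lo hi] := floor_itv y.
set m := Num.floor y in lo hi *.
have h1 : 2 * m <= Num.floor (2 * y).
  by rewrite floor_ge_int rmorphM ler_pM2l.
have h2 : Num.floor (2 * y) < 2 * m + 1 + 1.
  rewrite floor_lt_int -addrA -[1 + 1]/(2 * 1 : int) -mulrDr rmorphM ltr_pM2l//.
rewrite ltzD1 in h2.
move: h1 h2; rewrite -!(ler_int R) rmorphD !rmorphM /= => h1 h2.
by rewrite subr_ge0 lerBlDr addrC h1.
Qed.

Lemma is_cvg_cantor_series x :
  cvgn (series (fun k => 2 * binary_digit k x / 3 ^+ k.+1)).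
Proof.
have H k := andP (binary_digit_itv k x).
apply: (@series_le_cvg _ _ (geometric (2 / 3) 3^-1)) => [k|k|k|].
- by have [? _] := H k; rewrite divr_ge0 ?mulr_ge0 ?exprn_ge0.
- by rewrite /= mulr_ge0 ?exprn_ge0 ?invr_ge0 ?divr_ge0.
- have [_ ?] := H k.
  rewrite /= exprS invfM exprVn mulrA ler_pM2r ?invr_gt0 ?exprn_gt0//.
  by rewrite ler_pM2r ?invr_gt0// ler_piMr.
- by apply: is_cvg_geometric_series; rewrite ger0_norm ?invr_ge0// invf_lt1// ltr1n.
Qed.

Lemma measurable_cantor_map : measurable_fun setT cantor_map.
Proof.
apply: (@measurable_fun_cvg _ _ _ _
    (fun n x => series (fun k => 2 * binary_digit k x / 3 ^+ k.+1) n)); last first.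
  by move=> x _; exact: is_cvg_cantor_series.
have mfl j : measurable_fun setT (fun x : R => (Num.floor (2 ^+ j * x))%:~R : R).
  apply: nondecreasing_measurable => // s t st.
  by rewrite ler_int le_floor// ler_wpM2l// exprn_ge0.
move=> n; rewrite /series /=; apply: measurable_sum => k.
apply: measurable_funM => //; apply: measurable_funM => //.
by apply: measurable_funB => //; apply: measurable_funM.
Qed.

HB.instance Definition _ := @isMeasurableFun.Build _ _ _ _
  cantor_map measurable_cantor_map.

(* The law of sum_(k >= 0) 2 b_k / 3^(k+1) with (b_k) independent fair bits. *)
Definition cantor_measure : probability R R :=
  distribution (uniform_prob (@ltr01 R)) cantor_map.

Definition rescaling (x : R) : R := 1 / 2 + 3 / 2 * x.

Lemma measurable_rescaling : measurable_fun setT rescaling.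
Proof. by apply: measurable_funD => //; exact: measurable_funM. Qed.

HB.instance Definition _ := @isMeasurableFun.Build _ _ _ _
  rescaling measurable_rescaling.

Definition nu : probability R R :=
  distribution cantor_measure rescaling.

End cantor_measure.

Section dirichlet.
Variable R : realType.

Definition cexp (z : R[i]) : R[i] :=
  (expR (complex.Re z))%:C * (cos (complex.Im z) +i* sin (complex.Im z)).

Definition cpow (n : nat) (s : R[i]) : R[i] := cexp (s * (ln n%:R)%:C).

Definition nu_hat (n : nat) : R[i] :=
  (\int[nu R]_theta cos (n%:R * theta)) +i*
  (\int[nu R]_theta sin (n%:R * theta)).

(* R[i]^o is R[i] with the topology of its norm; derivable over the scalar
   field R[i] is complex differentiability. *)
Definition entire (f : R[i] -> R[i]) : Prop :=
  forall z : R[i], derivable (f : R[i]^o -> R[i]^o) z 1.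

(* f is the entire continuation of sum_(n >= 1) a_n n^-s; by the identity
   theorem there is at most one such f. *)
Definition entire_continuation (a : nat -> R[i]) (f : R[i] -> R[i]) : Prop :=
  entire f /\
  forall s : R[i], 1 < complex.Re s ->
    (series (fun k => a k.+1 * cpow k.+1 (- s)) : nat -> R[i]^o)
      @ \oo --> (f s : R[i]^o).

Definition cantor_dim : R := ln 2 / ln 3.

Definition C_nu_term (k : nat) : R := Normc.normc (nu_hat k.+1) ^+ 2 / k.+1%:R.

Definition C_nu : R := limn (series C_nu_term).

End dirichlet.

(* Main.v *)
Require Import Defs.
From mathcomp Require Import all_boot all_order all_algebra.
From mathcomp Require Import all_classical all_reals all_analysis.
From mathcomp Require Import measurable_realfun complex.
From mathcomp Require Import ring lra.

Set Implicit Arguments.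
Unset Strict Implicit.
Unset Printing Implicit Defensive.

Import Order.TTheory GRing.Theory Num.Theory.
Import numFieldNormedType.Exports.

Local Open Scope classical_set_scope.
Local Open Scope ring_scope.
Local Open Scope complex_scope.

(** Write a_n for the n-th Fourier coefficient of the Cantor measure and
p_n = |a_n|^2. Everything rests on the law of the difference D of two
independent points of the Cantor set: D is the sum of e_k / 3^k over k >= 0,
where e_k is -1, 0, 1 with probabilities 1/4, 1/2, 1/4, so that
p_n = E cos (n D). All expectations are taken at a finite stage K, where they are
finite sums obeying a one-step recursion, and 3^-K controls the error.

The first nonzero digit of D is e_k with probability 2^-(k+1) and then |D| is of
size 3^-k. Averaging |sum of cos (n x) over n <= N| <= min (N, 4 / |x|) over this
law gives sum_(n <= 3^K) p_n = O((3/2)^K), that is O(N^(1-d)) for N = 3^K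
(sum_coef_le), hence the convergence of the series for C and a tail O(2^-K)
(sum_coef_div_tail).

The sum of cos (n x) / n over n >= 1 is - ln |2 sin (x/2)|, so C is the
logarithmic energy E(- ln |2 sin (D/2)|) (sum_coef_div_energy). Self-similarity
computes it: e_0 = 0 with probability 1/2 and then D is a copy of D / 3, so
E(- ln |D|) = ln 3 - E(ln (1 - D^2/9)) / 2, and what remains is a rapidly
convergent series in the moments of D^2 (log_energy_le, log_energy_ge).

The continuation is obtained by summing by parts. On the support of the measure
1 - e^(iy) is bounded away from 0, so the means of e^(iny) / (1 - e^(iy))^k are
bounded in n and their k-th differences are the a_n. After k summations by parts
n^-s is replaced by its k-th difference, of size |n^(-s-k)|, and the series
converges for Re s > 1 - k; the values for different k agree. It is
differentiable in s because the k-th difference of the second-order remainder of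
n^-(s+h) in h is O(|h|^2) with summable constants (continuation_entire). The
k-th differences are estimated by the mean value theorem applied k times.

On the critical line, with T <= t <= 2T and N >= T^(3/2), three summations by
parts past N give L(1/2 + it) = sum_(n <= N) a_n n^(-1/2-it) + O(N^(-1/2))
(continuation_approx). The mean square of the polynomial is T times the partial
sum of C, plus off-diagonal terms bounded elementarily by
O(sum_(n <= N) p_n * log N) (dirichlet_poly_mean_square). With N = 3^K the
smallest power of 3 above T^(3/2), the bounds above make these errors
O(T 2^-K) and O(K (3/2)^K), both O(T^(1-d/2)) because 3^d = 2. *)


(** * Derivatives along the real line *)

Section calculus.
Variable R : realType.
Implicit Types (f g : R -> R) (x y a b c : R).

(** A plain proposition rather than the class of the same content, so that a
derivative still to be computed is never guessed by instance search. *)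
Definition der f x a : Prop := is_derive x 1 f a.

Lemma der_eq f x a b : der f x a -> a = b -> der f x b.
Proof. by move=> + <-. Qed.

Lemma der_cst c x : der (fun=> c) x 0.
Proof. exact: is_derive_cst. Qed.

Lemma der_id x : der (fun y => y) x 1.
Proof. exact: is_derive_id. Qed.

Lemma derD f g x a b : der f x a -> der g x b ->
  der (fun y => f y + g y) x (a + b).
Proof. by move=> ha hb; exact: is_deriveD. Qed.

Lemma derN f x a : der f x a -> der (fun y => - f y) x (- a).
Proof. by move=> ha; exact: is_deriveN. Qed.

Lemma derM f g x a b : der f x a -> der g x b ->
  der (fun y => f y * g y) x (a * g x + f x * b).
Proof.
move=> ha hb; apply: der_eq; first exact: (is_deriveM ha hb).
by rewrite /GRing.scale /= addrC mulrC.
Qed.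

Lemma derX f n x a : der f x a ->
  der (fun y => f y ^+ n) x (n%:R * f x ^+ n.-1 * a).
Proof.
move=> ha; elim: n => [|n IH].
  by apply: der_eq; [exact: der_cst|rewrite !mul0r].
have -> : (fun y => f y ^+ n.+1) = (fun y => f y * f y ^+ n).
  by apply/funext => y; rewrite exprS.
apply: der_eq; first exact: (derM ha IH).
case: n {IH} => [|n] /=; first by rewrite !expr0; ring.
by rewrite -[n.+2%:R]natr1 !exprS; ring.
Qed.

Lemma derV f x a : f x != 0 -> der f x a ->
  der (fun y => (f y)^-1) x (- a / f x ^+ 2).
Proof.
move=> fx0 ha; have h := is_deriveV fx0 ha; apply: (der_eq h).
by rewrite /GRing.scale /= mulNr mulrC mulNr.
Qed.

Lemma der_comp f g x a b : der f (g x) a -> der g x b ->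
  der (fun y => f (g y)) x (a * b).
Proof. by move=> ha hb; exact: is_derive1_comp. Qed.

Lemma der_sin g x b : der g x b ->
  der (fun y => sin (g y)) x (cos (g x) * b).
Proof. by move=> h; apply: der_comp h; exact: is_derive_sin. Qed.

Lemma der_cos g x b : der g x b ->
  der (fun y => cos (g y)) x (- sin (g x) * b).
Proof. by move=> h; apply: der_comp h; exact: is_derive_cos. Qed.

Lemma der_exp g x b : der g x b ->
  der (fun y => expR (g y)) x (expR (g x) * b).
Proof. by move=> h; apply: der_comp h; exact: is_derive_expR. Qed.

Lemma der_ln g x b : 0 < g x -> der g x b ->
  der (fun y => ln (g y)) x (b / g x).
Proof. by move=> g0 h; rewrite mulrC; apply: der_comp h; exact: is_derive1_ln. Qed.

Lemma der_sum n (F : nat -> R -> R) (G : nat -> R) x :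
  (forall i, (i < n)%N -> der (F i) x (G i)) ->
  der (fun y => \sum_(i < n) F i y) x (\sum_(i < n) G i).
Proof.
elim: n => [_|n IH H].
  by apply: der_eq; [|rewrite big_ord0; reflexivity];
     under eq_fun do rewrite big_ord0; exact: der_cst.
under eq_fun do rewrite big_ord_recr /=.
rewrite big_ord_recr /=; apply: derD; last exact: H.
by apply: IH => i /ltnW; exact: H.
Qed.

Lemma der_continuous f x a : der f x a -> {for x, continuous f}.
Proof. by case=> h _; exact/differentiable_continuous/derivable1_diffP. Qed.

Lemma der_within f (df : R -> R) a b :
  (forall x, a <= x <= b -> der f x (df x)) ->
  {within `[a, b], continuous f}.
Proof.
move=> h; apply: continuous_in_subspaceT => x; rewrite inE /= in_itv /= => xab.
exact: der_continuous (h x xab).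
Qed.

Lemma mean_value f (df : R -> R) a b : a <= b ->
  (forall x, a <= x <= b -> der f x (df x)) ->
  exists2 c, a <= c <= b & f b - f a = df c * (b - a).
Proof.
move=> ab h; have hoo x : x \in `]a, b[%R -> der f x (df x).
  by rewrite in_itv /= => /andP[/ltW ax /ltW xb]; apply: h; rewrite ax.
have [c] := MVT_segment ab hoo (der_within h).
by rewrite in_itv /= => hc e; exists c.
Qed.

Lemma der_ge0_le f (df : R -> R) a b : a <= b ->
  (forall x, a <= x <= b -> der f x (df x)) ->
  (forall x, a <= x <= b -> 0 <= df x) -> f a <= f b.
Proof.
move=> ab h h0; have [c hc e] := mean_value ab h.
by rewrite -subr_ge0 e mulr_ge0 ?h0// subr_ge0.
Qed.

Lemma der_norm_le f (df : R -> R) a b M : a <= b ->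
  (forall x, a <= x <= b -> der f x (df x)) ->
  (forall x, a <= x <= b -> `|df x| <= M) -> `|f b - f a| <= M * (b - a).
Proof.
move=> ab h h0; have [c hc ->] := mean_value ab h.
rewrite normrM [`|b - a|]ger0_norm ?subr_ge0//.
by rewrite ler_wpM2r ?subr_ge0 ?h0.
Qed.

(** With g an explicit primitive of the majorant, this bounds the increment of f
without any integral. *)
Lemma der_dominated f g (df dg : R -> R) a b : a <= b ->
  (forall x, a <= x <= b -> der f x (df x)) ->
  (forall x, a <= x <= b -> der g x (dg x)) ->
  (forall x, a <= x <= b -> `|df x| <= dg x) ->
  `|f b - f a| <= g b - g a.
Proof.
move=> ab hf hg h; rewrite ler_norml; apply/andP; split.
  have := @der_ge0_le (fun x => g x + f x) (fun x => dg x + df x) a b ab.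
  move=> /(_ (fun x xab => derD (hg x xab) (hf x xab))) H.
  suff : g a + f a <= g b + f b by lra.
  by apply: H => x /h; rewrite ler_norml => /andP[]; lra.
have := @der_ge0_le (fun x => g x + - f x) (fun x => dg x + - df x) a b ab.
move=> /(_ (fun x xab => derD (hg x xab) (derN (hf x xab)))) H.
suff : g a + - f a <= g b + - f b by lra.
by apply: H => x /h; rewrite ler_norml => /andP[]; lra.
Qed.

End calculus.

Ltac der_step := first
  [ apply: der_cst | apply: der_id | apply: derD | apply: derN | apply: derM
  | apply: derX | apply: der_sin | apply: der_cos | apply: der_exp
  | apply: der_ln | apply: derV | assumption ].
Ltac der := apply: der_eq; [ repeat der_step | ].

(** * Elementary bounds for sine and logarithm *)

Section elementary_bounds.
Variable R : realType.
Implicit Types x y u : R.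

Lemma sin_le_id x : 0 <= x -> sin x <= x.
Proof.
move=> x0; rewrite -subr_ge0.
have := @der_ge0_le R (fun y => y - sin y) (fun y => 1 - cos y) 0 x x0.
rewrite sin0 subrr; apply=> y _; last by rewrite subr_ge0 cos_le1.
by der; rewrite mulr1.
Qed.

Lemma cos_ge_quadratic x : 0 <= x -> 1 - x ^+ 2 / 2 <= cos x.
Proof.
move=> x0; rewrite -subr_ge0.
have := @der_ge0_le R (fun y => cos y - 1 + y ^+ 2 / 2)
  (fun y => y - sin y) 0 x x0.
rewrite cos0 => H.
suff : 1 - 1 + 0 ^+ 2 / 2 <= cos x - 1 + x ^+ 2 / 2 by lra.
apply: H => y /andP[y0 _]; last by rewrite subr_ge0 sin_le_id.
by der; rewrite /=; lra.
Qed.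

Lemma sin_ge_cubic x : 0 <= x -> x - x ^+ 3 / 6 <= sin x.
Proof.
move=> x0; rewrite -subr_ge0.
have := @der_ge0_le R (fun y => sin y - y + y ^+ 3 / 6)
  (fun y => cos y - 1 + y ^+ 2 / 2) 0 x x0.
rewrite sin0 => H.
suff : 0 - 0 + 0 ^+ 3 / 6 <= sin x - x + x ^+ 3 / 6 by lra.
apply: H => y /andP[y0 _]; last by have := cos_ge_quadratic y0; lra.
by der; rewrite /=; lra.
Qed.

Lemma cos_le_quartic x : 0 <= x -> cos x <= 1 - x ^+ 2 / 2 + x ^+ 4 / 24.
Proof.
move=> x0; rewrite -subr_ge0.
have := @der_ge0_le R (fun y => 1 - y ^+ 2 / 2 + y ^+ 4 / 24 - cos y)
  (fun y => sin y - y + y ^+ 3 / 6) 0 x x0.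
rewrite cos0 => H.
suff : 1 - 0 ^+ 2 / 2 + 0 ^+ 4 / 24 - 1
    <= 1 - x ^+ 2 / 2 + x ^+ 4 / 24 - cos x by lra.
apply: H => y /andP[y0 _]; last by have := sin_ge_cubic y0; lra.
by der; rewrite /=; lra.
Qed.

Lemma sin_le_quintic x : 0 <= x -> sin x <= x - x ^+ 3 / 6 + x ^+ 5 / 120.
Proof.
move=> x0; rewrite -subr_ge0.
have := @der_ge0_le R (fun y => y - y ^+ 3 / 6 + y ^+ 5 / 120 - sin y)
  (fun y => 1 - y ^+ 2 / 2 + y ^+ 4 / 24 - cos y) 0 x x0.
rewrite sin0 => H.
suff : 0 - 0 ^+ 3 / 6 + 0 ^+ 5 / 120 - 0
    <= x - x ^+ 3 / 6 + x ^+ 5 / 120 - sin x by lra.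
apply: H => y /andP[y0 _]; last by have := cos_le_quartic y0; lra.
by der; rewrite /=; lra.
Qed.

Lemma ln_onem_le u : 0 <= u <= 1 / 4 ->
  - ln (1 - u) <= u + u ^+ 2 / 2 + 4 / 9 * u ^+ 3.
Proof.
case/andP=> u0 u4.
have := @der_ge0_le R (fun y => y + y ^+ 2 / 2 + 4 / 9 * y ^+ 3 + ln (1 - y))
  (fun y => 1 + y + 4 / 3 * y ^+ 2 - (1 - y)^-1) 0 u u0.
rewrite /= (subr0 (1 : R)) ln1 => H.
suff : 0 + 0 ^+ 2 / 2 + 4 / 9 * 0 ^+ 3 + 0
    <= u + u ^+ 2 / 2 + 4 / 9 * u ^+ 3 + ln (1 - u) by lra.
apply: H => y /andP[y0 yu].
  by der; [lra|rewrite /=; lra].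
have y1 : 0 < 1 - y by lra.
by rewrite subr_ge0 -[_^-1]mul1r ler_pdivrMr//; nra.
Qed.

Lemma ln_onem_ge u : 0 <= u <= 1 / 4 ->
  u + u ^+ 2 / 2 + u ^+ 3 / 3 <= - ln (1 - u).
Proof.
case/andP=> u0 u4.
have := @der_ge0_le R (fun y => - ln (1 - y) - y - y ^+ 2 / 2 - y ^+ 3 / 3)
  (fun y => (1 - y)^-1 - 1 - y - y ^+ 2) 0 u u0.
rewrite /= (subr0 (1 : R)) ln1 => H.
suff : - 0 - 0 - 0 ^+ 2 / 2 - 0 ^+ 3 / 3
    <= - ln (1 - u) - u - u ^+ 2 / 2 - u ^+ 3 / 3 by lra.
apply: H => y /andP[y0 yu].
  by der; [lra|rewrite /=; lra].
have y1 : 0 < 1 - y by lra.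
suff : 1 + y + y ^+ 2 <= (1 - y)^-1 by lra.
rewrite -[leRHS]mul1r ler_pdivlMr//.
rewrite (_ : _ * _ = 1 - y ^+ 3); last ring.
by rewrite lerBlDr lerDl exprn_ge0.
Qed.

(** From the power series 2 (u + u^3/3 + u^5/5 + ...): for u <= 1/4 the
coefficient 3/14 > 1/5 absorbs all the later terms. *)
Lemma ln_ratio_bounds u : 0 <= u <= 1 / 4 ->
  2 * (u + u ^+ 3 / 3 + u ^+ 5 / 5) <= ln (1 + u) - ln (1 - u)
    <= 2 * (u + u ^+ 3 / 3 + u ^+ 5 * (3 / 14)).
Proof.
case/andP=> u0 u4; apply/andP; split.
  have := @der_ge0_le R
    (fun y => ln (1 + y) - ln (1 - y) - 2 * (y + y ^+ 3 / 3 + y ^+ 5 / 5))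
    (fun y => (1 + y)^-1 + (1 - y)^-1 - 2 * (1 + y ^+ 2 + y ^+ 4)) 0 u u0.
  rewrite /= (subr0 (1 : R)) (addr0 (1 : R)) ln1 => H.
  suff : 0 - 0 - 2 * (0 + 0 ^+ 3 / 3 + 0 ^+ 5 / 5)
    <= ln (1 + u) - ln (1 - u) - 2 * (u + u ^+ 3 / 3 + u ^+ 5 / 5) by lra.
  apply: H => y /andP[y0 yu].
    by der; [lra|lra|rewrite /=; lra].
  rewrite (_ : (1 + y)^-1 + (1 - y)^-1 = 2 / (1 - y ^+ 2)); last first.
    by field; apply/and3P; split; apply: lt0r_neq0; nra.
  rewrite subr_ge0 ler_pdivlMr; last by nra.
  rewrite (_ : _ * _ = 2 - 2 * (y ^+ 2) ^+ 3); last ring.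
  by rewrite lerBlDr lerDl mulr_ge0 ?exprn_ge0.
have := @der_ge0_le R
  (fun y => 2 * (y + y ^+ 3 / 3 + y ^+ 5 * (3 / 14)) - (ln (1 + y) - ln (1 - y)))
  (fun y => 2 * (1 + y ^+ 2 + 15 / 14 * y ^+ 4) - ((1 + y)^-1 + (1 - y)^-1)) 0 u u0.
rewrite /= (subr0 (1 : R)) (addr0 (1 : R)) ln1 => H.
suff : 2 * (0 + 0 ^+ 3 / 3 + 0 ^+ 5 * (3 / 14)) - (0 - 0)
  <= 2 * (u + u ^+ 3 / 3 + u ^+ 5 * (3 / 14)) - (ln (1 + u) - ln (1 - u)) by lra.
apply: H => y /andP[y0 yu].
  by der; [lra|lra|rewrite /=; lra].
rewrite (_ : (1 + y)^-1 + (1 - y)^-1 = 2 / (1 - y ^+ 2)); last first.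
  by field; apply/and3P; split; apply: lt0r_neq0; nra.
rewrite subr_ge0 ler_pdivrMr; last by nra.
rewrite (_ : 2 * _ * _ = 2 + y ^+ 4 / 7 * (1 - 15 * y ^+ 2)); last by field.
by rewrite lerDl mulr_ge0 ?divr_ge0 ?exprn_ge0//; nra.
Qed.

(** From 3 = (4/3)^3 (9/8)^2, where 4/3 and 9/8 have the form (1 + u) / (1 - u)
with u = 1/7 and u = 1/17. *)
Lemma ln3_bounds : 11 / 10 - 1 / 714 <= ln (3 : R) <= 11 / 10 - 1 / 725.
Proof.
have p (z : R) : 0 < z -> z \is Num.pos by rewrite posrE.
have h7 : ln (1 + 1 / 7 : R) - ln (1 - 1 / 7) = ln (4 / 3).
  rewrite -ln_div ?p//; [by congr ln; field|lra..].
have h17 : ln (1 + 1 / 17 : R) - ln (1 - 1 / 17) = ln (9 / 8).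
  rewrite -ln_div ?p//; [by congr ln; field|lra..].
have e : ln (3 : R) = 3 * ln (4 / 3) + 2 * ln (9 / 8).
  rewrite [in LHS](_ : 3 = (4 / 3) ^+ 3 * (9 / 8) ^+ 2); last by field.
  have h4 : 0 < 4 / 3 :> R by lra.
  have h9 : 0 < 9 / 8 :> R by lra.
  by rewrite lnM ?p ?exprn_gt0// !lnXn// !mulr_natl.
have /andP[a1 a2] : 2 * ((1 / 7) + (1 / 7) ^+ 3 / 3 + (1 / 7) ^+ 5 / 5) <= ln (4 / 3 : R)
    <= 2 * ((1 / 7) + (1 / 7) ^+ 3 / 3 + (1 / 7) ^+ 5 * (3 / 14)).
  by rewrite -h7; apply: ln_ratio_bounds; lra.
have /andP[b1 b2] : 2 * ((1 / 17) + (1 / 17) ^+ 3 / 3 + (1 / 17) ^+ 5 / 5) <= ln (9 / 8 : R)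
    <= 2 * ((1 / 17) + (1 / 17) ^+ 3 / 3 + (1 / 17) ^+ 5 * (3 / 14)).
  by rewrite -h17; apply: ln_ratio_bounds; lra.
by rewrite e; apply/andP; split; lra.
Qed.

End elementary_bounds.

(** * Trigonometric sums *)

Section trigonometric_sums.
Variable R : realType.
Implicit Types x r : R.

Lemma sin_ge_half x : 0 <= x <= 3 / 2 -> x / 2 <= sin x.
Proof.
case/andP=> x0 x1; have := sin_ge_cubic x0.
suff : x ^+ 3 <= x * (9 / 4) by lra.
by rewrite exprS ler_wpM2l//; nra.
Qed.

Lemma sum_cos_telescope N x :
  2 * sin (x / 2) * (\sum_(i < N) cos (i.+1%:R * x))
  = sin ((N%:R + 1 / 2) * x) - sin (x / 2).
Proof.
elim: N => [|N IH].
  by rewrite big_ord0 mulr0 add0r mulrC mul1r subrr.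
rewrite big_ord_recr mulrDr IH /= -[N.+1%:R]natr1.
set m : R := N%:R.
rewrite (_ : (m + 1 + 1 / 2) * x = (m + 1) * x + x / 2); last by field.
rewrite (_ : (m + 1 / 2) * x = (m + 1) * x - x / 2); last by field.
by rewrite sinB sinD; ring.
Qed.

Lemma sum_cos_le N x : x != 0 -> `|x| <= 3 / 2 ->
  \sum_(i < N) cos (i.+1%:R * x) <= 4 / `|x|.
Proof.
wlog x0 : x / 0 < x.
  move=> H x0 x1; have [xp|xn] := ltP 0 x; first exact: H.
  have xn' : x < 0 by rewrite lt_neqAle x0.
  rewrite -normrN; under eq_bigr => i _ do rewrite -cosN -mulrN.
  by apply: H; rewrite ?oppr_gt0 ?oppr_eq0 ?normrN.
rewrite gtr0_norm// => _ x1.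
have s0 : x / 4 <= sin (x / 2).
  by have := @sin_ge_half (x / 2); rewrite ler_pdivrMr//; lra.
have s1 : 0 < sin (x / 2) by lra.
rewrite ler_pdivlMr//.
have := sum_cos_telescope N x.
have := sin_le1 ((N%:R + 1 / 2) * x); have := sin_geN1 (x / 2).
set S := \sum_(i < N) _; set y := sin _; set z := sin _ => hy hz e.
have [S0|S0] := leP 0 S; last by nra.
have : S * (x / 4) <= S * y by rewrite ler_wpM2l.
by lra.
Qed.

(** The value of 1 - 2 r cos x + r^2 is the squared distance from 1 to r e^(ix);
minus half its logarithm is the generating function of cos (n x) / n in r. *)
Let q x r : R := 1 - 2 * r * cos x + r ^+ 2.

Lemma abel_sum_cos N x r :
  (\sum_(i < N) r ^+ i * cos (i.+1%:R * x)) * q x r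
  = cos x - r - r ^+ N * (cos (N.+1%:R * x) - r * cos (N%:R * x)).
Proof.
elim: N => [|N IH].
  by rewrite big_ord0 expr0 mulr0n !mul0r !mul1r cos0; ring.
rewrite big_ord_recr mulrDl IH /=.
have -> : N.+2%:R * x = N.+1%:R * x + x by rewrite -[N.+2%:R]natr1; ring.
have e : N%:R * x = N.+1%:R * x - x by rewrite -[N.+1%:R]natr1; ring.
have := cos2Dsin2 x; rewrite e cosB cosD /q [r ^+ N.+1]exprS => h.
set a := cos _; set b := sin _; set c := cos x; set s := sin x.
ring.
Qed.

(** At r = 1 the generating function leaves a truncation error of order
1 / (N |x|): its derivative in r is at most r^N / |1 - r e^(ix)|. *)
Lemma sum_cos_div_approx N x : x != 0 -> `|x| <= 3 / 2 ->
  `|\sum_(i < N) cos (i.+1%:R * x) / i.+1%:R + ln (2 - 2 * cos x) / 2|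
  <= 2 / `|x| / N.+1%:R.
Proof.
move=> x0 x1; have px : 0 < `|x| by rewrite normr_gt0.
have sin2 : (x / 2) ^+ 2 <= sin x ^+ 2.
  have h : `|x| / 2 <= sin `|x| by apply: sin_ge_half; rewrite ltW.
  have -> : sin x ^+ 2 = sin `|x| ^+ 2.
    by case: (ger0P x) => // _; rewrite sinN sqrrN.
  have -> : (x / 2) ^+ 2 = (`|x| / 2) ^+ 2.
    by rewrite -[LHS]ger0_norm ?sqr_ge0// normrX normrM [`|2^-1|]gtr0_norm.
  by rewrite ler_sqr ?nnegrE ?divr_ge0//; lra.
have qE r : q x r = (cos x - r) ^+ 2 + sin x ^+ 2.
  by rewrite /q -[X in X - _](cos2Dsin2 x); ring.
have q_ge r : x ^+ 2 / 4 <= q x r by rewrite qE; have := sqr_ge0 (cos x - r); lra.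
have x2 : 0 < x ^+ 2 by rewrite exprn_even_gt0.
have q_gt r : 0 < q x r by have := q_ge r; lra.
pose F r := \sum_(i < N) r ^+ i.+1 * (cos (i.+1%:R * x) / i.+1%:R)
  + ln (q x r) / 2.
pose dF r := \sum_(i < N) r ^+ i * cos (i.+1%:R * x) + (r - cos x) / q x r.
have hF r : 0 <= r <= 1 -> der F r (dF r).
  move=> _; rewrite /F /dF; apply: derD.
    apply: (der_sum (F := fun i r => r ^+ i.+1 * (cos (i.+1%:R * x) / i.+1%:R))
      (G := fun i => r ^+ i * cos (i.+1%:R * x))) => i _.
    der; rewrite /=.
    by have : 0 <= i%:R :> R by []; move=> ?; field; apply: lt0r_neq0; lra.
  have hq : der (q x) r (2 * r - 2 * cos x) by rewrite /q; der; rewrite /=; ring.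
  apply: der_eq; first by apply: derM; [apply: der_ln hq|exact: der_cst].
  by rewrite mulr0 addr0; field; rewrite gt_eqF.
have dFE r : dF r = - (r ^+ N * (cos (N.+1%:R * x) - r * cos (N%:R * x))) / q x r.
  rewrite /dF; apply: (mulIf (x := q x r)); first by rewrite gt_eqF.
  by rewrite mulrDl abel_sum_cos !divfK ?gt_eqF//; ring.
have hG r : 0 <= r <= 1 ->
    der (fun r => 2 / `|x| / N.+1%:R * r ^+ N.+1) r (2 / `|x| * r ^+ N).
  move=> _; der; rewrite /=; have ? : 0 <= N%:R :> R by [].
  by field; apply/andP; split; apply: lt0r_neq0; lra.
have := der_dominated ler01 hF hG.
have -> : F 0 = 0.
  rewrite /F big1 => [|i _]; last by rewrite exprS !mul0r.
  by rewrite /q !(mulr0, mul0r) subr0 expr0n addr0 ln1 mul0r addr0.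
rewrite subr0 expr1n mulr1 expr0n mulr0 subr0 => H.
have -> : \sum_(i < N) cos (i.+1%:R * x) / i.+1%:R + ln (2 - 2 * cos x) / 2 = F 1.
  rewrite /F; congr (_ + ln _ / 2); last by rewrite /q; ring.
  by apply: eq_bigr => i _; rewrite expr1n mul1r.
apply: H => r /andP[r0 _]; rewrite dFE mulNr normrN.
set A := (cos _ - _).
have A2 : A ^+ 2 <= q x r.
  rewrite /A (_ : N.+1%:R * x = N%:R * x + x); last by rewrite -[N.+1%:R]natr1; ring.
  rewrite cosD qE; have := cos2Dsin2 (N%:R * x).
  set a := cos (N%:R * x); set b := sin (N%:R * x); set c := cos x; set s := sin x.
  move=> hab; rewrite -[leRHS]mul1r -hab.
  rewrite -subr_ge0 (_ : _ - _ = (b * (c - r) + a * s) ^+ 2) ?sqr_ge0//; ring.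
rewrite -[_ * A / _]mulrA normrM (ger0_norm (exprn_ge0 _ r0)) mulrC ler_wpM2r ?exprn_ge0//.
rewrite -ler_sqr ?nnegrE ?divr_ge0// real_normK ?num_real//.
rewrite !exprMn !exprVn real_normK ?num_real// ler_pdivrMr ?exprn_gt0//.
have : A ^+ 2 * x ^+ 2 <= 4 * q x r ^+ 2.
  rewrite [q x r ^+ 2]expr2; have := q_ge r; have := q_gt r; have := sqr_ge0 A; nra.
move=> h; rewrite -natrX [leRHS]mulrAC ler_pdivlMr//.
Qed.

End trigonometric_sums.

(** * The difference of two independent Cantor points *)

Section difference_law.
Variable R : realType.
Implicit Types (f g : R -> R) (x c : R) (K : nat).

(** Expectation of f at the sum of e_k / 3^k over k < K, where the e_k are
independent and take the values -1, 0, 1 with probabilities 1/4, 1/2, 1/4: the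
law of the difference of two independent points of the K-th stage of the
rescaled Cantor set. The first term e_0 is split off. *)
Fixpoint diff_mean K f : R :=
  if K is K'.+1 then
    (diff_mean K' (fun x => f (x / 3 - 1)) + 2 * diff_mean K' (fun x => f (x / 3))
     + diff_mean K' (fun x => f (x / 3 + 1))) / 4
  else f 0.

Lemma diff_mean_le K f g : (forall x, `|x| <= 3 / 2 -> f x <= g x) ->
  diff_mean K f <= diff_mean K g.
Proof.
elim: K f g => [|K IH] f g fg /=; first by apply: fg; rewrite normr0 divr_ge0.
rewrite ler_pM2r ?invr_gt0// !lerD// ?ler_pM2l//; apply: IH => x;
  rewrite ler_norml => /andP[? ?]; apply: fg; rewrite ler_norml;
  apply/andP; split; lra.
Qed.

Lemma eq_diff_mean K f g : (forall x, `|x| <= 3 / 2 -> f x = g x) ->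
  diff_mean K f = diff_mean K g.
Proof.
by move=> fg; apply/eqP; rewrite eq_le; apply/andP; split;
  apply: diff_mean_le => x /fg ->.
Qed.

Lemma diff_meanD K f g :
  diff_mean K (fun x => f x + g x) = diff_mean K f + diff_mean K g.
Proof. by elim: K f g => [//|K IH] f g /=; rewrite !IH; lra. Qed.

Lemma diff_meanZ K c f : diff_mean K (fun x => c * f x) = c * diff_mean K f.
Proof. by elim: K f => [//|K IH] f /=; rewrite !IH; lra. Qed.

Lemma diff_mean_cst K c : diff_mean K (fun=> c) = c.
Proof. by elim: K => [//|K IH] /=; rewrite !IH; lra. Qed.

Lemma diff_mean_sum K N (F : nat -> R -> R) :
  diff_mean K (fun x => \sum_(i < N) F i x) = \sum_(i < N) diff_mean K (F i).
Proof.
elim: N => [|N IH].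
  rewrite big_ord0 -[RHS](diff_mean_cst K 0).
  by apply: eq_diff_mean => x _; rewrite big_ord0.
rewrite big_ord_recr /= -IH -diff_meanD.
by apply: eq_diff_mean => x _; rewrite big_ord_recr.
Qed.

Lemma diff_meanS K f : diff_mean K.+1 f
  = diff_mean K (fun x => (f (x / 3 - 1) + 2 * f (x / 3) + f (x / 3 + 1)) / 4).
Proof.
rewrite /= -diff_meanZ -!diff_meanD mulrC -diff_meanZ.
by apply: eq_diff_mean => x _; rewrite mulrC.
Qed.

Lemma diff_mean_cos K c : diff_mean K (fun x => cos (c * x))
  = \prod_(i < K) ((1 + cos (c / 3 ^+ i)) / 2).
Proof.
elim: K c => [|K IH] c; first by rewrite big_ord0 /= mulr0 cos0.
rewrite big_ord_recl expr0 divr1 diff_meanS.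
rewrite (_ : \prod_(i < K) _ = diff_mean K (fun x => cos (c / 3 * x))); last first.
  rewrite IH; apply: eq_bigr => i _.
  by rewrite /= /bump /= exprS invfM mulrA.
rewrite -diff_meanZ; apply: eq_diff_mean => x _.
have -> : c * (x / 3 - 1) = c / 3 * x - c by field.
have -> : c * (x / 3 + 1) = c / 3 * x + c by field.
have -> : c * (x / 3) = c / 3 * x by field.
by rewrite cosB cosD; field.
Qed.

(** The first nonzero e_k cannot be cancelled by the later terms, so the sum
vanishes only if every e_k does. *)
Lemma diff_mean_eq0 K : diff_mean K (fun x => (x == 0)%:R) = 2 ^- K.
Proof.
elim: K => [|K IH]; first by rewrite /= eqxx invr1.
rewrite diff_meanS exprS invfM -IH -diff_meanZ; apply: eq_diff_mean => x.
rewrite ler_norml => /andP[? ?].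
rewrite (_ : (x / 3 - 1 == 0) = false); last by apply: lt_eqF; lra.
rewrite (_ : (x / 3 + 1 == 0) = false); last by apply: gt_eqF; lra.
rewrite (_ : (x / 3 == 0) = (x == 0)); last by rewrite mulf_eq0 invr_eq0 pnatr_eq0 orbF.
by case: (x == 0); rewrite /= ?mulr1n ?mulr0n; lra.
Qed.

(** A nonzero difference whose first nonzero digit is e_k is of size 3^-k and
this happens with probability 2^-(k+1); hence the growth like (3/2)^K. *)
Lemma diff_mean_inv K : diff_mean K (fun x => `|x|^-1) <= 2 * (3 / 2) ^+ K.
Proof.
suff : diff_mean K (fun x => `|x|^-1) <= 2 * ((3 / 2) ^+ K - 1) by lra.
elim: K => [|K IH]; first by rewrite /= normr0 invr0 expr0 subrr mulr0.
rewrite diff_meanS.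
apply: (@le_trans _ _ (diff_mean K (fun x => 3 / 2 * `|x|^-1 + 1))); last first.
  by rewrite diff_meanD diff_mean_cst diff_meanZ exprS; lra.
apply: diff_mean_le => x; rewrite ler_norml => /andP[? ?].
rewrite (_ : `|x / 3|^-1 = 3 * `|x|^-1); last first.
  by rewrite normrM [`|3^-1|]ger0_norm// invfM invrK mulrC.
have inv2 (y : R) : 1 / 2 <= y -> y^-1 <= 2.
  by move=> hy; rewrite -[leRHS]invrK -[2^-1]div1r lef_pV2 ?posrE//; lra.
have h1 : `|x / 3 - 1|^-1 <= 2.
  by apply: inv2; rewrite ltr0_norm; lra.
have h2 : `|x / 3 + 1|^-1 <= 2.
  by apply: inv2; rewrite gtr0_norm; lra.
by lra.
Qed.

Let moment K j := diff_mean K (fun x => x ^+ j).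

Lemma moment2S K : moment K.+1 2 = moment K 2 / 9 + 1 / 2.
Proof.
rewrite /moment diff_meanS -[X in _ + X](diff_mean_cst K) [in RHS]mulrC -diff_meanZ.
by rewrite -diff_meanD; apply: eq_diff_mean => x _; field.
Qed.

Lemma moment4S K : moment K.+1 4 = 81^-1 * moment K 4 + 3^-1 * moment K 2 + 1 / 2.
Proof.
rewrite /moment diff_meanS -[X in _ + X](diff_mean_cst K) -!diff_meanZ.
by rewrite -!diff_meanD; apply: eq_diff_mean => x _; field.
Qed.

Lemma moment6S K : moment K.+1 6 =
  729^-1 * moment K 6 + 5 / 54 * moment K 4 + 5 / 6 * moment K 2 + 1 / 2.
Proof.
rewrite /moment diff_meanS -[X in _ + X](diff_mean_cst K) -!diff_meanZ.
by rewrite -!diff_meanD; apply: eq_diff_mean => x _; field.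
Qed.

(** The moments increase to 9/16, 891/1280 and 385641/372736; the bounds are
invariants of the recursion. *)
Lemma moments_le K :
  [/\ moment K 2 <= 9 / 16, moment K 4 <= 891 / 1280 & moment K 6 <= 1035 / 1000].
Proof.
elim: K => [|K [h2 h4 h6]].
  by rewrite /moment /= !expr0n /=; split; lra.
by rewrite moment2S moment4S moment6S; split; lra.
Qed.

Lemma moments_ge K :
  [/\ 562 / 1000 <= moment K.+4 2, 695 / 1000 <= moment K.+4 4
    & 103 / 100 <= moment K.+4 6].
Proof.
elim: K => [|K [h2 h4 h6]].
  rewrite !(moment2S, moment4S, moment6S) /moment /= !expr0n /=.
  by split; lra.
by rewrite moment2S moment4S moment6S; split; lra.
Qed.

End difference_law.

(** * The logarithmic energy *)

Section energy.
Variable R : realType.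
Implicit Types (x y u : R) (K N : nat).

Local Notation dm := (@diff_mean R).

(** The value - ln |1 - e^(ix)| of the sum of cos (n x) / n. At x = 0 it is 0,
through the default value of ln, so that expectations of it silently leave out
the atom of the difference law at 0. *)
Definition log_kernel x : R := - (ln (2 - 2 * cos x) / 2).

(** The Taylor polynomials of sin y / y have the form 1 - u with u close to
y^2 / 6; the bounds for ln (1 - u) then apply. *)
Lemma ln_sinc_bounds y : 0 < y <= 3 / 4 ->
  - ln y + y ^+ 2 / 6 <= - ln (sin y)
    <= - ln y + y ^+ 2 / 6 + (1000^-1 * 16) * y ^+ 4.
Proof.
case/andP=> y0 y1.
have y2 : y ^+ 2 <= 9 / 16 by nra.
have y20 : 0 <= y ^+ 2 by rewrite sqr_ge0.
have y4 : y ^+ 4 = y ^+ 2 * y ^+ 2 by rewrite -exprD.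
have y6 : y ^+ 6 = y ^+ 2 * y ^+ 2 * y ^+ 2 by rewrite -!exprD.
have ps : 0 < sin y by have := @sin_ge_half R y; lra.
have lnm u : u < 1 -> ln (y * (1 - u)) = ln y + ln (1 - u).
  by move=> u1; rewrite lnM// posrE; lra.
apply/andP; split.
  set u := y ^+ 2 / 6 - y ^+ 4 / 120.
  have u01 : 0 <= u <= 1 / 4 by rewrite /u y4; apply/andP; split; nra.
  have h : sin y <= y * (1 - u).
    rewrite (_ : y * (1 - u) = y - y ^+ 3 / 6 + y ^+ 5 / 120).
      exact/sin_le_quintic/ltW.
    by rewrite /u; field.
  have h2 : ln (sin y) <= ln y + ln (1 - u).
    have /andP[_ ?] := u01.
    by rewrite -lnm ?ler_ln ?posrE//; [apply: mulr_gt0 => //|]; lra.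
  have := ln_onem_ge u01.
  have : 0 <= u ^+ 3 / 3 by rewrite divr_ge0 ?exprn_ge0//; case/andP: u01.
  have : y ^+ 4 / 120 <= u ^+ 2 / 2.
    have hu : y ^+ 2 / 7 <= u by rewrite /u y4; nra.
    have : (y ^+ 2 / 7) * (y ^+ 2 / 7) <= u * u by apply: ler_pM => //; lra.
    by rewrite y4 expr2; nra.
  by rewrite {3}/u; lra.
set u := y ^+ 2 / 6.
have u01 : 0 <= u <= 1 / 4 by rewrite /u; apply/andP; split; lra.
have h : y * (1 - u) <= sin y.
  rewrite (_ : y * (1 - u) = y - y ^+ 3 / 6); last by rewrite /u; field.
  exact/sin_ge_cubic/ltW.
have h2 : ln y + ln (1 - u) <= ln (sin y).
  have /andP[_ ?] := u01.
  by rewrite -lnm ?ler_ln ?posrE//; [apply: mulr_gt0 => //|]; lra.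
have := ln_onem_le u01.
have : u ^+ 2 / 2 + 4 / 9 * u ^+ 3 <= 1000^-1 * 16 * y ^+ 4.
  rewrite y4 /u; move: (y ^+ 2) y2 y20 => w w1 w0.
  have : w * w * w <= w * w * (9 / 16) by apply: ler_wpM2l => //; nra.
  have : 0 <= w * w by rewrite mulr_ge0.
  by lra.
by lra.
Qed.

Lemma log_kernel_bounds x : `|x| <= 3 / 2 ->
  - ln `|x| + 24^-1 * x ^+ 2 <= log_kernel x
    <= - ln `|x| + 24^-1 * x ^+ 2 + 1000^-1 * x ^+ 4.
Proof.
move=> x1; have [->|x0] := eqVneq x 0.
  rewrite /log_kernel cos0 mulr1 subrr normr0 !expr0n /= !mulr0 !ln0// mul0r.
  by apply/andP; split; lra.
have px : 0 < `|x| by rewrite normr_gt0.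
have -> : log_kernel x = - ln 2 - ln (sin (`|x| / 2)).
  have s0 : 0 < sin (`|x| / 2) by have := @sin_ge_half R (`|x| / 2); lra.
  have -> : - ln 2 - ln (sin (`|x| / 2)) = - (ln ((2 * sin (`|x| / 2)) ^+ 2) / 2).
    rewrite lnXn ?mulr_gt0// lnM ?posrE// -mulr_natl; lra.
  rewrite /log_kernel -(cos_norm x); congr (- (ln _ / 2)).
  rewrite [in LHS](_ : `|x| = (`|x| / 2) *+ 2); last by rewrite mulr2n; field.
  by rewrite cos_mulr2n exprMn sin2cos2 mulr2n; ring.
have y34 : 0 < `|x| / 2 <= 3 / 4 by apply/andP; split; lra.
have := ln_sinc_bounds y34.
have -> : ln (`|x| / 2) = ln `|x| - ln 2 by rewrite ln_div ?posrE.
have -> : (`|x| / 2) ^+ 2 = x ^+ 2 / 4.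
  by rewrite exprMn real_normK ?num_real//; field.
have -> : (`|x| / 2) ^+ 4 = x ^+ 4 / 16.
  rewrite (_ : x ^+ 4 = (x ^+ 2) ^+ 2); last by rewrite -exprM.
  by rewrite -(real_normK (num_real x)); field.
by move=> /andP[? ?]; apply/andP; split; lra.
Qed.

Let lam K := dm K (fun x => - ln (1 - x ^+ 2 / 9)).

Let sq_ninth x : `|x| <= 3 / 2 -> 0 <= x ^+ 2 / 9 <= 1 / 4.
Proof.
move=> h; rewrite -[x ^+ 2]real_normK ?num_real//.
by have := normr_ge0 x; move=> ?; apply/andP; split; nra.
Qed.

Let lam_le K : lam K <= 3372 / 1000 / 50.
Proof.
apply: (@le_trans _ _ (dm K (fun x => 9^-1 * x ^+ 2
    + (162^-1 * x ^+ 4 + 4 / 9 / 729 * x ^+ 6)))).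
  apply: diff_mean_le => x /sq_ninth/ln_onem_le H; apply: le_trans H _.
  by rewrite le_eqVlt; apply/orP; left; apply/eqP; field.
rewrite !diff_meanD !diff_meanZ; have [] := moments_le R K; lra.
Qed.

Let lam_ge K : 6718 / 1000 / 100 <= lam K.+4.
Proof.
apply: (@le_trans _ _ (dm K.+4 (fun x => 9^-1 * x ^+ 2
    + (162^-1 * x ^+ 4 + 2187^-1 * x ^+ 6)))); last first.
  apply: diff_mean_le => x /sq_ninth/ln_onem_ge H; apply: le_trans H.
  by rewrite le_eqVlt; apply/orP; left; apply/eqP; field.
rewrite !diff_meanD !diff_meanZ; have [] := moments_ge R K; lra.
Qed.

Let ent K := dm K (fun x => - ln `|x|).

(** Self-similarity of the logarithmic energy: with probability 1/2 the leading
digits agree, which rescales the difference by 1/3, and otherwise the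
difference stays away from 0. *)
Let entS K : ent K.+1 = ent K / 2 + ln 3 / 2 * (1 - 2 ^- K) + lam K / 4.
Proof.
rewrite /ent /lam diff_meanS -(diff_mean_eq0 R K) ![_ / 2]mulrC ![_ / 4]mulrC.
rewrite mulrBr mulr1 -!diff_meanZ -[X in _ + (X - _) + _](diff_mean_cst K).
rewrite -[X in _ + (_ + X) + _]mulN1r -!diff_meanZ -!diff_meanD.
apply: eq_diff_mean => x h; have := h; rewrite ler_norml => /andP[? ?].
have -> : ln `|x / 3| = ln `|x| - ln 3 + ln 3 * (x == 0)%:R.
  have [->|x0] := eqVneq x 0; first by rewrite mul0r normr0 ln0// mulr1; lra.
  by rewrite normrM [`|3^-1|]gtr0_norm// ln_div ?posrE ?normr_gt0// mulr0 addr0.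
have -> : 1 - x ^+ 2 / 9 = `|x / 3 - 1| * `|x / 3 + 1|.
  by rewrite ltr0_norm ?gtr0_norm; [field|lra..].
have p1 : 0 < `|x / 3 - 1| by rewrite normr_gt0 ltr0_neq0//; lra.
have p2 : 0 < `|x / 3 + 1| by rewrite normr_gt0 lt0r_neq0//; lra.
by rewrite lnM ?posrE//; field.
Qed.

(** The recursion contracts by 1/2, so a bound that it preserves holds for all K. *)
Let ent_le K : ent K <= ln 3 + 3372 / 1000 / 100.
Proof.
have /andP[l3 _] := ln3_bounds R.
elim: K => [|K IH]; first by rewrite /ent /= normr0 ln0//; lra.
rewrite entS; have := lam_le K.
have : ln 3 / 2 * (1 - 2 ^- K) <= ln 3 / 2 :> R.
  by rewrite ger_pMr; [rewrite gerBl invr_ge0 exprn_ge0|lra].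
by lra.
Qed.

Let ent_ge K : ln 3 + 6718 / 1000 / 200 - 4 * (3 / 4) ^+ K <= ent K.+4.
Proof.
have /andP[l3 l3'] := ln3_bounds R.
elim: K => [|K IH].
  suff : - 1 <= ent 4 by rewrite expr0; lra.
  rewrite -(diff_mean_cst 4 (-1)) /ent; apply: diff_mean_le => x x1.
  have [->|x0] := eqVneq x 0; first by rewrite normr0 ln0//; lra.
  rewrite lerN2; have px : 0 < `|x| by rewrite normr_gt0.
  have := @le_ln1Dx R (`|x| - 1); rewrite subrKC => h.
  by apply: le_trans (h _) _; lra.
rewrite entS; have := lam_ge K.
have : (2 ^- K.+4 : R) <= (3 / 4) ^+ K.
  rewrite -exprVn; apply: (@le_trans _ _ ((2^-1) ^+ K)).
    by rewrite -addn4 exprD ger_pMr ?exprn_gt0// exprn_ile1//; lra.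
  by apply: lerXn2r; rewrite ?nnegrE; lra.
have k0 : 0 <= (3 / 4 : R) ^+ K by rewrite exprn_ge0//; lra.
have z0 : 0 <= (2 ^- K.+4 : R) by rewrite invr_ge0 exprn_ge0.
have : ln 3 / 2 * (2 ^- K.+4) <= 2 ^- K.+4 :> R by rewrite ler_piMl//; lra.
by rewrite [(3 / 4) ^+ K.+1]exprS; lra.
Qed.

Lemma log_energy_le K : dm K log_kernel <= 2313 / 2000.
Proof.
apply: (@le_trans _ _ (dm K (fun x => - ln `|x| + 24^-1 * x ^+ 2
    + 1000^-1 * x ^+ 4))).
  by apply: diff_mean_le => x /log_kernel_bounds/andP[].
rewrite !diff_meanD !diff_meanZ; have := ent_le K; rewrite /ent.
have [] := moments_le R K; have := ln3_bounds R; lra.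
Qed.

Lemma log_energy_ge K : 2311 / 2000 - 4 * (3 / 4) ^+ K <= dm K.+4 log_kernel.
Proof.
apply: (@le_trans _ _ (dm K.+4 (fun x => - ln `|x| + 24^-1 * x ^+ 2))); last first.
  by apply: diff_mean_le => x /log_kernel_bounds/andP[].
rewrite !diff_meanD !diff_meanZ; have := ent_ge K; rewrite /ent.
have [] := moments_ge R K; have := ln3_bounds R; lra.
Qed.

End energy.

(** * Sums of squared Cantor coefficients *)

Section coefficient_sums.
Variable R : realType.
Local Notation dm := (@diff_mean R).

(** Each block from b^K to b^(K+1) contributes at most b - 1. *)
Lemma harmonic_le b K : (0 < b)%N ->
  \sum_(0 <= i < b ^ K) (i.+1%:R : R)^-1 <= 1 + (b.-1 * K)%:R.
Proof.
move=> b0; elim: K => [|K IH]; first by rewrite expn0 big_nat1 invr1 muln0 addr0.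
have bK0 : (0 < b ^ K)%N by rewrite expn_gt0 b0.
have hle : (b ^ K <= b ^ K.+1)%N by rewrite leq_pexp2l.
rewrite (big_cat_nat _ hle)//= mulnS natrD [X in _ <= _ + X]addrC addrA lerD//.
apply: (@le_trans _ _ (\sum_(b ^ K <= i < b ^ K.+1) (b ^ K)%:R^-1)).
  rewrite !big_nat; apply: ler_sum => i /andP[h _].
  by rewrite lef_pV2 ?posrE ?ltr0n// ler_nat (leq_trans h).
rewrite sumr_const_nat expnS -[X in (_ - X)%N]mul1n -mulnBl.
by rewrite subn1 -[leLHS]mulr_natl natrM mulfK// pnatr_eq0 -lt0n.
Qed.

Variable p : nat -> R.
Hypothesis p_ge0 : forall n, 0 <= p n.
Hypothesis p_le : forall K n, p n <= dm K (fun x => cos (n%:R * x)).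
Hypothesis p_ge : forall K n, dm K (fun x => cos (n%:R * x)) - p n <= 6 * n%:R / 3 ^+ K.

(** Averaging the bound min (N, 4 / |x|) for the cosine sum over the law of the
difference: the atom at 0 contributes (3/2)^K and the rest 4 E(1 / |x|). *)
Lemma sum_coef_le K : \sum_(0 <= i < 3 ^ K) p i.+1 <= 9 * (3 / 2) ^+ K.
Proof.
rewrite big_mkord.
apply: (@le_trans _ _ (dm K (fun x => \sum_(i < 3 ^ K) cos (i.+1%:R * x)))).
  by rewrite (diff_mean_sum _ _ (fun i x => cos (i.+1%:R * x))); apply: ler_sum.
apply: (@le_trans _ _ (dm K (fun x => 4 * `|x|^-1 + (3 ^ K)%:R * (x == 0)%:R))).
  apply: diff_mean_le => x x1; have [->|x0] := eqVneq x 0.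
    rewrite normr0 invr0 mulr0 add0r mulr1.
    under eq_bigr => i _ do rewrite mulr0 cos0.
    by rewrite sumr_const card_ord.
  by rewrite mulr0 addr0; exact: sum_cos_le.
rewrite diff_meanD !diff_meanZ diff_mean_eq0 natrX -expr_div_n.
by have := diff_mean_inv R K; lra.
Qed.

(** On the block from 3^K to 3^(K+1) the weight 1/n is at most 3^-K, against the
sum of coefficients (3/2)^(K+1). *)
Lemma sum_coef_div_block K :
  \sum_(3 ^ K <= i < 3 ^ K.+1) p i.+1 / i.+1%:R <= 27 * (2 ^- K - 2 ^- K.+1).
Proof.
apply: (@le_trans _ _ (\sum_(3 ^ K <= i < 3 ^ K.+1) p i.+1 * (3 ^ K)%:R^-1)).
  rewrite !big_nat; apply: ler_sum => i /andP[h _].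
  rewrite ler_wpM2l// lef_pV2 ?posrE ?ltr0n ?expn_gt0// ler_nat.
  exact: leq_trans h (leqnSn _).
rewrite -mulr_suml ler_pdivrMr ?ltr0n ?expn_gt0//.
have hle : (3 ^ K <= 3 ^ K.+1)%N by rewrite leq_pexp2l.
have := sum_coef_le K.+1; rewrite (big_cat_nat _ hle)//= => h.
have h0 : 0 <= \sum_(0 <= i < 3 ^ K) p i.+1 by apply: sumr_ge0.
have -> : 27 * (2 ^- K - 2 ^- K.+1) * (3 ^ K)%:R = 9 * (3 / 2) ^+ K.+1 :> R.
  rewrite natrX expr_div_n !exprS invfM; field.
  by rewrite expf_neq0.
by lra.
Qed.

Lemma sum_coef_div_blocks K J : (K <= J)%N ->
  \sum_(3 ^ K <= i < 3 ^ J) p i.+1 / i.+1%:R <= 27 * (2 ^- K - 2 ^- J).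
Proof.
move=> /subnK <-; elim: (J - K)%N => [|m IH].
  by rewrite add0n big_geq// subrr mulr0.
rewrite addSn (@big_cat_nat _ _ _ (3 ^ (m + K)))/= ?leq_pexp2l ?leq_addl//.
have := sum_coef_div_block (m + K); lra.
Qed.

Let S N : R := \sum_(0 <= i < N) p i.+1 / i.+1%:R.

Let S_nd : {homo S : m n / (m <= n)%N >-> m <= n}.
Proof.
move=> m n mn; rewrite /S (big_cat_nat _ mn)//= lerDl.
by apply: sumr_ge0 => i _; rewrite divr_ge0.
Qed.

Let S_le K N : S N <= S (3 ^ K) + 27 * 2 ^- K.
Proof.
have h : (N <= 3 ^ (N + K))%N.
  by apply: leq_trans (leq_addr K N) _; exact/ltnW/ltn_expl.
apply: le_trans (S_nd h) _.
have hle : (3 ^ K <= 3 ^ (N + K))%N by rewrite leq_pexp2l ?leq_addl.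
rewrite /S (big_cat_nat _ hle)//= lerD2l.
have := sum_coef_div_blocks (leq_addl N K).
have : 0 <= (2 ^- (N + K) : R) by rewrite invr_ge0 exprn_ge0.
by lra.
Qed.

Lemma coef_div_cvg : cvgn (series (fun k => p k.+1 / k.+1%:R)).
Proof.
apply: nondecreasing_is_cvgn; first exact: S_nd.
exists (S (3 ^ 0) + 27 * 2 ^- 0) => _ [N _ <-]; exact: S_le.
Qed.

Let C := limn (series (fun k => p k.+1 / k.+1%:R)).

Lemma sum_coef_div_le N : \sum_(0 <= i < N) p i.+1 / i.+1%:R <= C.
Proof. exact: (nondecreasing_cvgn_le S_nd coef_div_cvg). Qed.

Lemma sum_coef_div_tail K :
  C <= \sum_(0 <= i < 3 ^ K) p i.+1 / i.+1%:R + 27 * 2 ^- K.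
Proof.
by apply: limr_le; [exact: coef_div_cvg|apply: nearW => N; exact: S_le].
Qed.

(** Truncating at n <= 2^K balances the three errors: replacing p by its K-th
approximation, the atom at 0, and the remainder of the sum of cos (n x) / n. *)
Lemma sum_coef_div_energy K :
  `|\sum_(0 <= i < 2 ^ K) p i.+1 / i.+1%:R - dm K (@log_kernel R)|
  <= 12 * (3 / 4) ^+ K.
Proof.
set N := (2 ^ K)%N.
have NE : N%:R = 2 ^+ K :> R by rewrite natrX.
pose D (x : R) := \sum_(i < N) cos (i.+1%:R * x) / i.+1%:R.
have DE : dm K D = \sum_(i < N) dm K (fun x => cos (i.+1%:R * x)) / i.+1%:R.
  rewrite /D (diff_mean_sum _ _ (fun i x => cos (i.+1%:R * x) / i.+1%:R)).
  apply: eq_bigr => i _; rewrite mulrC -diff_meanZ.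
  by apply: eq_diff_mean => x _; rewrite mulrC.
have h1 : `|\sum_(0 <= i < N) p i.+1 / i.+1%:R - dm K D| <= 6 * (2 / 3) ^+ K.
  rewrite distrC DE big_mkord -sumrB; under eq_bigr => i _ do rewrite -mulrBl.
  apply: le_trans (ler_norm_sum _ _ _) _.
  apply: (@le_trans _ _ (\sum_(i < N) 6 / 3 ^+ K)).
    apply: ler_sum => i _; rewrite ger0_norm ?mulr_ge0 ?subr_ge0//.
    rewrite ler_pdivrMr//; apply: le_trans (p_ge K i.+1) _.
    by rewrite mulrAC.
  by rewrite sumr_const card_ord -[leLHS]mulr_natr NE -mulrA [_^-1 * _]mulrC -expr_div_n.
have h2 : `|dm K D - dm K (@log_kernel R)|
    <= 4 * (3 / 4) ^+ K + (1 + K%:R) * 2 ^- K.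
  have -> : dm K D - dm K (@log_kernel R)
      = dm K (fun x => D x + ln (2 - 2 * cos x) / 2).
    rewrite -mulN1r -diff_meanZ -diff_meanD; apply: eq_diff_mean => x _.
    by rewrite /log_kernel; ring.
  set f : R -> R := fun x => _.
  have fb (x : R) : `|x| <= 3 / 2 ->
      `|f x| <= 2 / N%:R * `|x|^-1 + (1 + K%:R) * (x == 0)%:R.
    move=> x1; have [->|x0] := eqVneq x 0.
      rewrite normr0 invr0 mulr0 add0r mulr1 /f /D cos0 mulr1 subrr ln0// mul0r addr0.
      under eq_bigr => i _ do rewrite mulr0 cos0 mul1r.
      rewrite ger0_norm ?sumr_ge0//.
      by have := harmonic_le K (ltn0Sn 1); rewrite mul1n big_mkord.
    rewrite mulr0 addr0; apply: le_trans (sum_cos_div_approx N x0 x1) _.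
    rewrite mulrAC ler_wpM2r ?invr_ge0// ler_wpM2l//.
    by rewrite lef_pV2 ?posrE ?ltr0n ?expn_gt0// ler_nat.
  have bnd : dm K (fun x => 2 / N%:R * `|x|^-1 + (1 + K%:R) * (x == 0)%:R)
      <= 4 * (3 / 4) ^+ K + (1 + K%:R) * 2 ^- K.
    rewrite diff_meanD !diff_meanZ diff_mean_eq0 lerD2r NE.
    have -> : 4 * (3 / 4) ^+ K = 2 / 2 ^+ K * (2 * (3 / 2) ^+ K) :> R.
      rewrite (_ : 3 / 4 = (3 / 2) / 2 :> R); last by field.
      by rewrite [in LHS]expr_div_n; field; rewrite expf_neq0.
    by rewrite ler_wpM2l ?diff_mean_inv// divr_ge0 ?exprn_ge0.
  apply: le_trans bnd; rewrite ler_norml; apply/andP; split.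
    rewrite lerNl -mulN1r -diff_meanZ; apply: diff_mean_le => x /fb.
    by rewrite ler_norml => /andP[]; lra.
  by apply: diff_mean_le => x /fb; rewrite ler_norml => /andP[].
have h3 : (2 / 3 : R) ^+ K <= (3 / 4) ^+ K by apply: lerXn2r; rewrite ?nnegrE; lra.
have h4 : (1 + K%:R) * 2 ^- K <= 2 * (3 / 4) ^+ K :> R.
  elim: (K) => [|k IH]; first by rewrite addr0 invr1 !mulr1; lra.
  have : (2 ^- k : R) <= (3 / 4) ^+ k.
    by rewrite -exprVn; apply: lerXn2r; rewrite ?nnegrE; lra.
  by rewrite !exprS invfM -[k.+1%:R]natr1; lra.
have := ler_distD (dm K D) (S N) (dm K (@log_kernel R)); rewrite /S; lra.
Qed.

(** The partial sum up to 2^K increases to C and follows the energy up to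
12 (3/4)^K; from above, the tail bound at 3^K <= 4^K closes the gap. *)
Lemma sum_coef_div_value : `|C - 1156 / 1000| <= 5 / 10000.
Proof.
have cv4 c : (fun K => c * (3 / 4 : R) ^+ K) @ \oo --> 0.
  have -> : (0 : R) = c * 0 by rewrite mulr0.
  by apply: cvgMr; apply: cvg_expr; rewrite ger0_norm; lra.
suff : 2311 / 2000 <= C <= 2313 / 2000.
  by case/andP=> ? ?; rewrite ler_norml; apply/andP; split; lra.
apply/andP; split.
  suff h K : 2311 / 2000 - 16 * (3 / 4) ^+ K <= C.
    have H : (fun K => 2311 / 2000 - 16 * (3 / 4 : R) ^+ K) @ \oo --> (2311 / 2000 : R).
      by rewrite -[X in _ --> X]subr0; apply: cvgB (cv4 16); exact: cvg_cst.
    by rewrite -(cvg_lim _ H)//; apply: limr_le; [apply: cvgP H|exact: nearW].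
  have := sum_coef_div_le (2 ^ K.+4); have := sum_coef_div_energy K.+4.
  rewrite ler_norml => /andP[]; have := log_energy_ge R K.
  have : (3 / 4 : R) ^+ K.+4 <= (3 / 4) ^+ K.
    by rewrite -[K.+4]addn4 exprD ler_piMr ?exprn_ge0 ?exprn_ile1//; lra.
  lra.
suff h K : C <= 2313 / 2000 + 39 * (3 / 4) ^+ K.
  have H : (fun K => 2313 / 2000 + 39 * (3 / 4 : R) ^+ K) @ \oo --> (2313 / 2000 : R).
    by rewrite -[X in _ --> X]addr0; apply: cvgD (cv4 39); exact: cvg_cst.
  by rewrite -(cvg_lim _ H)//; apply: limr_ge; [apply: cvgP H|exact: nearW].
have := sum_coef_div_energy (2 * K); have := log_energy_le R (2 * K).
have : S (3 ^ K) <= S (2 ^ (2 * K)).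
  by apply: S_nd; rewrite expnM; case: (K) => // k; rewrite leq_exp2r.
have := sum_coef_div_tail K; rewrite -/(S _) ler_norml => Ct S34 E /andP[_ EE].
have : (3 / 4 : R) ^+ (2 * K) <= (3 / 4) ^+ K.
  by rewrite mul2n -addnn exprD ler_piMr ?exprn_ge0 ?exprn_ile1//; lra.
have : (2 ^- K : R) <= (3 / 4) ^+ K.
  by rewrite -exprVn; apply: lerXn2r; rewrite ?nnegrE; lra.
rewrite -/(S _) in EE; lra.
Qed.

End coefficient_sums.

(** * Complex numbers and the complex exponential *)

Local Notation nc := Normc.normc.
Local Notation Re := complex.Re.
Local Notation Im := complex.Im.

Section complex_exponential.
Variable R : realType.
Implicit Types (z w s h : R[i]) (x y : R).

Lemma ReD z w : Re (z + w) = Re z + Re w. Proof. by case: z; case: w. Qed.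
Lemma ImD z w : Im (z + w) = Im z + Im w. Proof. by case: z; case: w. Qed.
Lemma ReN z : Re (- z) = - Re z. Proof. by case: z. Qed.
Lemma ImN z : Im (- z) = - Im z. Proof. by case: z. Qed.
Lemma ReM z w : Re (z * w) = Re z * Re w - Im z * Im w.
Proof. by case: z; case: w. Qed.
Lemma ImM z w : Im (z * w) = Re z * Im w + Im z * Re w.
Proof. by case: z; case: w. Qed.

Lemma Re_sum N (f : nat -> R[i]) :
  Re (\sum_(0 <= n < N) f n) = \sum_(0 <= n < N) Re (f n).
Proof. by apply: (big_morph _ ReD). Qed.

Lemma Im_sum N (f : nat -> R[i]) :
  Im (\sum_(0 <= n < N) f n) = \sum_(0 <= n < N) Im (f n).
Proof. by apply: (big_morph _ ImD). Qed.

Lemma complex_ext z w : Re z = Re w -> Im z = Im w -> z = w.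
Proof. by case: z w => a b [c d] /= -> ->. Qed.

Lemma normc_sqr z : nc z ^+ 2 = Re z ^+ 2 + Im z ^+ 2.
Proof. by case: z => a b /=; rewrite sqr_sqrtr// addr_ge0 ?sqr_ge0. Qed.

Lemma normc_ge0 z : 0 <= nc z. Proof. by case: z => a b; rewrite sqrtr_ge0. Qed.

Lemma normcD_le z w : nc (z + w) <= nc z + nc w.
Proof. exact: (@le_normcD R z w). Qed.

Lemma normcB_le z w : nc (z - w) <= nc z + nc w.
Proof. by rewrite -[nc w](@normcN R w); exact: normcD_le. Qed.

Lemma normc_distC z w : nc (z - w) = nc (w - z).
Proof. by rewrite -[LHS](@normcN R) opprB. Qed.

Lemma normc_real x : nc x%:C = `|x|.
Proof. by rewrite /= expr0n addr0 sqrtr_sqr. Qed.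

Lemma normc_ge_absRe z : `|Re z| <= nc z.
Proof.
rewrite -ler_sqr ?nnegrE ?normc_ge0// normc_sqr real_normK ?num_real//.
by rewrite lerDl sqr_ge0.
Qed.

Lemma normc_ge_absIm z : `|Im z| <= nc z.
Proof.
rewrite -ler_sqr ?nnegrE ?normc_ge0// normc_sqr real_normK ?num_real//.
by rewrite lerDr sqr_ge0.
Qed.

Lemma normc_le_absD z : nc z <= `|Re z| + `|Im z|.
Proof.
rewrite -ler_sqr ?nnegrE ?normc_ge0 ?addr_ge0// normc_sqr sqrrD.
rewrite !real_normK ?num_real// addrAC lerDl.
by rewrite mulrn_wge0 ?mulr_ge0.
Qed.

Lemma normc_sum_le N (f : nat -> R[i]) :
  nc (\sum_(0 <= n < N) f n) <= \sum_(0 <= n < N) nc (f n).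
Proof.
elim: N => [|N IH]; first by rewrite !big_geq// Normc.normc0.
rewrite !big_nat_recr//=; apply: le_trans (normcD_le _ _) _.
by rewrite lerD2r.
Qed.

(** To bound a complex number it is enough to bound the real parts of its
products with 1 and -i. *)
Lemma normc_le_test z M : (forall w, nc w = 1 -> `|Re (w * z)| <= M) ->
  nc z <= 2 * M.
Proof.
move=> H; apply: le_trans (normc_le_absD z) _.
have h1 := H 1 (Normc.normc1 R); rewrite mul1r in h1.
have : `|Im z| <= M.
  have := H (0 -i* 1); rewrite /= expr0n sqrrN expr1n add0r sqrtr1 => /(_ erefl).
  by rewrite ReM /= mul0r sub0r mulN1r opprK.
lra.
Qed.

Lemma cexpD z w : cexp (z + w) = cexp z * cexp w.
Proof.
rewrite /cexp ReD ImD expRD cosD sinD.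
by apply: complex_ext; rewrite !(ReM, ImM) /=; ring.
Qed.

Lemma cexp0 : cexp (0 : R[i]) = 1.
Proof. by rewrite /cexp /= expR0 cos0 sin0 mul1r. Qed.

Lemma normc_cexp z : nc (cexp z) = expR (Re z).
Proof.
rewrite /cexp Normc.normcM normc_real ger0_norm ?expR_ge0//=.
by rewrite cos2Dsin2 sqrtr1 mulr1.
Qed.

Lemma cexp_real x : cexp x%:C = (expR x)%:C.
Proof. by rewrite /cexp /= cos0 sin0 mulr1. Qed.

Lemma der_Re_cexp w z u :
  der (fun u => Re (w * cexp (u%:C * z))) u (Re (w * z * cexp (u%:C * z))).
Proof.
have eRe v : Re (v%:C * z) = v * Re z by rewrite ReM /= mul0r subr0.
have eIm v : Im (v%:C * z) = v * Im z by rewrite ImM /= mul0r addr0.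
have -> : (fun u => Re (w * cexp (u%:C * z))) = (fun u =>
    Re w * (expR (u * Re z) * cos (u * Im z))
    - Im w * (expR (u * Re z) * sin (u * Im z))).
  apply/funext => v; rewrite /cexp ReM eRe eIm !(ReM, ImM) /=; ring.
by der; rewrite /cexp eRe eIm !(ReM, ImM) /=; ring.
Qed.

Lemma Re_mul_le w z : `|Re (w * z)| <= nc w * nc z.
Proof. by rewrite -Normc.normcM; exact: normc_ge_absRe. Qed.

Let cexp_seg u z : 0 <= u <= 1 -> nc (cexp (u%:C * z)) <= expR (nc z).
Proof.
case/andP=> u0 u1; rewrite normc_cexp ler_expR ReM /= mul0r subr0.
apply: le_trans (ler_norm _) _; rewrite normrM ger0_norm//.
have := normc_ge_absRe z; have := normr_ge0 (Re z); nra.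
Qed.

(** Second-order Taylor bound: the difference has derivatives z (e^(uz) - 1) and
z^2 e^(uz) along the segment from 0 to z. *)
Lemma cexp_taylor z : nc (cexp z - 1 - z) <= 2 * (nc z ^+ 2 * expR (nc z)).
Proof.
set E := expR (nc z).
have E0 : 0 <= E by exact: expR_ge0.
have first w u : 0 <= u <= 1 ->
    `|Re (w * (cexp (u%:C * z) - 1))| <= nc w * nc z * E.
  case/andP=> u0 u1.
  have -> : Re (w * (cexp (u%:C * z) - 1))
      = Re (w * cexp (u%:C * z)) - Re (w * cexp (0%:C * z)).
    by rewrite mul0r cexp0 mulrBr ReD ReN.
  have := @der_norm_le R (fun u => Re (w * cexp (u%:C * z)))
    (fun u => Re (w * z * cexp (u%:C * z))) 0 u (nc w * nc z * E) u0
    (fun v _ => der_Re_cexp w z v).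
  move=> H; apply: le_trans (H _) _ => [v /andP[v0 vu]|].
    apply: le_trans (Re_mul_le _ _) _; rewrite Normc.normcM.
    by rewrite ler_wpM2l ?mulr_ge0 ?normc_ge0// cexp_seg// v0 (le_trans vu).
  by rewrite subr0 ler_piMr// !mulr_ge0 ?normc_ge0.
apply: normc_le_test => w w1.
pose f u := Re (w * cexp (u%:C * z)) - u * Re (w * z).
have hf u : 0 <= u <= 1 -> der f u (Re (w * z * (cexp (u%:C * z) - 1))).
  move=> _; rewrite /f; apply: der_eq.
    apply: derD; first exact: der_Re_cexp.
    by apply: derN; apply: derM; [exact: der_id|exact: der_cst].
  by rewrite mulrBr mulr1 ReD ReN; ring.
have -> : Re (w * (cexp z - 1 - z)) = f 1 - f 0.
  by rewrite /f mul1r mul0r cexp0 mul1r mulr1 !mulrBr mulr1 !(ReD, ReN); ring.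
apply: le_trans (der_norm_le (M := nc z ^+ 2 * E) ler01 hf _) _.
  move=> u u01; apply: le_trans (first _ _ u01) _.
  by rewrite Normc.normcM w1 mul1r expr2.
by rewrite subr0 mulr1.
Qed.

(** The functions (c ln x + d) x^-s form a class closed under d/dx. *)
Definition logpow s c d x : R[i] := (c * (ln x)%:C + d) * cexp (- s * (ln x)%:C).

Lemma cexp_addr1 s x : 0 < x ->
  cexp (- (s + 1) * (ln x)%:C) = cexp (- s * (ln x)%:C) * (x^-1)%:C.
Proof.
move=> x0; rewrite opprD mulrDl cexpD; congr (_ * _).
by rewrite mulN1r -rmorphN cexp_real -lnV ?posrE// lnK// posrE invr_gt0.
Qed.

Lemma der_logpow w s c d x : 0 < x ->
  der (fun x => Re (w * logpow s c d x)) x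
      (Re (w * logpow (s + 1) (- s * c) (c - s * d) x)).
Proof.
move=> x0.
have hl : der (@ln R) x x^-1.
  by apply: der_eq; [exact: (der_ln x0 (der_id x))|rewrite div1r].
have rr (r : R) v : r * Re v = Re (r%:C * v) by rewrite ReM /= mul0r subr0.
have E := fun w => der_comp (der_Re_cexp w (- s) (ln x)) hl.
have -> : (fun x => Re (w * logpow s c d x)) = (fun x =>
    ln x * Re ((w * c) * cexp ((ln x)%:C * (- s)))
    + Re ((w * d) * cexp ((ln x)%:C * (- s)))).
  apply/funext => y; rewrite /logpow [- s * _]mulrC rr -ReD; congr Re; ring.
apply: der_eq; first by apply: derD; [apply: derM; [exact: hl|exact: E]|exact: E].
rewrite /logpow cexp_addr1// [- s * (ln x)%:C]mulrC.
rewrite ![_ * x^-1]mulrC !rr -!ReD; congr Re; ring.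
Qed.

Lemma normc_logpow_le s c d x (m : nat) : 1 <= x -> m%:R <= Re s ->
  nc (logpow s c d x) <= (nc c * x + nc d) / x ^+ m.
Proof.
move=> x1 ms; have x0 : 0 < x by lra.
have l0 : 0 <= ln x by exact: ln_ge0.
rewrite /logpow Normc.normcM; apply: ler_pM; rewrite ?normc_ge0//.
  apply: le_trans (normcD_le _ _) _; rewrite lerD2r Normc.normcM normc_real.
  rewrite ger0_norm// ler_wpM2l ?normc_ge0//.
  exact/ltW/ln_sublinear.
rewrite normc_cexp ReM ReN /= mulr0 subr0.
rewrite -[leRHS]lnK ?posrE ?invr_gt0 ?exprn_gt0// ler_expR.
by rewrite lnV ?posrE ?exprn_gt0// lnXn// -mulr_natl mulNr lerN2 ler_wpM2r.
Qed.

End complex_exponential.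

(** * Absolutely convergent complex series *)

Section complex_series.
Variable R : realType.
Implicit Types (f g : nat -> R[i]) (A : R) (N : nat).

(** The differences w_n - w_(n+1) serve at once as a summable majorant and as an
explicit bound w_N for the tail. *)
Lemma telescoping_majorant (u w : nat -> R) N :
  (forall n, (N <= n)%N -> `|u n| <= w n - w n.+1) -> (forall n, 0 <= w n) ->
  cvgn (series u) /\
  `|limn (series u) - \sum_(0 <= n < N) u n| <= w N.
Proof.
move=> uw w0.
have blk M : (N <= M)%N -> \sum_(N <= n < M) `|u n| <= w N - w M.
  move=> /subnK <-; elim: (M - N)%N => [|m IH]; first by rewrite big_geq// subrr.
  rewrite addSn big_nat_recr ?leq_addl//=.
  have := uw _ (leq_addl m N); lra.
have cu : cvgn (series u).
  apply: normed_cvg; apply: nondecreasing_is_cvgn.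
    by move=> m n mn; rewrite /= /series /= (big_cat_nat _ mn)//= lerDl; exact: sumr_ge0.
  exists (\sum_(0 <= n < N) `|u n| + w N) => _ [M _ <-].
  rewrite [X in X <= _](_ : _ = \sum_(0 <= n < M) `|u n|)//.
  have [MN|NM] := leqP M N.
    rewrite [X in _ <= X + _](big_cat_nat _ MN)//= -addrA lerDl addr_ge0//.
    exact: sumr_ge0.
  rewrite (big_cat_nat _ (ltnW NM))//= lerD2l; apply: le_trans (blk _ (ltnW NM)) _.
  by rewrite gerBl.
split=> //.
have h M : (N <= M)%N -> `|series u M - \sum_(0 <= n < N) u n| <= w N.
  move=> NM; rewrite /series /= (big_cat_nat _ NM)//= addrAC subrr add0r.
  apply: le_trans (ler_norm_sum _ _ _) _; apply: le_trans (blk _ NM) _.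
  by rewrite gerBl.
rewrite ler_norml; apply/andP; split.
  rewrite lerBrDr; apply: limr_ge => //; near=> M.
  have /h : (N <= M)%N by near: M; exact: nbhs_infty_ge.
  by rewrite ler_norml => /andP[]; lra.
rewrite lerBlDr; apply: limr_le => //; near=> M.
have /h : (N <= M)%N by near: M; exact: nbhs_infty_ge.
by rewrite ler_norml => /andP[]; lra.
Unshelve. all: by end_near. Qed.

Definition csum f : R[i] :=
  limn (series (fun n => Re (f n))) +i* limn (series (fun n => Im (f n))).

Definition csummable f : Prop :=
  cvgn (series (fun n => Re (f n))) /\ cvgn (series (fun n => Im (f n))).

Let inv_sq A n : 0 <= A -> A / n.+1%:R ^+ 2 <= 2 * A / n.+1%:R - 2 * A / n.+2%:R.
Proof.
move=> A0; rewrite -[n.+2%:R]natr1; set m : R := n.+1%:R.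
have m1 : 1 <= m by rewrite /m ler1n.
have -> : 2 * A / m - 2 * A / (m + 1) = A * (2 / (m * (m + 1))).
  by field; apply/andP; split; apply: lt0r_neq0; lra.
rewrite ler_wpM2l// ler_pdivlMr; last by nra.
rewrite mulrC ler_pdivrMr; nra.
Qed.

Lemma csum_tail f A N : 0 <= A ->
  (forall n, (N <= n)%N -> nc (f n) <= A / n.+1%:R ^+ 2) ->
  csummable f /\ nc (csum f - \sum_(0 <= n < N) f n) <= 4 * A / N.+1%:R.
Proof.
move=> A0 fA.
have w0 n : 0 <= 2 * A / n.+1%:R by rewrite divr_ge0// mulr_ge0.
have hRe n : (N <= n)%N -> `|Re (f n)| <= 2 * A / n.+1%:R - 2 * A / n.+2%:R.
  move=> /fA h; apply: le_trans (inv_sq n A0); apply: le_trans h.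
  exact: normc_ge_absRe.
have hIm n : (N <= n)%N -> `|Im (f n)| <= 2 * A / n.+1%:R - 2 * A / n.+2%:R.
  move=> /fA h; apply: le_trans (inv_sq n A0); apply: le_trans h.
  exact: normc_ge_absIm.
have [c1 b1] := telescoping_majorant hRe w0.
have [c2 b2] := telescoping_majorant hIm w0.
split=> //; apply: le_trans (normc_le_absD _) _.
rewrite ReD ImD ReN ImN Re_sum Im_sum.
have -> : 4 * A / N.+1%:R = 2 * A / N.+1%:R + 2 * A / N.+1%:R by field.
exact: lerD.
Qed.

Lemma csumD f g : csummable f -> csummable g ->
  csummable (fun n => f n + g n) /\ csum (fun n => f n + g n) = csum f + csum g.
Proof.
move=> [f1 f2] [g1 g2].
have e1 : series (fun n => Re (f n + g n)) =
    (fun N => series (fun n => Re (f n)) N + series (fun n => Re (g n)) N).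
  by apply/funext => N; rewrite /series /= -big_split; apply: eq_bigr => i _; rewrite ReD.
have e2 : series (fun n => Im (f n + g n)) =
    (fun N => series (fun n => Im (f n)) N + series (fun n => Im (g n)) N).
  by apply/funext => N; rewrite /series /= -big_split; apply: eq_bigr => i _; rewrite ImD.
split; first by rewrite /csummable e1 e2; split; apply: is_cvgD.
by rewrite /csum e1 e2; apply: complex_ext => /=; rewrite limD.
Qed.

Lemma csumZ c f : csummable f ->
  csummable (fun n => c * f n) /\ csum (fun n => c * f n) = c * csum f.
Proof.
move=> [f1 f2].
have e1 : series (fun n => Re (c * f n)) = (fun N =>
    Re c * series (fun n => Re (f n)) N + (- Im c) * series (fun n => Im (f n)) N).
  apply/funext => N; rewrite /series /= !mulr_sumr -big_split.
  by apply: eq_bigr => i _; rewrite ReM mulNr.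
have e2 : series (fun n => Im (c * f n)) = (fun N =>
    Re c * series (fun n => Im (f n)) N + Im c * series (fun n => Re (f n)) N).
  apply/funext => N; rewrite /series /= !mulr_sumr -big_split.
  by apply: eq_bigr => i _; rewrite ImM.
have z (a : R) (u : nat -> R) : cvgn u -> cvgn (fun N => a * u N).
  by move=> cu; apply: is_cvgMr.
have lz (a : R) (u : nat -> R) : cvgn u -> limn (fun N => a * u N) = a * limn u.
  by move=> cu; apply/cvg_lim => //; apply: cvgMr.
split; first by rewrite /csummable e1 e2; split; apply: is_cvgD; exact: z.
rewrite /csum e1 e2; apply: complex_ext; rewrite ?(ReM, ImM) /=.
  by rewrite limD; [rewrite !lz//; ring|exact: z|exact: z].
by rewrite limD; [rewrite !lz|exact: z|exact: z].
Qed.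

Lemma cvg_complex f (l : R[i]) (e : nat -> R) :
  (forall N, nc (f N - l) <= e N) -> e @ \oo --> 0 ->
  (f : nat -> R[i]^o) @ \oo --> (l : R[i]^o).
Proof.
move=> fe e0; apply/cvgrPdist_lt => eps eps0.
have er : 0 < Re eps by move: eps0; rewrite ltcE /= => /andP[].
have eE : eps = (Re eps)%:C.
  by move: eps0; rewrite ltcE => /andP[/eqP h _]; apply: complex_ext.
have /cvgrPdist_lt/(_ _ er) := e0; apply: filterS => N.
rewrite sub0r normrN => h.
change (`|l - f N| < eps); rewrite eE normc_def ltcR.
have := fe N; rewrite normc_distC => h2.
have -> : Num.sqrt (Re (l - f N) ^+ 2 + Im (l - f N) ^+ 2) = nc (l - f N).
  by case: (l - f N).
by apply: le_lt_trans h2 _; apply: le_lt_trans h; exact: ler_norm.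
Qed.

(** A quadratic remainder is the only form in which complex differentiability
is established below. *)
Lemma derivable_complex (f : R[i] -> R[i]) (z D : R[i]) (C : R) :
  (forall h, nc h <= 1 -> nc (f (z + h) - f z - h * D) <= C * nc h ^+ 2) ->
  derivable (f : R[i]^o -> R[i]^o) z 1.
Proof.
move=> H; apply/cvg_ex; exists D; apply/cvgrPdist_lt => eps eps0.
have er : 0 < Re eps by move: eps0; rewrite ltcE /= => /andP[].
have eE : eps = (Re eps)%:C.
  by move: eps0; rewrite ltcE => /andP[/eqP h _]; apply: complex_ext.
have nE (v : R[i]) : `|v| = (nc v)%:C by rewrite normc_def; case: v.
pose d := Num.min 1 (Re eps / (`|C| + 1)).
have d0 : 0 < d by rewrite lt_min ltr01 divr_gt0// ltr_wpDl.
near=> h.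
have h0 : h != 0 by near: h; exact: nbhs_dnbhs_neq.
have hd : nc h < d.
  rewrite -ltcR -nE; near: h; apply: dnbhs0_lt; by rewrite ltcR.
have nh : 0 < nc h.
  by rewrite lt_neqAle normc_ge0 andbT eq_sym; apply: contra h0 => /eqP/Normc.eq0_normc ->.
rewrite /= -[h *: 1]/(h * 1) mulr1 -[_ *: _]/(h^-1 * _).
rewrite [h + z]addrC eE nE ltcR.
have -> : D - h^-1 * (f (z + h) - f z) = - (h^-1 * (f (z + h) - f z - h * D)).
  by rewrite !mulrBr mulKf//; ring.
rewrite [X in X < _](@normcN R) Normc.normcM Normc.normcV mulrC ltr_pdivrMr//.
move: hd; rewrite lt_min => /andP[/ltW h1 he].
apply: le_lt_trans (H h h1) _; rewrite expr2 mulrA ltr_pM2r//.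
apply: (@le_lt_trans _ _ (`|C| * nc h)).
  by rewrite ler_wpM2r ?normc_ge0// ler_norm.
apply: (@le_lt_trans _ _ ((`|C| + 1) * nc h)).
  by rewrite ler_wpM2r ?normc_ge0// lerDl.
by rewrite mulrC -ltr_pdivlMr// ltr_wpDl.
Unshelve. all: by end_near. Qed.

End complex_series.

(** * Finite differences *)

Section finite_differences.
Variable R : realType.
Implicit Types (s c d h : R[i]) (x y : R) (k j N : nat).

Definition fdiff (V : zmodType) (f : R -> V) : R -> V := fun x => f (x + 1) - f x.

(** The k-th difference of u_0 at x is the k-th derivative at a later point: one
difference of u_j is a value of u_(j+1) by the mean value theorem, and the
differences again form a chain of derivatives. *)
Lemma fdiff_mean_value k (u : nat -> R -> R) x M :
  (forall j y, x <= y -> der (u j) y (u j.+1 y)) ->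
  (forall y, x <= y -> `|u k y| <= M) -> `|iter k (@fdiff _) (u 0) x| <= M.
Proof.
elim: k u => [|k IH] u hu hM; first exact: hM.
rewrite iterSr; apply: (IH (fun j => fdiff (u j))) => [j y xy|y xy].
  have xy1 : x <= y + 1 by lra.
  have s1 : der (fun z : R => z + 1) y 1 by der; rewrite addr0.
  have c1 := @der_comp R (u j) (fun z => z + 1) y _ _ (hu j _ xy1) s1.
  by apply: der_eq (derD c1 (derN (hu j y xy))) _; rewrite mulr1.
have y1 : y <= y + 1 by lra.
have [v /andP[yv _]] := mean_value y1 (fun z (hz : y <= z <= y + 1) =>
  hu k z (le_trans xy (proj1 (andP hz)))).
rewrite /fdiff => ->; rewrite addrAC subrr add0r mulr1.
by apply: hM; apply: le_trans yv.
Qed.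

Lemma fdiff_complex k (F : nat -> R -> R[i]) x M :
  (forall w j y, x <= y ->
    der (fun y => Re (w * F j y)) y (Re (w * F j.+1 y))) ->
  (forall y, x <= y -> nc (F k y) <= M) ->
  nc (iter k (@fdiff _) (F 0) x) <= 2 * M.
Proof.
move=> hF hM; apply: normc_le_test => w w1.
have -> : Re (w * iter k (@fdiff _) (F 0) x)
    = iter k (@fdiff _) (fun y => Re (w * F 0 y)) x.
  elim: k (F 0) x {hF hM} => [//|k IH] f x.
  rewrite !iterSr IH; congr (iter k _ _ _); apply/funext => y.
  by rewrite /fdiff mulrBr ReD ReN.
apply: (@fdiff_mean_value k (fun j y => Re (w * F j y))) => [j y|y /hM h].
  exact: hF.
by apply: le_trans (Re_mul_le _ _) _; rewrite w1 mul1r.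
Qed.

Lemma fdiffD k (f g : R -> R[i]) x : iter k (@fdiff _) (fun y => f y + g y) x
  = iter k (@fdiff _) f x + iter k (@fdiff _) g x.
Proof.
elim: k f g => [//|k IH] f g; rewrite !iterSr -IH; congr (iter k _ _ _).
by apply/funext => y; rewrite /fdiff; ring.
Qed.

Lemma fdiffZ k c (f : R -> R[i]) x :
  iter k (@fdiff _) (fun y => c * f y) x = c * iter k (@fdiff _) f x.
Proof.
elim: k f => [//|k IH] f; rewrite !iterSr -IH; congr (iter k _ _ _).
by apply/funext => y; rewrite /fdiff mulrBr.
Qed.

(** Coefficients of the j-th derivative of (c ln x + d) x^-s, which is
(c_j ln x + d_j) x^-(s + j). *)
Fixpoint logpow_coef s c d j : R[i] * R[i] :=
  if j is j'.+1 then
    let: (c', d') := logpow_coef s c d j' in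
    (- (s + j'%:R) * c', c' - (s + j'%:R) * d')
  else (c, d).

Lemma der_logpow_coef s c d w j x : 0 < x ->
  der (fun x => Re (w * logpow (s + j%:R)
        (logpow_coef s c d j).1 (logpow_coef s c d j).2 x)) x
      (Re (w * logpow (s + j.+1%:R)
        (logpow_coef s c d j.+1).1 (logpow_coef s c d j.+1).2 x)).
Proof.
move=> x0; rewrite [logpow_coef _ _ _ j.+1]/=.
case: (logpow_coef s c d j) => c' d' /=.
by rewrite -[j.+1%:R]natr1 addrA; exact: der_logpow.
Qed.

Lemma Re_addn s j : Re (s + j%:R) = Re s + j%:R.
Proof.
rewrite ReD; congr (_ + _).
by rewrite -(rmorph_nat (real_complex R)).
Qed.

Lemma fdiff_logpow_le s c d k m x : 1 <= x -> m.+1%:R <= Re s + k%:R ->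
  nc (iter k (@fdiff _) (logpow s c d) x) <=
  2 * ((nc (logpow_coef s c d k).1 + nc (logpow_coef s c d k).2) / x ^+ m).
Proof.
move=> x1 hm; have x0 : 0 < x by lra.
pose F j := logpow (s + j%:R) (logpow_coef s c d j).1 (logpow_coef s c d j).2.
rewrite [logpow s c d](_ : _ = F 0); last by rewrite /F addr0.
apply: fdiff_complex => [w j y xy|y xy].
  by apply: der_logpow_coef; lra.
have y1 : 1 <= y by lra.
apply: le_trans (normc_logpow_le _ _ y1 (m := m.+1) _) _; first by rewrite Re_addn.
set a := nc _; set b := nc _.
have a0 : 0 <= a := normc_ge0 _; have b0 : 0 <= b := normc_ge0 _.
apply: (@le_trans _ _ ((a + b) / y ^+ m)).
  rewrite exprS invfM mulrA ler_wpM2r ?invr_ge0 ?exprn_ge0//; first lra.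
  by rewrite ler_pdivrMr; [rewrite mulrDl lerD2l ler_peMr|lra].
rewrite ler_wpM2l ?addr_ge0// lef_pV2 ?posrE ?exprn_gt0//; last lra.
by apply: lerXn2r; rewrite ?nnegrE; lra.
Qed.

(** The sharp form for pure powers, whose coefficients c_j vanish. *)
Lemma fdiff_pow_le s k x : 1 <= x -> 0 <= Re s + k%:R ->
  nc (iter k (@fdiff _) (logpow s 0 1) x) <=
  2 * ((nc s + k%:R) ^+ k * expR (- (Re s + k%:R) * ln x)).
Proof.
move=> x1 hs.
pose F j := logpow (s + j%:R) (logpow_coef s 0 1 j).1 (logpow_coef s 0 1 j).2.
rewrite [logpow s 0 1](_ : _ = F 0); last by rewrite /F addr0.
have c0 j : (logpow_coef s 0 1 j).1 = 0.
  by elim: j => [//|j] /=; case: (logpow_coef _ _ _ _) => a b /= ->; rewrite mulr0.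
have dj j : (j <= k)%N -> nc (logpow_coef s 0 1 j).2 <= (nc s + k%:R) ^+ j.
  elim: j => [|j IH] jk; first by rewrite Normc.normc1.
  have := IH (ltnW jk); have := c0 j => /=.
  case: (logpow_coef _ _ _ _) => a b /= -> hb.
  rewrite sub0r [X in X <= _](@normcN R) Normc.normcM exprS.
  apply: ler_pM; rewrite ?normc_ge0//.
  apply: le_trans (normcD_le _ _) _; rewrite lerD2l.
  rewrite -(rmorph_nat (real_complex R)) normc_real ger0_norm// ler_nat.
  exact: ltnW.
apply: fdiff_complex => [w j y xy|y xy].
  by apply: der_logpow_coef; lra.
rewrite /F /logpow c0 mul0r add0r Normc.normcM normc_cexp.
apply: ler_pM; rewrite ?normc_ge0 ?expR_ge0 ?dj//.
rewrite ler_expR ReM ReN Re_addn /= mulr0 subr0 !mulNr lerN2.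
by rewrite ler_wpM2l// ler_ln ?posrE//; lra.
Qed.

(** Second-order remainder of x^-s in the exponent. *)
Definition pow_remainder s h x : R[i] :=
  logpow (s + h) 0 1 x - logpow s 0 1 x - h * logpow s (- 1) 0 x.

(** The coefficient p(s) of x^-(s+k) in the k-th derivative of x^-s is a
polynomial in s; q is its derivative, read off from the derivative of
- ln x x^-s. *)
Lemma coef_remainder s k : exists2 M, 0 <= M & forall h, nc h <= 1 ->
  let p h := (logpow_coef (s + h) 0 1 k).2 in
  let q := (logpow_coef s (- 1) 0 k).2 in
  [/\ (logpow_coef s (- 1) 0 k).1 = - p 0, nc (p h) <= M,
      nc (p h - p 0) <= M * nc h & nc (p h - p 0 - h * q) <= M * nc h ^+ 2].
Proof.
have c0 t j : (logpow_coef t 0 1 j).1 = 0.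
  by elim: j => [//|j] /=; case: (logpow_coef _ _ _ _) => a b /= ->; rewrite mulr0.
elim: k => [|k [M M0 IH]].
  exists 1 => // h h1 p q.
  have pE t : p t = 1 by [].
  have qE : q = 0 by [].
  rewrite !pE qE Normc.normc1 !subrr mulr0 subr0 Normc.normc0 !mul1r.
  by split; rewrite ?exprn_ge0 ?normc_ge0.
pose A := nc s + k%:R + 1.
have A0 : 0 <= A by rewrite /A !addr_ge0 ?normc_ge0.
exists (M * (A + 1)) => [|h h1 p q].
  by rewrite mulr_ge0// addr_ge0.
have [] := IH h h1; move: (IH) => _.
have n0 := normc_ge0 h.
pose b t := (logpow_coef t 0 1 k).2.
have pE t : p t = - (s + t + k%:R) * b (s + t).
  rewrite /p /= /b; have := c0 (s + t) k.
  by case: (logpow_coef _ _ _ _) => u v /= ->; rewrite sub0r mulNr.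
set e := logpow_coef s (- 1) 0 k.
have qE : q = e.1 - (s + k%:R) * e.2 by rewrite /q /= -/e; case: (e).
have eE : (logpow_coef s (- 1) 0 k.+1).1 = - (s + k%:R) * e.1.
  by rewrite /= -/e; case: (e).
rewrite eE !pE qE -/(b (s + h)) -/(b (s + 0)) addr0.
have sk : nc (s + k%:R) <= A.
  apply: le_trans (normcD_le _ _) _.
  by rewrite -(rmorph_nat (real_complex R)) normc_real ger0_norm// /A lerDl.
have sk' : nc (s + h + k%:R) <= A.
  rewrite addrAC; apply: le_trans (normcD_le _ _) _.
  apply: lerD => //; apply: le_trans (normcD_le _ _) _.
  by rewrite -(rmorph_nat (real_complex R)) normc_real ger0_norm.
move=> e1 hb hd hr; split.
- by rewrite e1; ring.
- rewrite Normc.normcM [X in X * _](@normcN R) mulrC.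
  by apply: ler_pM; rewrite ?normc_ge0//; apply: le_trans sk' _; rewrite lerDl.
- rewrite (_ : _ - _ = - ((s + k%:R) * (b (s + h) - b s) + h * b (s + h))); last by ring.
  rewrite [X in X <= _](@normcN R); apply: le_trans (normcD_le _ _) _.
  rewrite !Normc.normcM.
  have := ler_pM (normc_ge0 _) (normc_ge0 _) sk hd.
  have := ler_wpM2l n0 hb.
  lra.
rewrite (_ : _ - _ - _ = - ((s + k%:R) * (b (s + h) - b s - h * e.2)
    + h * (b (s + h) - b s))); last by rewrite e1 -/(b s); ring.
rewrite [X in X <= _](@normcN R); apply: le_trans (normcD_le _ _) _.
rewrite !Normc.normcM.
have := ler_pM (normc_ge0 _) (normc_ge0 _) sk hr.
have := ler_wpM2l n0 hd.
rewrite expr2; lra.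
Qed.

(** The k-th derivative of the remainder is x^-(s+k) times
p(s+h) (x^-h - 1 + h ln x) + (p(s+h) - p(s) - h q) - h ln x (p(s+h) - p(s)),
each term of which is of second order in h. Up to three powers of x pay for
the logarithms and for x^-h. *)
Lemma fdiff_pow_remainder_le s k m : m.+3%:R <= Re s + k%:R ->
  exists2 C, 0 <= C & forall h x, nc h <= 1 -> 1 <= x ->
    nc (iter k (@fdiff _) (pow_remainder s h) x) <= C * nc h ^+ 2 / x ^+ m.
Proof.
move=> hm; have [M M0 HM] := coef_remainder s k.
exists (2 * (4 * M)) => [|h x h1 x1]; first by rewrite !mulr_ge0.
have [e1 hb hd hr] := HM h h1.
have n0 := normc_ge0 h.
pose F j y := logpow (s + h + j%:R) (logpow_coef (s + h) 0 1 j).1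
    (logpow_coef (s + h) 0 1 j).2 y
  - logpow (s + j%:R) (logpow_coef s 0 1 j).1 (logpow_coef s 0 1 j).2 y
  - h * logpow (s + j%:R) (logpow_coef s (- 1) 0 j).1
    (logpow_coef s (- 1) 0 j).2 y.
rewrite (_ : pow_remainder s h = F 0); last first.
  by apply/funext => y; rewrite /F /pow_remainder !addr0.
rewrite -mulrA -mulrA; apply: fdiff_complex => [w j y xy|y xy].
  have y0 : 0 < y by lra.
  rewrite /F; under eq_fun do rewrite !mulrBr !ReD !ReN.
  rewrite !mulrBr !ReD !ReN.
  apply: derD; first apply: derD; last first.
  - apply: derN; under eq_fun do rewrite mulrA; rewrite mulrA.
    exact: der_logpow_coef.
  - by apply: derN; apply: der_logpow_coef.
  - by apply: der_logpow_coef.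
have c0 t j : (logpow_coef t 0 1 j).1 = 0.
  by elim: j => [//|j] /=; case: (logpow_coef _ _ _ _) => a b /= ->; rewrite mulr0.
have y1 : 1 <= y by lra.
have y0 : 0 < y by lra.
move: hb hd hr e1; rewrite /F !c0 addr0.
set ph := (logpow_coef (s + h) 0 1 k).2; set p0 := (logpow_coef s 0 1 k).2.
set q := (logpow_coef s (- 1) 0 k).2 => hb hd hr ->.
pose X : R[i] := (ln y)%:C.
have -> : logpow (s + h + k%:R) 0 ph y - logpow (s + k%:R) 0 p0 y
    - h * logpow (s + k%:R) (- p0) q y
  = logpow (s + k%:R) 0 1 y * (ph * (cexp (- h * X) - 1 - (- h * X))
     + (ph - p0 - h * q) - h * X * (ph - p0)).
  rewrite /logpow -/X (_ : - (s + h + k%:R) * X = - (s + k%:R) * X + - h * X); last by ring.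
  by rewrite cexpD; ring.
have lX : nc X = ln y by rewrite normc_real ger0_norm// ln_ge0.
have l0 : 0 <= ln y by exact: ln_ge0.
have ly : ln y <= y by exact/ltW/ln_sublinear.
have tay : nc (cexp (- h * X) - 1 - (- h * X)) <= 2 * (nc h ^+ 2 * y ^+ 3).
  apply: le_trans (cexp_taylor _) _; rewrite ler_wpM2l//.
  have hX : nc (- h * X) = nc h * ln y by rewrite Normc.normcM lX [nc (- h)](@normcN R).
  rewrite hX exprMn -mulrA ler_wpM2l ?exprn_ge0// [y ^+ 3]exprSr.
  apply: ler_pM; rewrite ?exprn_ge0 ?expR_ge0//.
    by apply: lerXn2r; rewrite ?nnegrE ?(ltW y0).
  by rewrite -[leRHS]lnK ?posrE// ler_expR ler_piMl.
have y3 : 1 <= y ^+ 3 by rewrite exprn_ege1.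
have yy3 : y <= y ^+ 3 by rewrite ler_eXnr.
rewrite Normc.normcM.
have h1' := @normc_logpow_le R (s + k%:R) 0 1 y m.+3 y1.
rewrite Re_addn Normc.normc0 Normc.normc1 mul0r add0r div1r in h1'.
apply: (@le_trans _ _ ((y ^+ m.+3)^-1 * (4 * M * nc h ^+ 2 * y ^+ 3))).
  apply: ler_pM; rewrite ?normc_ge0 ?h1'//.
  apply: le_trans (normcB_le _ _) _.
  apply: (@le_trans _ _ (M * (2 * (nc h ^+ 2 * y ^+ 3)) + M * nc h ^+ 2
    + nc h * ln y * (M * nc h))).
    apply: lerD; last first.
      by rewrite !Normc.normcM lX ler_wpM2l// mulr_ge0.
    apply: le_trans (normcD_le _ _) _; apply: lerD => //.
    by rewrite Normc.normcM; apply: ler_pM; rewrite ?normc_ge0.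
  have t0 : 0 <= M * nc h ^+ 2 by rewrite mulr_ge0 ?exprn_ge0.
  have t1 := ler_wpM2l t0 (le_trans ly yy3).
  have t2 := ler_wpM2l t0 y3.
  rewrite mulr1 in t2; rewrite [nc h * ln y * _](_ : _ = M * nc h ^+ 2 * ln y); last by ring.
  lra.
have -> : (y ^+ m.+3)^-1 * (4 * M * nc h ^+ 2 * y ^+ 3)
    = 4 * M * (nc h ^+ 2 / y ^+ m).
  rewrite -[m.+3]addn3 exprD.
  have : y ^+ m != 0 by rewrite gt_eqF// exprn_gt0.
  have : y ^+ 3 != 0 by rewrite gt_eqF// exprn_gt0.
  by move: (y ^+ 3) (y ^+ m) => B A B0 A0; field; apply/andP.
rewrite !ler_wpM2l ?mulr_ge0 ?exprn_ge0// lef_pV2 ?posrE ?exprn_gt0//; last lra.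
by apply: lerXn2r; rewrite ?nnegrE; lra.
Qed.

End finite_differences.

(** * Continuation by repeated summation by parts *)

Section continuation.
Variable R : realType.
Implicit Types (s h z : R[i]) (f g : R -> R[i]) (k j N : nat).

(** The k-th row of b is a bounded k-fold summation of the coefficients, which
form row 0. *)
Variables (b : nat -> nat -> R[i]) (M : nat -> R).
Hypothesis b_sum : forall k n, b k.+1 n - b k.+1 n.+1 = b k n.
Hypothesis b_bnd : forall k n, nc (b k n) <= M k.

Local Notation D k f := (iter k (@fdiff R _) f).

Let M0 k : 0 <= M k. Proof. exact: le_trans (normc_ge0 _) (b_bnd k 0). Qed.

Lemma summation_by_parts k f N :
  \sum_(0 <= n < N) b 0 n.+1 * f n.+1%:R =
  \sum_(0 <= j < k) (b j.+1 j.+1 * D j f 1 - b j.+1 (N + j).+1 * D j f N.+1%:R)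
  + \sum_(0 <= n < N) b k (n + k).+1 * D k f n.+1%:R.
Proof.
elim: k => [|k ->].
  by rewrite [X in _ = X + _]big_geq// add0r; under [RHS]eq_bigr do rewrite addn0.
rewrite big_nat_recr//= -addrA; congr (_ + _).
elim: N => [|N IH]; first by rewrite !big_geq// add0n subrr addr0.
rewrite !big_nat_recr//= {}IH -(b_sum k (N + k).+1) addSnnS addnS.
have -> : fdiff (D k f) N.+1%:R = D k f N.+2%:R - D k f N.+1%:R.
  by rewrite /fdiff natr1.
by ring.
Qed.

(** The value of the sum of b_0(n) f(n) after k summations by parts, also where
that sum diverges. *)
Definition reg_sum k f : R[i] := \sum_(0 <= j < k) b j.+1 j.+1 * D j f 1
  + csum (fun n => b k (n + k).+1 * D k f n.+1%:R).

Lemma reg_sum_expand k f N : reg_sum k f =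
  \sum_(0 <= n < N) b 0 n.+1 * f n.+1%:R
  + \sum_(0 <= j < k) b j.+1 (N + j).+1 * D j f N.+1%:R
  + (csum (fun n => b k (n + k).+1 * D k f n.+1%:R)
     - \sum_(0 <= n < N) b k (n + k).+1 * D k f n.+1%:R).
Proof. by rewrite (summation_by_parts k) sumrB /reg_sum; ring. Qed.

Definition reg_summable k f : Prop :=
  csummable (fun n => b k (n + k).+1 * D k f n.+1%:R).

Lemma reg_summable_tail k f A N : 0 <= A ->
  (forall n, (N <= n)%N -> nc (D k f n.+1%:R) <= A / n.+1%:R ^+ 2) ->
  reg_summable k f /\
  nc (csum (fun n => b k (n + k).+1 * D k f n.+1%:R)
      - \sum_(0 <= n < N) b k (n + k).+1 * D k f n.+1%:R) <= 4 * (M k * A) / N.+1%:R.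
Proof.
move=> A0 h; apply: csum_tail; first exact: mulr_ge0.
move=> n /h hn; rewrite Normc.normcM -mulrA.
by apply: ler_pM; rewrite ?normc_ge0.
Qed.

Lemma reg_sumD k f g : reg_summable k f -> reg_summable k g ->
  reg_summable k (fun x => f x + g x) /\
  reg_sum k (fun x => f x + g x) = reg_sum k f + reg_sum k g.
Proof.
move=> sf sg; have [h1 h2] := csumD sf sg.
have e : (fun n => b k (n + k).+1 * D k (fun x => f x + g x) n.+1%:R) =
    (fun n => b k (n + k).+1 * D k f n.+1%:R + b k (n + k).+1 * D k g n.+1%:R).
  by apply/funext => n; rewrite fdiffD mulrDr.
rewrite /reg_summable /reg_sum e; split=> //; rewrite h2.
under eq_bigr => j _ do rewrite fdiffD mulrDr.
by rewrite big_split /=; ring.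
Qed.

Lemma reg_sumZ k c f : reg_summable k f ->
  reg_summable k (fun x => c * f x) /\
  reg_sum k (fun x => c * f x) = c * reg_sum k f.
Proof.
move=> sf; have [h1 h2] := csumZ c sf.
have e : (fun n => b k (n + k).+1 * D k (fun x => c * f x) n.+1%:R) =
    (fun n => c * (b k (n + k).+1 * D k f n.+1%:R)).
  by apply/funext => n; rewrite fdiffZ mulrCA.
rewrite /reg_summable /reg_sum e; split=> //; rewrite h2 mulrDr mulr_sumr.
by congr (_ + _); apply: eq_bigr => j _; rewrite fdiffZ mulrCA.
Qed.

Lemma le0_of_harmonic (x C : R) : (forall N, x <= C / N.+1%:R) -> x <= 0.
Proof.
move=> h.
have cv : (fun N => C / N.+1%:R) @ \oo --> (0 : R).
  by rewrite -(mulr0 C); apply: cvgMr; exact: cvg_harmonic.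
rewrite -(cvg_lim _ cv)//; apply: limr_ge; first exact: cvgP cv.
exact: nearW.
Qed.

Let fdiff_logpow_sq s c d k : 3 <= Re s + k%:R -> exists2 A, 0 <= A &
  forall n, nc (D k (logpow s c d) n.+1%:R) <= A / n.+1%:R ^+ 2.
Proof.
move=> hs; exists (2 * (nc (logpow_coef s c d k).1 + nc (logpow_coef s c d k).2)).
  by rewrite mulr_ge0 ?addr_ge0 ?normc_ge0.
by move=> n; rewrite -mulrA; apply: fdiff_logpow_le; rewrite ?ler1n.
Qed.

Lemma reg_summable_logpow s c d k : 3 <= Re s + k%:R ->
  reg_summable k (logpow s c d).
Proof.
by case/(fdiff_logpow_sq c d) => A A0 hA; have [] := reg_summable_tail (N := 0) A0 (fun n _ => hA n).
Qed.

(** One more summation by parts adds a boundary term at N and replaces one tail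
by another; all three vanish as N grows. *)
Lemma reg_sum_step s c d k : 3 <= Re s + k%:R ->
  reg_sum k.+1 (logpow s c d) = reg_sum k (logpow s c d).
Proof.
move=> hs; have hs1 : 3 <= Re s + k.+1%:R by rewrite -natr1; lra.
have [A A0 hA] := fdiff_logpow_sq c d hs.
have [A1 A10 hA1] := fdiff_logpow_sq c d hs1.
apply/eqP; rewrite -subr_eq0; apply/eqP/Normc.eq0_normc/le_anti/andP.
split; last exact: normc_ge0.
apply: (@le0_of_harmonic _ (M k.+1 * A + 4 * (M k.+1 * A1) + 4 * (M k * A))) => N.
have [_ t] := reg_summable_tail (N := N) A0 (fun n _ => hA n).
have [_ t1] := reg_summable_tail (N := N) A10 (fun n _ => hA1 n).
rewrite (reg_sum_expand k _ N) (reg_sum_expand k.+1 _ N) big_nat_recr//=.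
set f := logpow s c d in hA hA1 t t1 *.
rewrite opprD [X in nc X](_ : _ = b k.+1 (N + k).+1 * D k f N.+1%:R
    + (csum (fun n => b k.+1 (n + k.+1).+1 * D k.+1 f n.+1%:R)
       - \sum_(0 <= n < N) b k.+1 (n + k.+1).+1 * D k.+1 f n.+1%:R)
    - (csum (fun n => b k (n + k).+1 * D k f n.+1%:R)
       - \sum_(0 <= n < N) b k (n + k).+1 * D k f n.+1%:R)); last by ring.
apply: le_trans (normcB_le _ _) _; rewrite mulrDl; apply: lerD => //.
apply: le_trans (normcD_le _ _) _; rewrite mulrDl; apply: lerD => //.
rewrite Normc.normcM -mulrA; apply: ler_pM; rewrite ?normc_ge0//.
apply: le_trans (hA N) _; rewrite ler_wpM2l// lef_pV2 ?posrE ?exprn_gt0//.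
by rewrite ler_eXnr ?ler1n.
Qed.

Lemma reg_sum_stable s c d k m : 3 <= Re s + k%:R ->
  reg_sum (m + k) (logpow s c d) = reg_sum k (logpow s c d).
Proof.
move=> hs; elim: m => [//|m IH]; rewrite addSn reg_sum_step//.
by rewrite natrD; have : 0 <= m%:R :> R by []; lra.
Qed.

(** The number of summations by parts grows with |s|, so that the differenced
series converges near every point. *)
Let depth s : nat := (Num.truncn (nc s)).+4.

Let depth_ok s : 3 <= Re s + (depth s)%:R.
Proof.
have := normc_ge_absRe s; rewrite ler_norml => /andP[h _].
have := truncnS_gt (nc s).
rewrite /depth -addn3 natrD; lra.
Qed.

Definition continuation s : R[i] := reg_sum (depth s) (logpow s 0 1).

Lemma continuationE s k : 3 <= Re s + k%:R ->
  continuation s = reg_sum k (logpow s 0 1).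
Proof.
move=> hs; rewrite /continuation -(reg_sum_stable _ _ (depth s) hs) addnC.
by rewrite reg_sum_stable// depth_ok.
Qed.

(** For Re s > 1 the boundary terms at N tend to 0 as well. *)
Lemma continuation_series s : 1 < Re s -> exists C, forall N,
  nc (\sum_(0 <= n < N) b 0 n.+1 * cpow n.+1 (- s) - continuation s) <= C / N.+1%:R.
Proof.
move=> hs.
have hs3 : 3 <= Re s + (depth s)%:R := depth_ok s.
have [A A0 hA] := fdiff_logpow_sq 0 1 hs3; set k := depth s in hs3 hA *.
pose B j := 2 * (nc s + j%:R) ^+ j.
exists (\sum_(0 <= j < k) M j.+1 * B j + 4 * (M k * A)) => N.
have [_ t] := reg_summable_tail (N := N) A0 (fun n _ => hA n).
rewrite /continuation -/k (reg_sum_expand k _ N) normc_distC.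
have -> : \sum_(0 <= n < N) b 0 n.+1 * cpow n.+1 (- s)
    = \sum_(0 <= n < N) b 0 n.+1 * logpow s 0 1 n.+1%:R.
  by apply: eq_bigr => n _; rewrite /logpow mul0r add0r mul1r.
have cancel3 (u v w : R[i]) : u + v + w - u = v + w by ring.
rewrite cancel3; apply: le_trans (normcD_le _ _) _; rewrite mulrDl; apply: lerD => //.
apply: le_trans (normc_sum_le _ _) _; rewrite mulr_suml; apply: ler_sum => j _.
rewrite Normc.normcM -mulrA; apply: ler_pM; rewrite ?normc_ge0//.
have N1 : 1 <= N.+1%:R :> R by rewrite ler1n.
have j0 : 0 <= j%:R :> R by [].
apply: le_trans (fdiff_pow_le N1 _) _; first lra.
rewrite /B -mulrA ler_wpM2l// ler_wpM2l ?exprn_ge0 ?addr_ge0 ?normc_ge0//.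
rewrite -[leRHS]lnK ?posrE ?invr_gt0// ler_expR lnV ?posrE// mulNr lerN2.
by rewrite ler_peMl ?ln_ge0//; lra.
Qed.

Let remainder_at s x : 1 <= x -> exists2 C, 0 <= C & forall h, nc h <= 1 ->
  nc (pow_remainder s h x) <= C * nc h ^+ 2.
Proof.
move=> x1; have x0 : 0 < x by lra.
exists (nc (logpow s 0 1 x) * (2 * (ln x ^+ 2 * x))) => [|h h1].
  apply: mulr_ge0; first exact: normc_ge0.
  by rewrite mulr_ge0// mulr_ge0 ?sqr_ge0//; lra.
pose X : R[i] := (ln x)%:C.
have l0 : 0 <= ln x by exact: ln_ge0.
have -> : pow_remainder s h x
    = logpow s 0 1 x * (cexp (- h * X) - 1 - (- h * X)).
  rewrite /pow_remainder /logpow -/X.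
  rewrite (_ : - (s + h) * X = - s * X + - h * X); last by ring.
  by rewrite cexpD; ring.
rewrite Normc.normcM -mulrA ler_wpM2l ?normc_ge0//.
apply: le_trans (cexp_taylor _) _; rewrite -[leRHS]mulrA ler_wpM2l//.
have hX : nc (- h * X) = nc h * ln x.
  by rewrite Normc.normcM normc_real ger0_norm// [nc (- h)](@normcN R).
rewrite hX exprMn [leRHS]mulrC -[leLHS]mulrA ler_wpM2l ?exprn_ge0 ?normc_ge0//.
rewrite ler_wpM2l ?sqr_ge0// -[leRHS]lnK ?posrE// ler_expR.
by rewrite ler_piMl.
Qed.

Let fdiff_remainder_at s j x : 1 <= x -> exists2 C, 0 <= C & forall h, nc h <= 1 ->
  nc (D j (pow_remainder s h) x) <= C * nc h ^+ 2.
Proof.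
elim: j x => [|j IH] x x1; first exact: remainder_at.
have x2 : 1 <= x + 1 by lra.
have [C C0 hC] := IH _ x1; have [C' C'0 hC'] := IH _ x2.
exists (C' + C) => [|h h1]; first exact: addr_ge0.
rewrite iterS {1}/fdiff mulrDl; apply: le_trans (normcB_le _ _) _.
by apply: lerD; [exact: hC'|exact: hC].
Qed.

Let boundary_remainder s k : exists2 C, 0 <= C & forall h, nc h <= 1 ->
  \sum_(0 <= j < k) M j.+1 * nc (D j (pow_remainder s h) 1) <= C * nc h ^+ 2.
Proof.
elim: k => [|k [C C0 IH]].
  by exists 0 => // h _; rewrite big_geq// mul0r.
have [C' C'0 hC'] := fdiff_remainder_at s k (lexx 1).
exists (C + M k.+1 * C') => [|h h1]; first by rewrite addr_ge0// mulr_ge0.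
rewrite big_nat_recr//= mulrDl; apply: lerD; first exact: IH.
by rewrite -mulrA ler_wpM2l// hC'.
Qed.

(** The derivative at z is the regularized sum of - ln n n^-z, and the error is
the regularized sum of the second-order remainder of n^-z. *)
Lemma continuation_taylor z : exists d C, 0 <= C /\ forall h, nc h <= 1 ->
  nc (continuation (z + h) - continuation z - h * d) <= C * nc h ^+ 2.
Proof.
pose k := (depth z).+2.
have kz : 5 <= Re z + k%:R.
  by have := depth_ok z; rewrite /k -addn2 natrD; lra.
have [C C0 hC] := fdiff_pow_remainder_le (m := 2) kz.
have [C' C'0 hC'] := boundary_remainder z k.
have kz3 : 3 <= Re z + k%:R by lra.
exists (reg_sum k (logpow z (- 1) 0)), (C' + 4 * (M k * C)); split.
  by rewrite addr_ge0// !mulr_ge0.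
move=> h h1.
have kzh : 3 <= Re (z + h) + k%:R.
  by have := normc_ge_absRe h; rewrite ReD ler_norml => /andP[]; lra.
rewrite (continuationE kzh) (continuationE kz3).
have s1 := reg_summable_logpow 0 1 kzh.
have [s2 e2] := reg_sumZ (- 1) (reg_summable_logpow 0 1 kz3).
have [s3 e3] := reg_sumZ (- h) (reg_summable_logpow (- 1) 0 kz3).
have [s4 e4] := reg_sumD s1 s2; have [s5 e5] := reg_sumD s4 s3.
have -> : reg_sum k (logpow (z + h) 0 1) - reg_sum k (logpow z 0 1)
    - h * reg_sum k (logpow z (- 1) 0) = reg_sum k (pow_remainder z h).
  rewrite (_ : pow_remainder z h = fun x => logpow (z + h) 0 1 x
      + -1 * logpow z 0 1 x + - h * logpow z (- 1) 0 x); last first.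
    by apply/funext => x; rewrite /pow_remainder; ring.
  by rewrite e5 e4 e2 e3; ring.
have A0 : 0 <= C * nc h ^+ 2 by rewrite mulr_ge0 ?exprn_ge0 ?normc_ge0.
have hn n : (0 <= n)%N -> nc (D k (pow_remainder z h) n.+1%:R)
    <= C * nc h ^+ 2 / n.+1%:R ^+ 2.
  by move=> _; apply: hC; rewrite ?ler1n.
have [_ t] := reg_summable_tail A0 hn.
rewrite big_geq// subr0 divr1 in t.
rewrite /reg_sum; apply: le_trans (normcD_le _ _) _; rewrite mulrDl.
apply: lerD; last by apply: le_trans t _; rewrite -!mulrA.
apply: le_trans (hC' h h1); apply: le_trans (normc_sum_le _ _) _.
by apply: ler_sum => j _; rewrite Normc.normcM ler_wpM2r ?normc_ge0.
Qed.

Lemma continuation_entire : entire_continuation (b 0) continuation.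
Proof.
split=> [z|s hs].
  by have [d [C [_ H]]] := continuation_taylor z; exact: derivable_complex H.
have [C hC] := continuation_series hs.
apply: (cvg_complex (e := fun N => C / N.+1%:R)) => [N|]; first exact: hC.
by rewrite -(mulr0 C); apply: cvgMr; exact: cvg_harmonic.
Qed.

End continuation.

(** * Means of bounded functions *)

Section bounded_means.
Context d (T : measurableType d) (R : realType) (P : probability T R).
Implicit Types (f g : T -> R) (F G : T -> R[i]).

Definition bounded_mfun f : Prop :=
  measurable_fun setT f /\ exists M, forall x, `|f x| <= M.

Lemma bounded_mfun_integrable f :
  bounded_mfun f -> P.-integrable setT (EFin \o f).
Proof.
move=> [mf [M fM]]; apply: measurable_bounded_integrable => //.
  by rewrite ltey_eq fin_num_measure.
exists M; split; first by rewrite num_real.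
by move=> x Mx y _; apply: le_trans (fM y) _; exact: ltW.
Qed.

Local Notation E f := (\int[P]_x f x).

Lemma meanD f g : bounded_mfun f -> bounded_mfun g ->
  E (fun x => f x + g x) = E f + E g.
Proof. by move=> bf bg; apply: RintegralD => //; exact: bounded_mfun_integrable. Qed.

Lemma meanB f g : bounded_mfun f -> bounded_mfun g ->
  E (fun x => f x - g x) = E f - E g.
Proof. by move=> bf bg; apply: RintegralB => //; exact: bounded_mfun_integrable. Qed.

Lemma meanZ c f : bounded_mfun f -> E (fun x => c * f x) = c * E f.
Proof. by move=> bf; apply: RintegralZl => //; exact: bounded_mfun_integrable. Qed.

Lemma mean_cst c : E (fun=> c) = c.
Proof.
rewrite Rintegral_cst// -[RHS]mulr1; congr (_ * _).
exact: (congr1 fine (probability_setT P)).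
Qed.

Lemma bounded_mfun_cst c : bounded_mfun (fun=> c).
Proof. by split=> //; exists `|c|. Qed.

Lemma bounded_mfunD f g : bounded_mfun f -> bounded_mfun g ->
  bounded_mfun (fun x => f x + g x).
Proof.
move=> [mf [M hM]] [mg [N hN]]; split; first exact: measurable_funD.
by exists (M + N) => x; apply: le_trans (ler_normD _ _) _; exact: lerD.
Qed.

Lemma bounded_mfunM f g : bounded_mfun f -> bounded_mfun g ->
  bounded_mfun (fun x => f x * g x).
Proof.
move=> [mf [M hM]] [mg [N hN]]; split; first exact: measurable_funM.
by exists (M * N) => x; rewrite normrM; exact: ler_pM.
Qed.

Lemma bounded_mfunZ c f : bounded_mfun f -> bounded_mfun (fun x => c * f x).
Proof. by move=> bf; apply: bounded_mfunM => //; exact: bounded_mfun_cst. Qed.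

Lemma bounded_mfunB f g : bounded_mfun f -> bounded_mfun g ->
  bounded_mfun (fun x => f x - g x).
Proof.
move=> bf bg.
have -> : (fun x => f x - g x) = (fun x => f x + -1 * g x).
  by apply/funext => x; rewrite mulN1r.
by apply: bounded_mfunD => //; exact: bounded_mfunZ.
Qed.

Lemma bounded_mfun_sum N (F : nat -> T -> R) :
  (forall i, bounded_mfun (F i)) -> bounded_mfun (fun x => \sum_(i < N) F i x).
Proof.
move=> bF; elim: N => [|N IH].
  by under eq_fun do rewrite big_ord0; exact: bounded_mfun_cst.
by under eq_fun do rewrite big_ord_recr; exact: bounded_mfunD.
Qed.

Lemma mean_sum N (F : nat -> T -> R) : (forall i, bounded_mfun (F i)) ->
  E (fun x => \sum_(i < N) F i x) = \sum_(i < N) E (F i).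
Proof.
move=> bF; elim: N => [|N IH].
  by under eq_Rintegral do rewrite big_ord0; rewrite mean_cst big_ord0.
under eq_Rintegral do rewrite big_ord_recr /=.
by rewrite meanD ?big_ord_recr ?IH//; exact: bounded_mfun_sum.
Qed.

Lemma mean_le f g : bounded_mfun f -> bounded_mfun g ->
  (forall x, f x <= g x) -> E f <= E g.
Proof. by move=> bf bg fg; apply: le_Rintegral => //; exact: bounded_mfun_integrable. Qed.

Lemma mean_norm_le f g : bounded_mfun f -> bounded_mfun g ->
  (forall x, `|f x| <= g x) -> `|E f| <= E g.
Proof.
move=> bf bg fg; rewrite ler_norml; apply/andP; split.
  rewrite -mulN1r -meanZ//; apply: mean_le => //; first exact: bounded_mfunZ.
  by move=> x; have := fg x; rewrite ler_norml => /andP[]; lra.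
by apply: mean_le => // x; have := fg x; rewrite ler_norml => /andP[].
Qed.

Definition complex_mean F : R[i] := E (fun x => Re (F x)) +i* E (fun x => Im (F x)).

Definition bounded_cfun F : Prop :=
  bounded_mfun (fun x => Re (F x)) /\ bounded_mfun (fun x => Im (F x)).

Lemma complex_meanB F G : bounded_cfun F -> bounded_cfun G ->
  complex_mean F - complex_mean G = complex_mean (fun x => F x - G x).
Proof.
move=> [f1 f2] [g1 g2]; apply: complex_ext; rewrite ?(ReD, ImD, ReN, ImN) /=.
  by rewrite -meanB//; apply: eq_Rintegral => x _; rewrite ReD ReN.
by rewrite -meanB//; apply: eq_Rintegral => x _; rewrite ImD ImN.
Qed.

Lemma normc_complex_mean_le F M : bounded_cfun F -> (forall x, nc (F x) <= M) ->
  nc (complex_mean F) <= 2 * M.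
Proof.
move=> [f1 f2] FM; apply: le_trans (normc_le_absD _) _ => /=.
have bM := bounded_mfun_cst M.
have h1 : `|E (fun x => Re (F x))| <= M.
  rewrite -[leRHS]mean_cst; apply: mean_norm_le => // x.
  by apply: le_trans (FM x); exact: normc_ge_absRe.
have h2 : `|E (fun x => Im (F x))| <= M.
  rewrite -[leRHS]mean_cst; apply: mean_norm_le => // x.
  by apply: le_trans (FM x); exact: normc_ge_absIm.
lra.
Qed.

End bounded_means.

(** * The Cantor measure *)

Section cantor_measure_means.
Variable R : realType.
Local Notation U := (uniform_prob (@ltr01 R)).
Local Notation TR := (measurableTypeR R).

Definition cantor_point (x : TR) : R := rescaling (cantor_map x).

Let digit_le n (x : R) : `|2 * binary_digit n x / 3 ^+ n.+1| <= 3 ^- n - 3 ^- n.+1.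
Proof.
have /andP[b0 b1] := binary_digit_itv n x.
have p3 : 0 < (3 : R) ^+ n.+1 by rewrite exprn_gt0.
rewrite ger0_norm; last by rewrite divr_ge0 ?mulr_ge0// ltW.
have -> : 3 ^- n - 3 ^- n.+1 = 2 / 3 ^+ n.+1 :> R.
  by rewrite exprS; field; rewrite expf_neq0.
by rewrite ler_pM2r ?invr_gt0//; lra.
Qed.

Definition cantor_stage K (x : R) : R :=
  \sum_(0 <= k < K) 2 * binary_digit k x / 3 ^+ k.+1.

Lemma cantor_map_stage K x : `|cantor_map x - cantor_stage K x| <= 3 ^- K.
Proof.
have [//|_] := @telescoping_majorant R (fun k => 2 * binary_digit k x / 3 ^+ k.+1)
  (fun k => 3 ^- k) K (fun n _ => digit_le n x).
by apply=> n; rewrite invr_ge0 exprn_ge0.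
Qed.

Lemma cantor_point_itv x : 1 / 2 <= cantor_point x <= 2.
Proof.
have c0 : 0 <= cantor_map x.
  apply: limr_ge; first exact: is_cvg_cantor_series.
  apply: nearW => n; apply: sumr_ge0 => k _.
  by have /andP[b0 b1] := binary_digit_itv k x; rewrite divr_ge0 ?mulr_ge0 ?exprn_ge0.
have := cantor_map_stage 0 x; rewrite /cantor_stage big_geq// subr0 expr0 invr1.
rewrite ger0_norm// => c1; rewrite /cantor_point /rescaling; apply/andP; split; lra.
Qed.

Lemma measurable_cantor_point : measurable_fun setT cantor_point.
Proof.
apply: (measurableT_comp (f := @rescaling R) (g := @cantor_map R)).
  exact: measurable_rescaling.
exact: measurable_cantor_map.
Qed.

Lemma bounded_cantor (f : R -> R) M : measurable_fun setT f ->
  (forall y, `|f y| <= M) -> bounded_mfun (fun x : TR => f (cantor_point x)).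
Proof.
move=> mf fM; split; last by exists M => x.
exact: measurableT_comp mf measurable_cantor_point.
Qed.

Lemma mean_nu (f : R -> R) M : measurable_fun setT f -> (forall y, `|f y| <= M) ->
  \int[nu R]_y f y = \int[U]_x f (cantor_point x).
Proof.
move=> mf fM; rewrite /Rintegral; congr fine.
have mf' : measurable_fun setT (EFin \o f : R -> \bar R) by exact/measurable_EFinP.
have := integral_pushforward (phi := cantor_point) measurable_cantor_point
  (mu := U) (D := setT) (f := EFin \o f) mf' _ measurableT.
rewrite preimage_setT; apply.
exact: (@bounded_mfun_integrable _ _ _ U _ (bounded_cantor mf fM)).
Qed.

(** The left end of the K-th stage interval with index j, in binary. *)
Fixpoint stage_point K (j : nat) : R :=
  if K is K'.+1 then stage_point K' j./2 + 2 * (odd j)%:R / 3 ^+ K else 0.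

Lemma cantor_stageE K j (x : R) : j%:R <= 2 ^+ K * x < j.+1%:R ->
  cantor_stage K x = stage_point K j.
Proof.
elim: K j => [|K IH] j; first by rewrite /cantor_stage big_geq.
move=> /andP[h1 h2]; rewrite /cantor_stage big_nat_recr//=.
have ej := odd_double_half j.
have ejR : j%:R = (odd j)%:R + 2 * (j./2)%:R :> R.
  by rewrite -{1}ej natrD -muln2 natrM mulrC.
have [q0 q1] : 0 <= (odd j)%:R :> R /\ (odd j)%:R <= 1 :> R by case: (odd j).
have hK : (j./2)%:R <= 2 ^+ K * x < (j./2).+1%:R.
  move: h1 h2; rewrite exprS -[j.+1%:R]natr1 -[(j./2).+1%:R]natr1 ejR.
  by move=> ? ?; apply/andP; split; lra.
rewrite -/(cantor_stage K x) (IH _ hK); congr (_ + 2 * _ / _).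
rewrite /binary_digit.
have fl (n : nat) (y : R) : n%:R <= y < n.+1%:R -> Num.floor y = n%:Z.
  by move=> hn; apply: floor_def; rewrite -[n%:Z + 1]/(n%:Z + 1%:Z) -PoszD addn1 !pmulrn in hn *.
rewrite (fl j) ?h1// (fl j./2)//.
by rewrite -!pmulrn ejR addrK.
Qed.

Lemma mean_indic_itv (a b : R) : 0 <= a -> a <= b -> b <= 1 ->
  \int[U]_x (\1_(`[a, b[%classic : set R) x : R) = b - a.
Proof.
move=> a0 ab b1; rewrite /Rintegral integral_indic//= setIT.
rewrite /uniform_prob (eq_integral (fun=> 1%:E)); last first.
  move=> x; rewrite inE /= in_itv /= => /andP[ax xb].
  by rewrite /uniform_pdf (le_trans a0 ax) (ltW (lt_le_trans xb b1)) subr0 invr1.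
rewrite integral_cst//.
transitivity (fine (1 * lebesgue_measure (`[a, b[%classic : set R))%E); first by [].
rewrite mul1e lebesgue_measure_itv /= lte_fin.
by case: ltgtP ab => //= -> _; rewrite subrr.
Qed.

(** Each binary interval of order K has probability 2^-K and on it the Cantor
function is within 3^-K of the stage point; for a Lipschitz function this gives
the mean up to the mesh size. The indicators below leave out the single point 1,
which is accounted for by the missing mass 1 - sum of the indicators, equal to 0
in the mean. *)
Lemma mean_stage (f : R -> R) (M B : R) K : measurable_fun setT f ->
  (forall y, `|f y| <= B) -> (forall y z, `|f y - f z| <= M * `|y - z|) ->
  `|\int[U]_x f (cantor_point x)
    - 2 ^- K * \sum_(j < 2 ^ K) f (rescaling (stage_point K j))|
  <= M * (3 / 2) / 3 ^+ K.
Proof.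
move=> mf fB fM.
have p2 : 0 < (2 : R) ^+ K by rewrite exprn_gt0.
pose I j : set R := `[j%:R / 2 ^+ K, j.+1%:R / 2 ^+ K[%classic.
pose ind j (x : TR) : R := \1_(I j) x.
have bind j : bounded_mfun (ind j).
  split; first by apply: measurable_indic; exact: measurable_itv.
  by exists 1 => x; rewrite /ind indicE; case: (_ \in _); rewrite ?normr1 ?normr0.
have eind (j : 'I_(2 ^ K)) : \int[U]_x ind j x = 2 ^- K.
  rewrite mean_indic_itv.
  - by rewrite -mulrBl -[j.+1%:R]natr1 addrAC subrr add0r mul1r.
  - by rewrite divr_ge0 // ltW.
  - by rewrite ler_pM2r ?invr_gt0// ler_nat.
  - by rewrite ler_pdivrMr// mul1r -natrX ler_nat.
pose S (x : TR) := \sum_(j < 2 ^ K) f (rescaling (stage_point K j)) * ind j x.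
pose W (x : TR) := \sum_(j < 2 ^ K) ind j x.
have bS : bounded_mfun S.
  apply: (@bounded_mfun_sum _ _ _ (2 ^ K) (fun j x => f (rescaling (stage_point K j)) * ind j x)).
  by move=> j; exact: bounded_mfunZ.
have bW : bounded_mfun W by exact: bounded_mfun_sum.
have bf : bounded_mfun (fun x : TR => f (cantor_point x)) by exact: bounded_cantor fB.
have ES : \int[U]_x S x = 2 ^- K * \sum_(j < 2 ^ K) f (rescaling (stage_point K j)).
  rewrite (@mean_sum _ _ _ U (2 ^ K) (fun j x => f (rescaling (stage_point K j)) * ind j x)).
    rewrite mulr_sumr; apply: eq_bigr => j _.
    by rewrite meanZ// eind mulrC.
  by move=> j; exact: bounded_mfunZ.
have EW : \int[U]_x W x = 1.
  rewrite (@mean_sum _ _ _ U (2 ^ K) ind)//; under eq_bigr => j _ do rewrite eind.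
  by rewrite sumr_const card_ord -[LHS]mulr_natl natrX mulfV// gt_eqF.
rewrite -ES -meanB//.
pose c := M * (3 / 2) / 3 ^+ K.
have -> : M * (3 / 2) / 3 ^+ K = \int[U]_x (c + B * (1 - W x)).
  rewrite meanD; [|exact: bounded_mfun_cst|]; last first.
    by apply: bounded_mfunZ; apply: bounded_mfunB => //; exact: bounded_mfun_cst.
  rewrite meanZ; last by apply: bounded_mfunB => //; exact: bounded_mfun_cst.
  rewrite meanB//; last exact: bounded_mfun_cst.
  by rewrite !mean_cst EW subrr mulr0 addr0.
have M0 : 0 <= M.
  by have := fM 1 0; rewrite subr0 normr1 mulr1; apply: le_trans.
have c0 : 0 <= c by rewrite /c divr_ge0 ?exprn_ge0// mulr_ge0//; lra.
apply: mean_norm_le; first exact: bounded_mfunB.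
  apply: bounded_mfunD; first exact: bounded_mfun_cst.
  by apply: bounded_mfunZ; apply: bounded_mfunB => //; exact: bounded_mfun_cst.
move=> x; have [[i hi]|no] := pselect (exists i : 'I_(2 ^ K), I i x); last first.
  have i0 (j : 'I_(2 ^ K)) : ind j x = 0.
    by rewrite /ind indicE memNset//; apply: contra_not no => h; exists j.
  rewrite /S /W big1 => [|j _]; last by rewrite i0 mulr0.
  rewrite big1 => [|j _]; last by rewrite i0.
  by rewrite !subr0 mulr1; apply: le_trans (fB _) _; rewrite lerDr.
have hix : i%:R <= 2 ^+ K * x < i.+1%:R.
  move: hi; rewrite /I /= in_itv /= ler_pdivrMr// ltr_pdivlMr//.
  by rewrite [x * _]mulrC.
have ii : ind i x = 1 by rewrite /ind indicE mem_set.
have i0 (j : 'I_(2 ^ K)) : j != i -> ind j x = 0.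
  move=> ji; rewrite /ind indicE memNset// /I /= in_itv /= ler_pdivrMr// ltr_pdivlMr//.
  rewrite [x * _]mulrC => /andP[j1 j2]; case/negP: ji; apply/eqP/val_inj => /=.
  case/andP: hix => i1 i2.
  have := le_lt_trans j1 i2; have := le_lt_trans i1 j2.
  by rewrite !ltr_nat !ltnS => a b; apply/eqP; rewrite eqn_leq b a.
have -> : S x = f (rescaling (stage_point K i)).
  rewrite /S (bigD1 i)//= ii mulr1 big1 ?addr0// => j ji.
  by rewrite i0 ?mulr0.
have -> : W x = 1.
  by rewrite /W (bigD1 i)//= ii big1 ?addr0// => j ji; rewrite i0.
rewrite subrr mulr0 addr0; apply: le_trans (fM _ _) _.
rewrite /c -mulrA ler_wpM2l//.
rewrite /cantor_point /rescaling -(cantor_stageE hix).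
have -> : 1 / 2 + 3 / 2 * cantor_map x - (1 / 2 + 3 / 2 * cantor_stage K x)
  = 3 / 2 * (cantor_map x - cantor_stage K x) by ring.
rewrite normrM ger0_norm; last by lra.
by rewrite ler_wpM2l ?cantor_map_stage//; lra.
Qed.

End cantor_measure_means.

(** * The Fourier coefficients of the Cantor measure *)

Section cantor_coefficients.
Variable R : realType.
Local Notation U := (uniform_prob (@ltr01 R)).
Local Notation TR := (measurableTypeR R).
Implicit Types (n k K : nat) (y z : R).

Definition cis y : R[i] := cos y +i* sin y.

Lemma cisD y z : cis (y + z) = cis y * cis z.
Proof.
by apply: complex_ext; rewrite ?(ReM, ImM) /= ?cosD ?sinD//; ring.
Qed.

Lemma normc_cis y : nc (cis y) = 1.
Proof. by rewrite /= cos2Dsin2 sqrtr1. Qed.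

Lemma bounded_trig (f : R -> R) n : continuous f -> (forall y, `|f y| <= 1) ->
  measurable_fun setT (fun y => f (n%:R * y)) /\ (forall y, `|f (n%:R * y)| <= 1).
Proof.
move=> cf f1; split=> // ; apply: continuous_measurable_fun => y.
apply: (continuous_comp (g := f)); last exact: cf.
exact: (der_continuous (derM (der_cst n%:R y) (der_id y))).
Qed.

Lemma lipschitz_trig (f df : R -> R) n : (forall y, der f y (df y)) ->
  (forall y, `|df y| <= 1) ->
  forall y z, `|f (n%:R * y) - f (n%:R * z)| <= n%:R * `|y - z|.
Proof.
move=> hf h1 y z; wlog zy : y z / z <= y.
  move=> H; case: (leP z y) => [|/ltW]; first exact: H.
  by rewrite distrC [`|y - z|]distrC; exact: H.
have nzy : n%:R * z <= n%:R * y by rewrite ler_wpM2l.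
apply: le_trans (der_norm_le nzy (fun x _ => hf x) (fun x _ => h1 x)) _.
by rewrite mul1r -mulrBr [`|y - z|]ger0_norm ?subr_ge0.
Qed.

Let der_sinE y : der (@sin R) y (cos y).
Proof. by apply: der_eq; [exact: (der_sin (der_id y))|rewrite mulr1]. Qed.

Let der_cosE y : der (@cos R) y (- sin y).
Proof. by apply: der_eq; [exact: (der_cos (der_id y))|rewrite mulr1]. Qed.

Lemma nu_hatE n : nu_hat R n = complex_mean U (fun x => cis (n%:R * cantor_point x)).
Proof.
have [m1 b1] := bounded_trig n (@continuous_cos R) (@cos_max R).
have [m2 b2] := bounded_trig n (@continuous_sin R) (@sin_max R).
by rewrite /nu_hat /complex_mean /= (mean_nu m1 b1) (mean_nu m2 b2).
Qed.

Definition stage_coef K n : R[i] :=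
  (2 ^- K)%:C * \sum_(j < 2 ^ K) cis (n%:R * rescaling (stage_point R K j)).

Lemma nu_hat_stage K n : nc (nu_hat R n - stage_coef K n) <= 3 * n%:R / 3 ^+ K.
Proof.
have Re_s (N : nat) (F : 'I_N -> R[i]) :
    Re (\sum_(j < N) F j) = \sum_(j < N) Re (F j) by apply: (big_morph _ (@ReD R)).
have Im_s (N : nat) (F : 'I_N -> R[i]) :
    Im (\sum_(j < N) F j) = \sum_(j < N) Im (F j) by apply: (big_morph _ (@ImD R)).
have [m1 b1] := bounded_trig n (@continuous_cos R) (@cos_max R).
have [m2 b2] := bounded_trig n (@continuous_sin R) (@sin_max R).
have n1 y : `|- sin y| <= 1 :> R by rewrite normrN sin_max.
have h1 := mean_stage K m1 b1 (lipschitz_trig n der_cosE n1).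
have h2 := mean_stage K m2 b2 (lipschitz_trig n der_sinE (@cos_max R)).
rewrite nu_hatE; apply: le_trans (normc_le_absD _) _.
rewrite /stage_coef !(ReD, ImD, ReN, ImN, ReM, ImM) Re_s Im_s /= !mul0r subr0 addr0.
have -> : 3 * n%:R / 3 ^+ K = n%:R * (3 / 2) / 3 ^+ K + n%:R * (3 / 2) / 3 ^+ K :> R.
  by field; rewrite expf_neq0.
exact: lerD.
Qed.

Let sum_double (V : zmodType) (N : nat) (F : nat -> V) :
  \sum_(j < N + N) F j = \sum_(j < N) (F j.*2 + F j.*2.+1).
Proof.
elim: N => [|N IH]; first by rewrite !big_ord0.
by rewrite addSn addnS !big_ord_recr /= IH addnn addrA.
Qed.

(** The two values of the last binary digit are equally likely, which gives one
more factor (1 + e^(i n / 3^K)) / 2. *)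
Lemma stage_coefS K n : stage_coef K.+1 n
  = stage_coef K n * ((1 / 2)%:C * (1 + cis (n%:R / 3 ^+ K))).
Proof.
rewrite /stage_coef expnS mul2n -addnn.
rewrite (sum_double _ (fun j => cis (n%:R * rescaling (stage_point R K.+1 j)))).
have -> : (2 ^- K.+1)%:C = (2 ^- K)%:C * (1 / 2)%:C :> R[i].
  by rewrite -rmorphM; congr (_%:C); rewrite exprS; field; rewrite expf_neq0.
rewrite [RHS]mulrACA; congr (_ * _); rewrite mulr_suml; apply: eq_bigr => j _.
rewrite /= odd_double doubleK uphalf_double /=.
rewrite mulr0n mulr0 mul0r addr0 [RHS]mulrDr [X in _ = X + _]mulr1 -cisD; congr (_ + cis _).
rewrite /rescaling exprS; field.
by rewrite expf_neq0.
Qed.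

Lemma normc_stage_coef K n :
  nc (stage_coef K n) ^+ 2 = diff_mean K (fun x => cos (n%:R * x)).
Proof.
rewrite diff_mean_cos; elim: K => [|K IH].
  rewrite big_ord0 /stage_coef expr0 invr1 mul1r expn0 big_ord_recl big_ord0 addr0.
  by rewrite normc_cis expr1n.
rewrite big_ord_recr /= -IH stage_coefS Normc.normcM exprMn; congr (_ * _).
rewrite Normc.normcM exprMn; set t := n%:R / 3 ^+ K.
have -> : nc (1 / 2)%:C ^+ 2 = 1 / 4 :> R by rewrite normc_real ger0_norm; lra.
have -> : nc (1 + cis t) ^+ 2 = 2 * (1 + cos t).
  by rewrite normc_sqr ReD ImD /= add0r sqrrD sin2cos2; ring.
by field.
Qed.

Let stage_le1 K n : nc (stage_coef K n) <= 1.
Proof.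
rewrite -(@ler_pXn2r _ 2)// ?nnegrE ?normc_ge0// expr1n normc_stage_coef.
by rewrite -[leRHS](diff_mean_cst K); apply: diff_mean_le => x _; exact: cos_le1.
Qed.

Lemma normc_nu_hat_le1 n : nc (nu_hat R n) <= 1.
Proof.
rewrite -subr_le0; apply: (@le0_of_harmonic R _ (3 * n%:R)) => m.
have := nu_hat_stage m n; have := stage_le1 m n.
have := normcD_le (nu_hat R n - stage_coef m n) (stage_coef m n); rewrite subrK.
move=> h1 h2 h3; apply: (@le_trans _ _ (3 * n%:R / 3 ^+ m)); first lra.
rewrite ler_wpM2l ?mulr_ge0// lef_pV2 ?posrE ?exprn_gt0//.
by rewrite -natrX ler_nat ltn_expl.
Qed.

Lemma normc_nu_hat_stage K n :
  `|nc (nu_hat R n) ^+ 2 - diff_mean K (fun x => cos (n%:R * x))|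
  <= 6 * n%:R / 3 ^+ K.
Proof.
rewrite -normc_stage_coef subr_sqr normrM.
have h := nu_hat_stage K n.
have d : `|nc (nu_hat R n) - nc (stage_coef K n)| <= 3 * n%:R / 3 ^+ K.
  apply: le_trans h; rewrite ler_norml; apply/andP; split.
    have := normcD_le (stage_coef K n - nu_hat R n) (nu_hat R n).
    by rewrite subrK normc_distC; lra.
  have := normcD_le (nu_hat R n - stage_coef K n) (stage_coef K n).
  by rewrite subrK; lra.
have s : `|nc (nu_hat R n) + nc (stage_coef K n)| <= 2.
  rewrite ger0_norm ?addr_ge0 ?normc_ge0//.
  by have := stage_le1 K n; have := normc_nu_hat_le1 n; lra.
have := ler_pM (normr_ge0 _) (normr_ge0 _) d s; lra.
Qed.

(** The squared stage coefficients decrease in K, being partial products of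
factors in [0, 1]. *)
Lemma normc_nu_hat_le K n :
  nc (nu_hat R n) ^+ 2 <= diff_mean K (fun x => cos (n%:R * x)).
Proof.
have dec m : diff_mean (m + K) (fun x : R => cos (n%:R * x))
    <= diff_mean K (fun x => cos (n%:R * x)).
  elim: m => [//|m IH]; apply: le_trans IH.
  rewrite addSn !diff_mean_cos big_ord_recr /= ler_piMr//.
    by apply: prodr_ge0 => i _; rewrite divr_ge0// -lerBlDl sub0r cos_geN1.
  by rewrite ler_pdivrMr// mul1r [leRHS](_ : 2 = 1 + 1)// lerD2l cos_le1.
rewrite -subr_le0; apply: (@le0_of_harmonic R _ (6 * n%:R)) => m.
have := normc_nu_hat_stage (m + K) n; rewrite ler_norml => /andP[_].
have := dec m.
move=> h1 h2; apply: (@le_trans _ _ (6 * n%:R / 3 ^+ (m + K))); first lra.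
rewrite ler_wpM2l ?mulr_ge0// lef_pV2 ?posrE ?exprn_gt0//.
rewrite -natrX ler_nat; apply: leq_trans (ltn_expl m (isT : (1 < 3)%N)) _.
by rewrite leq_pexp2l// leq_addr.
Qed.

Lemma normc_nu_hat_ge K n :
  diff_mean K (fun x => cos (n%:R * x)) - nc (nu_hat R n) ^+ 2
  <= 6 * n%:R / 3 ^+ K.
Proof.
by apply: le_trans (normc_nu_hat_stage K n); rewrite distrC; exact: ler_norm.
Qed.

(** The function 1 / (1 - e^(iy)) = 1/2 + (i/2) cot (y/2). On [1/2, 2] the sine
of y/2 stays above 1/8; the maximum makes the formula bounded everywhere. *)
Definition geom_kernel y : R[i] :=
  (1 / 2) +i* (cos (y / 2) * (Num.max (sin (y / 2)) (1 / 8))^-1 / 2).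

Lemma geom_kernelE y : 1 / 2 <= y <= 2 -> geom_kernel y * (1 - cis y) = 1.
Proof.
case/andP=> y1 y2.
have s8 : 1 / 8 <= sin (y / 2) by have := @sin_ge_half R (y / 2); lra.
have s0 : sin (y / 2) != 0 by apply: lt0r_neq0; lra.
rewrite /geom_kernel max_l//.
have ey : y = y / 2 + y / 2 by field.
have h := cos2Dsin2 (y / 2).
have ec : cos y = cos (y / 2) ^+ 2 - sin (y / 2) ^+ 2 by rewrite {1}ey cosD; ring.
have es : sin y = 2 * sin (y / 2) * cos (y / 2) by rewrite {1}ey sinD; ring.
apply: complex_ext; rewrite ?(ReM, ImM, ReD, ImD, ReN, ImN) /= ec es;
  move: (cos _) (sin _) h s0 => c s h s0.
  transitivity ((1 + (c ^+ 2 + s ^+ 2)) / 2); first by field.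
  by rewrite h; field.
transitivity ((1 - (c ^+ 2 + s ^+ 2)) * (c / (2 * s))); first by field.
by rewrite h subrr mul0r.
Qed.

Lemma normc_geom_kernel y : nc (geom_kernel y) <= 5.
Proof.
apply: le_trans (normc_le_absD _) _ => /=.
have m0 : 1 / 8 <= Num.max (sin (y / 2)) (1 / 8) by rewrite le_max lexx orbT.
have : `|cos (y / 2) * (Num.max (sin (y / 2)) (1 / 8))^-1 / 2| <= 1 * 8 / 2.
  rewrite !normrM; apply: ler_pM; rewrite ?mulr_ge0//; last by rewrite ger0_norm.
  apply: ler_pM => //; first exact: cos_max.
  rewrite ger0_norm; last by rewrite invr_ge0; lra.
  by rewrite -[leRHS]invrK lef_pV2 ?posrE; lra.
by move=> h; rewrite [`|1 / 2|]ger0_norm; lra.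
Qed.

Fixpoint iter_kernel k n y : R[i] :=
  if k is k'.+1 then geom_kernel y * iter_kernel k' n y else cis (n%:R * y).

Lemma iter_kernelS k n y : iter_kernel k n.+1 y = iter_kernel k n y * cis y.
Proof.
elim: k => [|k IH] /=; last by rewrite IH mulrA.
by rewrite -cisD -natr1; congr cis; ring.
Qed.

Lemma normc_iter_kernel k n y : nc (iter_kernel k n y) <= 5 ^+ k.
Proof.
elim: k => [|k IH]; first by rewrite normc_cis.
rewrite [iter_kernel _ _ _]/= Normc.normcM exprS.
by apply: ler_pM; rewrite ?normc_ge0// normc_geom_kernel.
Qed.

Lemma measurable_iter_kernel k n :
  measurable_fun setT (fun y => Re (iter_kernel k n y)) /\
  measurable_fun setT (fun y => Im (iter_kernel k n y)).
Proof.
have mk : measurable_fun setT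
    (fun y : R => cos (y / 2) * (Num.max (sin (y / 2)) (1 / 8))^-1 / 2).
  have mh (f : R -> R) : continuous f -> measurable_fun setT (fun y : R => f (y / 2)).
    move=> cf; apply: continuous_measurable_fun => y.
    apply: (@continuous_comp _ _ _ (fun y : R => y / 2) f); last exact: cf.
    exact: (der_continuous (derM (der_id y) (der_cst 2^-1 y))).
  have mV : measurable_fun setT (fun y : R => - (Num.max y (1 / 8))^-1).
    apply: nondecreasing_measurable => // s t st.
    have ms : 0 < Num.max s (1 / 8) by rewrite lt_max; apply/orP; right; lra.
    have mt : 0 < Num.max t (1 / 8) by rewrite lt_max; apply/orP; right; lra.
    rewrite lerN2 lef_pV2 ?posrE// ge_max !le_max st lexx /=.
    by rewrite orbT.
  have mV2 := measurableT_comp mV (mh _ (@continuous_sin R)).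
  rewrite [X in measurable_fun _ X](_ : _ = fun y : R => cos (y / 2)
    * (- (Num.max (sin (y / 2)) (1 / 8))^-1) * (- 2^-1)); last first.
    by apply/funext => y; ring.
  apply: measurable_funM => //; apply: measurable_funM => //.
  exact: (mh _ (@continuous_cos R)).
elim: k => [|k [IH1 IH2]].
  have [m1 _] := bounded_trig n (@continuous_cos R) (@cos_max R).
  by have [m2 _] := bounded_trig n (@continuous_sin R) (@sin_max R).
split; rewrite [X in measurable_fun _ X]/=.
  under eq_fun do rewrite ReM.
  by apply: measurable_funB; apply: measurable_funM.
under eq_fun do rewrite ImM.
by apply: measurable_funD; apply: measurable_funM.
Qed.

(** Dividing by 1 - e^(iy) under the mean inverts the difference in n, and the
result stays bounded in n. *)
Definition iter_coef k n : R[i] :=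
  complex_mean U (fun x => iter_kernel k n (cantor_point x)).

Let bounded_iter k n : bounded_cfun (fun x : TR => iter_kernel k n (cantor_point x)).
Proof.
have [m1 m2] := measurable_iter_kernel k n; split.
  apply: (bounded_cantor (M := 5 ^+ k) m1) => y.
  by apply: le_trans (normc_iter_kernel k n y); exact: normc_ge_absRe.
apply: (bounded_cantor (M := 5 ^+ k) m2) => y.
by apply: le_trans (normc_iter_kernel k n y); exact: normc_ge_absIm.
Qed.

Lemma iter_coef0 : iter_coef 0 = nu_hat R.
Proof. by apply/funext => n; rewrite nu_hatE. Qed.

Lemma iter_coef_sum k n : iter_coef k.+1 n - iter_coef k.+1 n.+1 = iter_coef k n.
Proof.
rewrite complex_meanB; [|exact: bounded_iter..].
rewrite /iter_coef; congr complex_mean; apply/funext => x /=.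
rewrite iter_kernelS mulrA -{1}[geom_kernel _ * _]mulr1 -mulrBr mulrAC.
by rewrite geom_kernelE ?cantor_point_itv// mul1r.
Qed.

Lemma iter_coef_le k n : nc (iter_coef k n) <= 2 * 5 ^+ k.
Proof.
apply: normc_complex_mean_le; first exact: bounded_iter.
by move=> x; exact: normc_iter_kernel.
Qed.

End cantor_coefficients.

(** * Mean squares of Dirichlet polynomials *)

Section mean_squares.
Variable R : realType.
Implicit Types (c a : nat -> R[i]) (l : nat -> R) (N m n : nat) (t T : R).
Local Notation mu := (@lebesgue_measure R).

Definition exp_poly c l N t : R[i] := \sum_(n < N) c n * cis (- (t * l n)).

Lemma ftc2_der (f F : R -> R) (a b : R) : a < b -> continuous f ->
  (forall t, der F t (f t)) -> \int[mu]_(t in `[a, b]) f t = F b - F a.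
Proof.
move=> ab cf hF; rewrite /Rintegral (@continuous_FTC2 R f F)//.
- exact: continuous_subspaceT.
- split=> [t _||].
  + by case: (hF t).
  + by apply: cvg_at_right_filter; exact: (der_continuous (hF a)).
  + by apply: cvg_at_left_filter; exact: (der_continuous (hF b)).
- by move=> t _; rewrite derive1E; case: (hF t).
Qed.

Lemma der_bigsum2 N (F : nat -> nat -> R -> R) (G : nat -> nat -> R) t :
  (forall m n, der (F m n) t (G m n)) ->
  der (fun t => \sum_(m < N) \sum_(n < N) F m n t) t (\sum_(m < N) \sum_(n < N) G m n).
Proof.
move=> h; apply: (der_sum (F := fun m t => \sum_(n < N) F m n t)
  (G := fun m => \sum_(n < N) G m n)) => m _.
by apply: (der_sum (F := fun n t => F m n t)) => n _; exact: h.
Qed.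

Lemma normc_exp_poly_sqr c l N t : nc (exp_poly c l N t) ^+ 2 =
  \sum_(m < N) \sum_(n < N)
    ((Re (c m) * Re (c n) + Im (c m) * Im (c n)) * cos ((l m - l n) * t)
     + (Im (c m) * Re (c n) - Re (c m) * Im (c n)) * sin ((l m - l n) * t)).
Proof.
have Re_s (F : 'I_N -> R[i]) :
    Re (\sum_(j < N) F j) = \sum_(j < N) Re (F j) by apply: (big_morph _ (@ReD R)).
have Im_s (F : 'I_N -> R[i]) :
    Im (\sum_(j < N) F j) = \sum_(j < N) Im (F j) by apply: (big_morph _ (@ImD R)).
rewrite normc_sqr /exp_poly Re_s Im_s !expr2 !mulr_suml -big_split.
apply: eq_bigr => m _; rewrite /= !mulr_sumr -big_split; apply: eq_bigr => n _.
have -> : (l m - l n) * t = t * l m - t * l n by ring.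
by rewrite /= !(ReM, ImM) /= !cosN !sinN cosB sinB; ring.
Qed.

Let primitive (al be la t : R) : R :=
  if la == 0 then al * t else (al * sin (la * t) - be * cos (la * t)) * la^-1.

Let der_primitive al be la t :
  der (primitive al be la) t (al * cos (la * t) + be * sin (la * t)).
Proof.
rewrite /primitive; case: eqVneq => [->|la0].
  by der; rewrite !mul0r cos0 sin0; ring.
by der; rewrite /=; field.
Qed.

Lemma continuous_exp_poly_sqr c l N : continuous (fun t => nc (exp_poly c l N t) ^+ 2).
Proof.
under eq_fun do rewrite normc_exp_poly_sqr.
move=> t; pose D (al be la : R) := derD
  (derM (der_cst al t) (der_cos (derM (der_cst la t) (der_id t))))
  (derM (der_cst be t) (der_sin (derM (der_cst la t) (der_id t)))).
exact: (der_continuous (der_bigsum2 N (fun m n =>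
  D (Re (c m) * Re (c n) + Im (c m) * Im (c n))
    (Im (c m) * Re (c n) - Re (c m) * Im (c n)) (l m - l n)))).
Qed.

(** The diagonal terms integrate to T |c_n|^2; an off-diagonal term oscillates
with frequency l_m - l_n and has a primitive of size |c_m c_n| / |l_m - l_n|. *)
Lemma exp_poly_mean_square c l N T : 0 < T ->
  (forall m n, l m = l n -> m = n) ->
  `|\int[mu]_(t in `[T, 2 * T]) nc (exp_poly c l N t) ^+ 2
    - T * \sum_(n < N) nc (c n) ^+ 2|
  <= \sum_(m < N) \sum_(n < N) 4 * (nc (c m) * nc (c n)) * `|l m - l n|^-1.
Proof.
move=> T0 linj.
pose al m n := Re (c m) * Re (c n) + Im (c m) * Im (c n).
pose be m n := Im (c m) * Re (c n) - Re (c m) * Im (c n).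
pose G t := \sum_(m < N) \sum_(n < N) primitive (al m n) (be m n) (l m - l n) t.
have TT : T < 2 * T by lra.
rewrite (ftc2_der (F := G) TT (@continuous_exp_poly_sqr c l N)); last first.
  move=> t; rewrite normc_exp_poly_sqr.
  exact: (@der_bigsum2 N (fun m n => primitive (al m n) (be m n) (l m - l n))
    (fun m n => al m n * cos ((l m - l n) * t) + be m n * sin ((l m - l n) * t)) t
    (fun m n => der_primitive (al m n) (be m n) (l m - l n) t)).
have -> : T * \sum_(n < N) nc (c n) ^+ 2
    = \sum_(m < N) \sum_(n < N) (if m == n then T * nc (c m) ^+ 2 else 0).
  rewrite mulr_sumr; apply: eq_bigr => m _.
  rewrite (bigD1 m)//= eqxx big1 ?addr0// => n nm.
  by rewrite eq_sym (negbTE nm).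
rewrite /G -!sumrB; apply: le_trans (ler_norm_sum _ _ _) _; apply: ler_sum => m _.
rewrite -!sumrB; apply: le_trans (ler_norm_sum _ _ _) _; apply: ler_sum => n _.
have [mn|mn] := eqVneq m n.
  rewrite mn /primitive subrr eqxx normr0 invr0 mulr0.
  by rewrite /al normc_sqr -!expr2 -mulrBr (_ : 2 * T - T = T) 1?mulrC ?subrr ?normr0//; ring.
have la0 : l m - l n != 0.
  by rewrite subr_eq0; apply: contra mn => /eqP/linj/val_inj ->.
rewrite /primitive (negbTE la0) subr0 -mulrBl normrM normfV.
rewrite ler_wpM2r ?invr_ge0//.
have hal : `|al m n| <= nc (c m) * nc (c n).
  rewrite -ler_sqr ?nnegrE ?mulr_ge0 ?normc_ge0// real_normK ?num_real//.
  rewrite exprMn !normc_sqr -subr_ge0.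
  rewrite (_ : _ - _ = (be m n) ^+ 2) ?sqr_ge0// /al /be; ring.
have hbe : `|be m n| <= nc (c m) * nc (c n).
  rewrite -ler_sqr ?nnegrE ?mulr_ge0 ?normc_ge0// real_normK ?num_real//.
  rewrite exprMn !normc_sqr -subr_ge0.
  rewrite (_ : _ - _ = (al m n) ^+ 2) ?sqr_ge0// /al /be; ring.
have tr (x y : R) : `|y| <= 1 -> `|x| <= nc (c m) * nc (c n) ->
    `|x * y| <= nc (c m) * nc (c n).
  by move=> hy hx; rewrite normrM; apply: le_trans hx; rewrite ler_piMr.
have t1 := tr _ _ (sin_max ((l m - l n) * (2 * T))) hal.
have t2 := tr _ _ (sin_max ((l m - l n) * T)) hal.
have t3 := tr _ _ (cos_max ((l m - l n) * (2 * T))) hbe.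
have t4 := tr _ _ (cos_max ((l m - l n) * T)) hbe.
move: t1 t2 t3 t4; rewrite !ler_norml => /andP[? ?] /andP[? ?] /andP[? ?] /andP[? ?].
by apply/andP; split; lra.
Qed.

Definition inv_sqrt n : R := expR (- (1 / 2) * ln n.+1%:R).

Lemma inv_sqrt_sqr n : inv_sqrt n ^+ 2 = n.+1%:R^-1.
Proof.
rewrite /inv_sqrt -expRM_natl mulrA mulr_natl.
rewrite (_ : - (1 / 2) *+ 2 = -1); last by rewrite mulr2n; field.
by rewrite mulN1r -lnV ?posrE// lnK ?posrE ?invr_gt0.
Qed.

(** For x > y, ln (x/y) >= (x - y) / x, and x / (x - y) = 1 + y / (x - y) where
y / sqrt (x y) <= 1. *)
Lemma log_gap_le m n : m != n ->
  inv_sqrt m * inv_sqrt n * `|ln m.+1%:R - ln n.+1%:R|^-1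
  <= inv_sqrt m * inv_sqrt n + `|m%:R - n%:R|^-1.
Proof.
wlog nm : m n / (n < m)%N.
  move=> H mn; case: (ltngtP n m) => [nm|nm|e]; first exact: H.
    rewrite [inv_sqrt m * _]mulrC distrC [`|m%:R - _|]distrC.
    by apply: H; rewrite 1?eq_sym.
  by move: mn; rewrite e eqxx.
move=> _; have rm := inv_sqrt_sqr m; have rn := inv_sqrt_sqr n.
have m0 : 0 < inv_sqrt m by exact: expR_gt0.
have n0 : 0 < inv_sqrt n by exact: expR_gt0.
set x : R := m.+1%:R in rm *; set y : R := n.+1%:R in rn *.
have xy : y < x by rewrite ltr_nat.
have y0 : 0 < y by rewrite ltr0n.
have x0 : 0 < x by rewrite ltr0n.
have -> : m%:R - n%:R = x - y :> R.
  by rewrite /x /y -[m.+1%:R]natr1 -[n.+1%:R]natr1; ring.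
have lxy : (x - y) / x <= ln x - ln y.
  have := @le_ln1Dx R (- ((x - y) / x)).
  have -> : 1 + - ((x - y) / x) = y / x by field; rewrite gt_eqF.
  rewrite ln_div ?posrE// ltrN2 ltr_pdivrMr// mul1r => H.
  have : x - y < x by lra.
  by move=> /H h; rewrite -lerN2 opprB.
have d0 : 0 < (x - y) / x by rewrite divr_gt0//; lra.
have l0 := lt_le_trans d0 lxy.
rewrite [`|ln x - _|]gtr0_norm//.
rewrite [`|x - y|]ger0_norm; last by lra.
apply: (@le_trans _ _ (inv_sqrt m * inv_sqrt n * (x / (x - y)))).
  apply: ler_wpM2l; first by rewrite mulr_ge0// ltW.
  rewrite -[leRHS]invrK invf_div.
  by rewrite lef_pV2 ?posrE.
have -> : x / (x - y) = 1 + y / (x - y).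
  by field; apply: lt0r_neq0; lra.
rewrite mulrDr mulr1 lerD2l mulrA; apply: ler_piMl.
  by rewrite invr_ge0 subr_ge0 ltW.
have mn : inv_sqrt m <= inv_sqrt n.
  by rewrite -ler_sqr ?nnegrE ?(ltW m0) ?(ltW n0)// rm rn lef_pV2 ?posrE// ltW.
have : inv_sqrt n ^+ 2 * y = 1 by rewrite rn mulVf// gt_eqF.
by rewrite expr2 => <-; do 2 (apply: ler_wpM2r; first exact: ltW).
Qed.

(** The term n = m is 0, being the inverse of 0. *)
Lemma sum_inv_dist_le m N : (m < N)%N ->
  \sum_(n < N) `|m%:R - n%:R : R|^-1 <= 2 * \sum_(0 <= i < N) i.+1%:R^-1.
Proof.
move=> mN; rewrite -(big_mkord xpredT (fun n => `|m%:R - n%:R : R|^-1)).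
have mono k : (k <= N)%N ->
    \sum_(0 <= i < k) i.+1%:R^-1 <= \sum_(0 <= i < N) (i.+1%:R^-1 : R).
  by move=> kN; rewrite [leRHS](big_cat_nat _ kN)//= lerDl; apply: sumr_ge0.
rewrite (big_cat_nat _ (ltnW mN))//=.
suff [h1 h2] : \sum_(0 <= n < m) `|m%:R - n%:R : R|^-1 <= \sum_(0 <= i < m) i.+1%:R^-1
    /\ \sum_(m <= n < N) `|m%:R - n%:R : R|^-1 <= \sum_(0 <= i < N - m) i.+1%:R^-1.
  by have := mono _ (ltnW mN); have := mono _ (leq_subr m N); lra.
split.
  rewrite big_nat_rev /= !big_nat; apply: ler_sum => i /andP[_ im].
  by rewrite add0n natrB// opprB addrCA subrr addr0 ger0_norm.
rewrite -{1}[m]add0n big_addn.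
case: (N - m)%N => [|M]; first by rewrite !big_geq.
rewrite big_nat_recl//= add0n subrr normr0 invr0 add0r.
rewrite big_nat_recr//=; apply: le_trans (_ : _ <= \sum_(0 <= i < M) i.+1%:R^-1) _.
  apply: ler_sum => i _.
  by rewrite natrD opprD addrCA subrr addr0 normrN ger0_norm.
by rewrite lerDl.
Qed.

(** Both kernels are summed by 2 A_m A_n <= A_m^2 + A_n^2. *)
Lemma off_diagonal_le (A : nat -> R) N : (forall n, 0 <= A n) ->
  \sum_(m < N) \sum_(n < N)
    4 * (inv_sqrt m * A m * (inv_sqrt n * A n)) * `|ln m.+1%:R - ln n.+1%:R|^-1
  <= 12 * (\sum_(n < N) A n ^+ 2) * \sum_(0 <= i < N) i.+1%:R^-1.
Proof.
move=> A0; set H := \sum_(0 <= i < N) _; set S := \sum_(n < N) A n ^+ 2.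
have HE : H = \sum_(n < N) inv_sqrt n ^+ 2.
  by rewrite /H big_mkord; apply: eq_bigr => i _; rewrite inv_sqrt_sqr.
pose d m n : R := `|m%:R - n%:R|^-1.
have d0 m n : 0 <= d m n by rewrite invr_ge0.
have i0 n : 0 <= inv_sqrt n by exact: expR_ge0.
pose B m n := 2 * (A m ^+ 2 * inv_sqrt n ^+ 2 + A n ^+ 2 * inv_sqrt m ^+ 2)
  + 2 * (A m ^+ 2 * d m n + A n ^+ 2 * d n m).
apply: (@le_trans _ _ (\sum_(m < N) \sum_(n < N) B m n)).
  apply: ler_sum => m _; apply: ler_sum => n _.
  have [->|mn] := eqVneq m n.
    rewrite subrr normr0 invr0 mulr0 /B.
    by rewrite !(addr_ge0, mulr_ge0) ?d0 ?sqr_ge0.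
  have h := log_gap_le (mn : val m != val n).
  have AA : 0 <= A m * A n by rewrite mulr_ge0.
  have := ler_wpM2l AA h.
  have e1 : 0 <= (A m * inv_sqrt n - A n * inv_sqrt m) ^+ 2 by rewrite sqr_ge0.
  have dd : d n m = d m n by rewrite /d distrC.
  have e2 : 0 <= (A m - A n) ^+ 2 * d m n by rewrite mulr_ge0 ?sqr_ge0.
  rewrite /B dd -/(d m n).
  move: e1 e2; rewrite !sqrrB !expr2; nra.
rewrite /B; under eq_bigr => m _ do rewrite big_split /= -!mulr_sumr !big_split /=.
rewrite big_split /= -!mulr_sumr !big_split /=.
have s1 : \sum_(m < N) \sum_(n < N) A m ^+ 2 * inv_sqrt n ^+ 2 = S * H.
  rewrite HE /S mulr_suml; apply: eq_bigr => m _.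
  by rewrite mulr_sumr.
have s2 : \sum_(m < N) \sum_(n < N) A n ^+ 2 * inv_sqrt m ^+ 2 = S * H.
  by rewrite exchange_big.
have s3 : \sum_(m < N) \sum_(n < N) A m ^+ 2 * d m n <= S * (2 * H).
  rewrite /S mulr_suml; apply: ler_sum => m _; rewrite -mulr_sumr ler_wpM2l ?sqr_ge0//.
  exact: sum_inv_dist_le.
have s4 : \sum_(m < N) \sum_(n < N) A n ^+ 2 * d n m <= S * (2 * H).
  by rewrite exchange_big.
rewrite s1 s2; lra.
Qed.

Lemma cpow_critical n t : cpow n.+1 (- ((1 / 2) +i* t))
  = (inv_sqrt n)%:C * cis (- (t * ln n.+1%:R)).
Proof.
pose z : R[i] := - ((1 / 2) +i* t) * (ln n.+1%:R)%:C.
rewrite /cpow -/z /cexp /inv_sqrt /cis.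
have -> : Re z = - (1 / 2) * ln n.+1%:R by rewrite /z ReM ReN ImN /=; ring.
by have -> : Im z = - (t * ln n.+1%:R) by rewrite /z ImM ReN ImN /=; ring.
Qed.

(** The weights n^(-1/2) of the critical line are those of off_diagonal_le, so
the off-diagonal terms exceed the square sum only by a logarithm. *)
Lemma dirichlet_poly_mean_square a N T : 0 < T ->
  `|\int[mu]_(t in `[T, 2 * T])
      nc (\sum_(0 <= n < N) a n.+1 * cpow n.+1 (- ((1 / 2) +i* t))) ^+ 2
    - T * \sum_(0 <= n < N) nc (a n.+1) ^+ 2 / n.+1%:R|
  <= 12 * (\sum_(0 <= n < N) nc (a n.+1) ^+ 2) * \sum_(0 <= i < N) i.+1%:R^-1.
Proof.
move=> T0; pose c n := (inv_sqrt n)%:C * a n.+1.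
pose l n : R := ln n.+1%:R.
have linj m n : l m = l n -> m = n.
  move=> h; have : m.+1%:R = n.+1%:R :> R by apply: ln_inj h; rewrite posrE.
  by move=> /eqP; rewrite eqr_nat => /eqP [].
have E t : \sum_(0 <= n < N) a n.+1 * cpow n.+1 (- ((1 / 2) +i* t))
    = exp_poly c l N t.
  rewrite /exp_poly big_mkord; apply: eq_bigr => n _.
  by rewrite cpow_critical /c; ring.
under eq_Rintegral do rewrite E.
have nE n : nc (c n) = inv_sqrt n * nc (a n.+1).
  by rewrite Normc.normcM normc_real ger0_norm// expR_ge0.
have -> : \sum_(0 <= n < N) nc (a n.+1) ^+ 2 / n.+1%:R = \sum_(n < N) nc (c n) ^+ 2.
  by rewrite big_mkord; apply: eq_bigr => n _; rewrite nE exprMn inv_sqrt_sqr mulrC.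
apply: le_trans (exp_poly_mean_square c N T0 linj) _.
rewrite [X in 12 * X]big_mkord.
have := @off_diagonal_le (fun n => nc (a n.+1)) N (fun n => normc_ge0 _).
apply: le_trans; apply: ler_sum => m _; apply: ler_sum => n _.
by rewrite !nE.
Qed.

Lemma continuous_dirichlet_poly a N : continuous (fun t =>
  nc (\sum_(0 <= n < N) a n.+1 * cpow n.+1 (- ((1 / 2) +i* t))) ^+ 2).
Proof.
pose c n := (inv_sqrt n)%:C * a n.+1; pose l n : R := ln n.+1%:R.
rewrite [X in continuous X](_ : _ = fun t => nc (exp_poly c l N t) ^+ 2).
  exact: continuous_exp_poly_sqr.
apply/funext => t; congr (nc _ ^+ 2).
rewrite /exp_poly big_mkord; apply: eq_bigr => n _.
by rewrite cpow_critical /c; ring.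
Qed.

(** Meant for f = u^2 and g = v^2, where |f - g| is at most eta g plus a multiple
of the squared error |u - v|^2. *)
Lemma integral_compare (f g : R -> R) (a b eta e : R) : a <= b ->
  continuous f -> continuous g ->
  (forall t, a <= t <= b -> `|f t - g t| <= eta * g t + e) ->
  `|\int[mu]_(t in `[a, b]) f t - \int[mu]_(t in `[a, b]) g t|
  <= eta * \int[mu]_(t in `[a, b]) g t + e * (b - a).
Proof.
move=> ab cf cg fg.
have ic (h : R -> R) : continuous h -> mu.-integrable `[a, b] (EFin \o h).
  move=> ch; apply: continuous_compact_integrable; first exact: segment_compact.
  exact: continuous_subspaceT.
have ce : continuous (fun t => eta * g t + e).
  by move=> t; apply: cvgD; [apply: cvgM; [exact: cvg_cst|exact: cg]|exact: cvg_cst].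
have cd : continuous (fun t => f t - g t).
  by move=> t; apply: cvgB; [exact: cf|exact: cg].
have cn : continuous (fun t => `|f t - g t|).
  move=> t; apply: (@continuous_comp _ _ _ (fun t => f t - g t) (fun y : R => `|y|)).
    exact: cd.
  exact: norm_continuous.
rewrite -RintegralB//; [|exact: ic..].
apply: (@le_trans _ _ (\int[mu]_(t in `[a, b]) `|f t - g t|)).
  by apply: le_normr_Rintegral => //; exact: (ic _ cd).
apply: (@le_trans _ _ (\int[mu]_(t in `[a, b]) (eta * g t + e))).
  apply: le_Rintegral.
  - exact: measurable_itv.
  - exact: (ic _ cn).
  - exact: (ic _ ce).
  - by move=> t /=; rewrite in_itv /=; exact: fg.
rewrite RintegralD//; last 2 first.
- by apply: (ic (fun t => eta * g t)) => t; apply: cvgM; [exact: cvg_cst|exact: cg].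
- by apply: (ic (fun=> e)) => t; exact: cvg_cst.
rewrite RintegralZl//; last exact: ic.
rewrite lerD2l Rintegral_cst//= lebesgue_measure_itv /= lte_fin.
by case: ltgtP ab => //= -> _; rewrite subrr.
Qed.

End mean_squares.

(** * The mean square on the critical line *)

Section critical_line.
Variable R : realType.
Implicit Types (t T : R) (N K : nat).
Local Notation mu := (@lebesgue_measure R).
Local Notation L := (continuation (iter_coef R)).
Local Notation line t := ((1 / 2) +i* t).

Let M k : R := 2 * 5 ^+ k.

Lemma local_lipschitz_continuous (f : R -> R) :
  (forall t, exists C, forall h, `|h| <= 1 -> `|f (t + h) - f t| <= C * `|h|) ->
  continuous f.
Proof.
move=> H t; have [C hC] := H t; apply/cvgrPdist_lt => e e0.
pose C1 := `|C| + 1; have C10 : 0 < C1 by rewrite ltr_wpDl.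
have d0 : 0 < Num.min 1 (e / C1) by rewrite lt_min ltr01 divr_gt0.
near=> u.
have : `|t - u| < Num.min 1 (e / C1).
  by near: u; apply: cvgr_dist_lt => //; exact: cvg_id.
rewrite lt_min distrC => /andP[u1 ue].
have := hC (u - t) (ltW u1); rewrite subrKC distrC => h; apply: le_lt_trans h _.
apply: (@le_lt_trans _ _ (C1 * `|u - t|)).
  by rewrite ler_wpM2r// /C1; have := ler_norm C; lra.
by rewrite mulrC -ltr_pdivlMr.
Unshelve. all: by end_near. Qed.

Lemma continuous_continuation_sqr : continuous (fun t => nc (L (line t)) ^+ 2).
Proof.
have lip t : exists C, forall h : R, `|h| <= 1 ->
    nc (L (line (t + h)) - L (line t)) <= C * `|h|.
  have [d [C [C0 H]]] := continuation_taylor (@iter_coef_sum R) (@iter_coef_le R) (line t).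
  exists (C + nc d) => h h1.
  have nh : nc (0 +i* h) = `|h| by rewrite /= expr0n add0r sqrtr_sqr.
  have lE : line (t + h) = line t + (0 +i* h).
    by apply: complex_ext; rewrite ?(ReD, ImD) /= ?addr0.
  have := H (0 +i* h); rewrite nh -lE => /(_ h1) h2.
  have := normcD_le (L (line (t + h)) - L (line t) - (0 +i* h) * d) ((0 +i* h) * d).
  rewrite subrK Normc.normcM nh => h3; apply: le_trans h3 _.
  have : C * `|h| ^+ 2 <= C * `|h|.
    by rewrite ler_wpM2l// expr2 ler_piMl.
  lra.
under eq_fun do rewrite normc_sqr.
have cf (f : R[i] -> R) : (forall z w, f z - f w = f (z - w)) ->
    (forall z, `|f z| <= nc z) -> continuous (fun t => f (L (line t)) ^+ 2).
  move=> fB fn t.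
  have cl : continuous (fun t => f (L (line t))).
    apply: local_lipschitz_continuous => {}t; have [C hC] := lip t.
    by exists C => h h1; rewrite fB; apply: le_trans (fn _) (hC h h1).
  rewrite (_ : (fun t => f (L (line t)) ^+ 2)
    = (fun t => f (L (line t)) * f (L (line t)))); last by apply/funext => u; rewrite expr2.
  by apply: cvgM; exact: cl.
move=> t; apply: cvgD.
  by apply: cf => [z w|z]; [rewrite ReD ReN|exact: normc_ge_absRe].
by apply: cf => [z w|z]; [rewrite ImD ImN|exact: normc_ge_absIm].
Qed.

Let expR_ln_half n j : expR (- (1 / 2 + j%:R) * ln n.+1%:R)
  = inv_sqrt R n / n.+1%:R ^+ j.
Proof.
rewrite /inv_sqrt opprD mulrDl expRD; congr (_ * _).
rewrite mulNr mulr_natl -lnXn// -lnV ?posrE ?exprn_gt0// lnK//.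
by rewrite posrE invr_gt0 exprn_gt0.
Qed.

Let approx_const : R := \sum_(0 <= j < 3) M j.+1 * (2 * 6 ^+ j) + 4 * (M 3 * 432).

(** Three summations by parts past N: each boundary term carries powers of
T / N <= 1, and the remaining series is at most T^3 N^(-5/2). *)
Lemma continuation_approx T N t : 1 <= T -> T ^+ 3 <= N.+1%:R ^+ 2 ->
  T <= t <= 2 * T ->
  nc (L (line t) - \sum_(0 <= n < N) nu_hat R n.+1 * cpow n.+1 (- line t))
  <= approx_const * inv_sqrt R N.
Proof.
move=> T1 TN /andP[t1 t2].
set s := line t; set r := inv_sqrt R N; set x : R := N.+1%:R in TN *.
have r0 : 0 <= r by exact: expR_ge0.
have x1 : 1 <= x by rewrite ler1n.
have rx : r ^+ 2 = x^-1 by exact: inv_sqrt_sqr.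
have Tx : T <= x.
  rewrite leNgt; apply/negP => xT.
  have : x ^+ 2 < T ^+ 2 by rewrite ltr_pXn2r ?nnegrE//; lra.
  have : T ^+ 2 <= T ^+ 3 by rewrite ler_weXn2l.
  lra.
have ns : nc s + 3 <= 6 * T.
  have := normc_le_absD s; rewrite /s /= [`|1 / 2|]ger0_norm; last by lra.
  rewrite ger0_norm; lra.
have sE : Re s = 1 / 2 by [].
have s3 : 3 <= Re s + 3%:R by rewrite sE; lra.
rewrite (continuationE (@iter_coef_sum R) (@iter_coef_le R) s3) (reg_sum_expand (@iter_coef_sum R) 3 _ N).
have -> : \sum_(0 <= n < N) iter_coef R 0 n.+1 * logpow s 0 1 n.+1%:R
    = \sum_(0 <= n < N) nu_hat R n.+1 * cpow n.+1 (- s).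
  by apply: eq_bigr => n _; rewrite iter_coef0 /logpow mul0r add0r mul1r.
have cancel3 (u v w : R[i]) : u + v + w - u = v + w by ring.
rewrite cancel3; apply: le_trans (normcD_le _ _) _; rewrite mulrDl; apply: lerD.
  apply: le_trans (normc_sum_le _ _) _; rewrite mulr_suml.
  rewrite !big_nat; apply: ler_sum => j /andP[_ j3].
  rewrite Normc.normcM -mulrA; apply: ler_pM; rewrite ?normc_ge0 ?iter_coef_le//.
  have j0 : 0 <= j%:R :> R by [].
  have j3' : j%:R <= 3 :> R by rewrite ler_nat ltnW.
  apply: le_trans (fdiff_pow_le x1 _) _; first by rewrite sE addr_ge0.
  rewrite -[leRHS]mulrA ler_wpM2l// sE expR_ln_half -/x -/r mulrA mulrAC.
  rewrite ler_wpM2r// ler_pdivrMr; last by rewrite exprn_gt0//; lra.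
  rewrite -exprMn; apply: lerXn2r; rewrite ?nnegrE.
  - by rewrite addr_ge0// normc_ge0.
  - lra.
  - lra.
pose A := 2 * ((6 * T) ^+ 3 * r ^+ 3).
have A0 : 0 <= A by rewrite !mulr_ge0 ?exprn_ge0//; lra.
have hA n : (N <= n)%N -> nc (iter 3 (@fdiff R _) (logpow s 0 1) n.+1%:R)
    <= A / n.+1%:R ^+ 2.
  move=> Nn; have n1 : 1 <= n.+1%:R :> R by rewrite ler1n.
  have xn : x <= n.+1%:R by rewrite ler_nat.
  apply: le_trans (fdiff_pow_le n1 _) _; first by rewrite sE addr_ge0.
  rewrite sE expR_ln_half.
  have -> : A / n.+1%:R ^+ 2 = 2 * ((6 * T) ^+ 3 * (r ^+ 3 / n.+1%:R ^+ 2)).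
    by rewrite /A -!mulrA.
  rewrite ler_wpM2l//; apply: ler_pM.
  - by rewrite exprn_ge0// addr_ge0// normc_ge0.
  - by rewrite divr_ge0 ?exprn_ge0// expR_ge0.
  - by apply: lerXn2r; rewrite ?nnegrE//; [rewrite addr_ge0 ?normc_ge0|lra].
  rewrite [n.+1%:R ^+ 3]exprS invfM -(inv_sqrt_sqr R n) mulrA.
  rewrite ler_wpM2r ?invr_ge0 ?exprn_ge0// -exprS.
  apply: lerXn2r; rewrite ?nnegrE ?expR_ge0//.
  rewrite -ler_sqr ?nnegrE ?expR_ge0// rx inv_sqrt_sqr lef_pV2 ?posrE//; lra.
have [_ tail] := reg_summable_tail (@iter_coef_le R) A0 hA.
apply: le_trans tail _; rewrite -/x -/(M 3) -rx /A.
have -> : 4 * (M 3 * (2 * ((6 * T) ^+ 3 * r ^+ 3))) * r ^+ 2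
    = 4 * (M 3 * 432) * r * (T ^+ 3 * (r ^+ 2) ^+ 2) by ring.
have M30 : 0 <= 4 * (M 3 * 432).
  have : 0 <= M 3 by rewrite /M mulr_ge0// exprn_ge0.
  lra.
move: (4 * (M 3 * 432)) M30 => c c0.
have x2 : 0 < x ^+ 2 by rewrite exprn_gt0//; lra.
have Tx2 : T ^+ 3 * x^-1 ^+ 2 <= 1 by rewrite exprVn ler_pdivrMr// mul1r.
by rewrite rx ler_piMr// mulr_ge0.
Qed.

Let p n : R := nc (nu_hat R n) ^+ 2.
Let p_ge0 n : 0 <= p n. Proof. by rewrite sqr_ge0. Qed.
Let p_le K n : p n <= diff_mean K (fun x => cos (n%:R * x)).
Proof. exact: normc_nu_hat_le. Qed.
Let p_ge K n : diff_mean K (fun x => cos (n%:R * x)) - p n <= 6 * n%:R / 3 ^+ K.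
Proof. exact: normc_nu_hat_ge. Qed.

Lemma C_nu_cvg : cvgn (series (C_nu_term R)).
Proof. exact: (coef_div_cvg p_ge0 p_le). Qed.

Lemma C_nu_value : `|C_nu R - 1156 / 1000| <= 5 / 10000.
Proof. exact: (sum_coef_div_value p_ge0 p_le p_ge). Qed.

Let power_of_nine T : 1 < T -> exists K, 9 ^+ K <= T /\ T <= 9 ^+ K.+1.
Proof.
move=> T1.
have ex : exists K, T <= 9 ^+ K.
  exists (Num.truncn T).+1; apply: ltW; apply: lt_trans (truncnS_gt T) _.
  by rewrite -natrX ltr_nat ltn_expl.
case: (ex_minnP ex) => -[|K] h min; first by move: h; rewrite expr0; lra.
exists K; split=> //; rewrite leNgt; apply/negP => /ltW/min.
by rewrite ltnn.
Qed.

Let d := cantor_dim R.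

Let ln2_gt0 : 0 < ln (2 : R). Proof. by rewrite ln_gt0// ltr1n. Qed.
Let ln23 : ln (2 : R) < ln 3. Proof. by rewrite ltr_ln ?posrE// ltr_nat. Qed.
Let ln3_gt0 : 0 < ln (3 : R). Proof. exact: lt_trans ln23. Qed.
Let d_ln3 : d * ln 3 = ln 2. Proof. by rewrite /d /cantor_dim divfK// gt_eqF. Qed.

Let d_itv : 0 <= d <= 1.
Proof.
rewrite /d /cantor_dim; apply/andP; split; first by rewrite divr_ge0 ?ltW.
by rewrite ler_pdivrMr// mul1r ltW.
Qed.

(** Since 3^d = 2, taking logarithms reduces these comparisons to 0 <= d <= 1 and
(8/5)^3 <= 9/2. *)
Let scales T K : 1 <= T -> 9 ^+ K <= T ^+ 3 -> T ^+ 3 <= 9 ^+ K.+1 ->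
  let eta := T `^ (- (d / 2)) in
  [/\ 0 < eta <= 1, T `^ (1 - d / 2) = T * eta, 2 ^- K.+1 <= eta,
      (8 / 5) ^+ K <= T * eta & 1 <= T * eta ^+ 2].
Proof.
move=> T1 h1 h2 eta; have T0 : 0 < T by lra.
have /andP[d0 d1] := d_itv.
have lT : 0 <= ln T by exact: ln_ge0.
have etaE : eta = expR (- (d / 2) * ln T) by rewrite /eta /powR gt_eqF.
have TE : T = expR (ln T) by rewrite lnK.
have l9 : ln (9 : R) = 2 * ln 3.
  have n9 : 9 = 3 ^+ 2 :> R by ring.
  by rewrite n9 lnXn// mulr_natl.
have p9 n : 0 < (9 : R) ^+ n by rewrite exprn_gt0.
have ln_mono (a b : R) : 0 < a -> a <= b -> ln a <= ln b.
  by move=> a0 ab; rewrite ler_ln ?posrE//; exact: lt_le_trans ab.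
have k1 : 2 * K%:R * ln 3 <= 3 * ln T.
  by have := ln_mono _ _ (p9 K) h1;
    rewrite !lnXn// -[ln 9 *+ _]mulr_natl -[ln T *+ _]mulr_natl l9; lra.
have k2 : 3 * ln T <= 2 * K.+1%:R * ln 3.
  have T30 : 0 < T ^+ 3 by rewrite exprn_gt0.
  by have := ln_mono _ _ T30 h2;
    rewrite !lnXn// -[ln 9 *+ _]mulr_natl -[ln T *+ _]mulr_natl l9; lra.
have k0 : 0 <= K%:R :> R by [].
have k10 : 0 <= K.+1%:R :> R by [].
split.
- by rewrite etaE expR_gt0 expR_le1 mulNr oppr_le0 mulr_ge0// divr_ge0.
- rewrite etaE [in RHS]TE -expRD /powR gt_eqF//; congr expR.
  by rewrite expRK; ring.
- rewrite etaE -[leLHS]lnK ?posrE ?invr_gt0 ?exprn_gt0// ler_expR.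
  rewrite lnV ?posrE ?exprn_gt0// lnXn// -[ln 2 *+ _]mulr_natl mulNr lerN2.
  have := ler_wpM2l d0 k2.
  have -> : d * (2 * K.+1%:R * ln 3) = 2 * K.+1%:R * ln 2 by rewrite -d_ln3; ring.
  have : 0 <= K.+1%:R * ln 2 :> R by rewrite mulr_ge0// ltW.
  lra.
- rewrite [in leRHS]TE etaE -expRD -[leLHS]lnK ?posrE ?exprn_gt0//.
  rewrite ler_expR lnXn; last lra.
  rewrite -[_ *+ K]mulr_natl.
  have l85 : 3 * ln (8 / 5 : R) <= 2 * ln 3 - ln 2.
    have -> : 2 * ln 3 - ln 2 = ln (9 / 2 : R).
      by rewrite ln_div ?posrE// l9.
    rewrite mulr_natl -lnXn; last lra.
    by apply: ln_mono; [rewrite exprn_gt0//; lra|lra].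
  have d2 : 0 <= 1 - d / 2 by lra.
  have a1 := ler_wpM2l d2 k1; have a2 := ler_wpM2l k0 l85.
  have e1 : (1 - d / 2) * (2 * K%:R * ln 3) = K%:R * (2 * ln 3 - ln 2).
    by rewrite -d_ln3; field.
  rewrite e1 in a1; lra.
rewrite [in leRHS]TE etaE -expRM_natl -expRD -[leLHS]expR0 ler_expR.
have : 0 <= (1 - d) * ln T by rewrite mulr_ge0// subr_ge0.
by lra.
Qed.

(** As 3/2 * 16/15 = 8/5, the linear factor is absorbed by (16/15)^K. *)
Let log_factor K : (3 / 2) ^+ K.+1 * (1 + (2 * K.+1)%:R) <= 48 * (8 / 5) ^+ K :> R.
Proof.
have bern (k : nat) : 1 + k%:R / 15 <= (16 / 15) ^+ k :> R.
  elim: k => [|k IH]; first by rewrite mul0r addr0.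
  rewrite exprS -[k.+1%:R]natr1; have : 0 <= k%:R :> R by []; nra.
have e : 48 * (8 / 5) ^+ K = 30 * ((3 / 2) ^+ K.+1 * (16 / 15) ^+ K.+1) :> R.
  rewrite -exprMn (_ : 3 / 2 * (16 / 15) = 8 / 5 :> R); last by field.
  by rewrite exprS; field.
rewrite e mulrCA; apply: ler_wpM2l; first by rewrite exprn_ge0//; lra.
have := bern K.+1; rewrite natrM; have : 0 <= K.+1%:R :> R by []; lra.
Qed.

(** The approximation error is spread by the inequality 2 u v <= eta u^2 +
v^2 / eta with eta = T^(-d/2), so that eta times the mean square of the
polynomial is of the admissible order. *)
Lemma mean_square_continuation : exists C : R, forall T, 2 <= T ->
  `| \int[mu]_(t in `[T, 2 * T]) nc (L (line t)) ^+ 2 - C_nu R * T |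
  <= C * T `^ (1 - d / 2).
Proof.
set C := C_nu R; set B := approx_const.
have C0 : 0 <= C.
  by have := sum_coef_div_le p_ge0 p_le 0; rewrite big_geq.
exists (27 + 2 * (108 * 48) + C + 2 * B ^+ 2) => T T2.
have T1 : 1 <= T by lra.
have T31 : 1 < T ^+ 3 by rewrite exprn_egt1//; lra.
have [K [h1 h2]] := power_of_nine T31.
have [/andP[e0 e1] -> w2 w85 we] := scales T1 h1 h2.
move: (T `^ (- (d / 2))) e0 e1 w2 w85 we => eta e0 e1 w2 w85 we.
set N := (3 ^ K.+1)%N.
pose D t := \sum_(0 <= n < N) nu_hat R n.+1 * cpow n.+1 (- line t).
pose S := \sum_(0 <= n < N) p n.+1 / n.+1%:R.
have NE : N%:R ^+ 2 = 9 ^+ K.+1 :> R.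
  by rewrite /N natrX -exprM mulnC exprM -natrX.
have TN : T ^+ 3 <= N.+1%:R ^+ 2.
  apply: le_trans h2 _; rewrite -NE; apply: lerXn2r; rewrite ?nnegrE//.
  by rewrite ler_nat.
have TN1 : T <= N.+1%:R.
  rewrite leNgt; apply/negP => xT.
  have : N.+1%:R ^+ 2 < T ^+ 2 by rewrite ltr_pXn2r ?nnegrE//; lra.
  have : T ^+ 2 <= T ^+ 3 by rewrite ler_weXn2l.
  lra.
have S1 : S <= C by exact: (sum_coef_div_le p_ge0 p_le N).
have S2 : C <= S + 27 * 2 ^- K.+1 by exact: (sum_coef_div_tail p_ge0 p_le K.+1).
have T0 : 0 < T by lra.
pose E2 : R := 108 * ((3 / 2) ^+ K.+1 * (1 + (2 * K.+1)%:R)).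
have E2le : E2 <= 108 * 48 * (T * eta).
  have := log_factor K; rewrite /E2; lra.
have E20 : 0 <= E2.
  by rewrite /E2 mulr_ge0// mulr_ge0.
have DS : `|\int[mu]_(t in `[T, 2 * T]) nc (D t) ^+ 2 - T * S| <= E2.
  apply: le_trans (dirichlet_poly_mean_square (nu_hat R) N T0) _.
  have a1 := sum_coef_le p_le K.+1.
  have a2 : \sum_(0 <= i < N) i.+1%:R^-1 <= 1 + (2 * K.+1)%:R :> R.
    exact: (@harmonic_le R 3 K.+1 isT).
  have a3 : 0 <= \sum_(0 <= i < N) p i.+1 by exact: sumr_ge0.
  have a4 : 0 <= \sum_(0 <= i < N) (i.+1%:R^-1 : R) by exact: sumr_ge0.
  have a5 := ler_pM a3 a4 a1 a2.
  rewrite -mulrA /E2.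
  apply: le_trans (ler_wpM2l _ a5) _ => //.
  by rewrite le_eqVlt; apply/orP; left; apply/eqP; ring.
pose rho2 := B ^+ 2 / N.+1%:R.
have rho0 : 0 <= rho2 by rewrite divr_ge0 ?sqr_ge0.
have cmp : `|\int[mu]_(t in `[T, 2 * T]) nc (L (line t)) ^+ 2
    - \int[mu]_(t in `[T, 2 * T]) nc (D t) ^+ 2|
    <= eta * \int[mu]_(t in `[T, 2 * T]) nc (D t) ^+ 2
       + (1 + eta^-1) * rho2 * (2 * T - T).
  apply: integral_compare; first lra.
  - exact: continuous_continuation_sqr.
  - exact: continuous_dirichlet_poly.
  move=> t tT.
  have := continuation_approx T1 TN tT; rewrite -/(D t) -/B => app.
  have app2 : nc (L (line t) - D t) ^+ 2 <= rho2.
    rewrite /rho2 -(inv_sqrt_sqr R N) -exprMn; apply: lerXn2r; rewrite ?nnegrE ?normc_ge0//.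
    exact: le_trans (normc_ge0 _) app.
  set u := nc (L (line t)); set v := nc (D t); set e := nc (L (line t) - D t) in app2.
  have u0 : 0 <= u := normc_ge0 _; have v0 : 0 <= v := normc_ge0 _.
  have ee0 : 0 <= e := normc_ge0 _.
  have uv : `|u - v| <= e.
    rewrite ler_norml; apply/andP; split.
      have := normcD_le (D t - L (line t)) (L (line t)).
      by rewrite subrK normc_distC -/u -/v -/e; lra.
    have := normcD_le (L (line t) - D t) (D t).
    by rewrite subrK -/u -/v -/e; lra.
  have ab : `|u ^+ 2 - v ^+ 2| <= e * (2 * v + e).
    rewrite subr_sqr normrM; apply: ler_pM => //.
    rewrite ger0_norm ?addr_ge0//; move: uv; rewrite ler_norml => /andP[]; lra.
  apply: le_trans ab _.
  have amgm : 2 * (e * v) <= eta * v ^+ 2 + eta^-1 * e ^+ 2.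
    have := sqr_ge0 (eta * v - e) => sq.
    rewrite -(ler_pM2l e0) mulrDr [eta * (eta^-1 * _)]mulrA mulfV ?gt_eqF// mul1r.
    move: sq; rewrite sqrrB exprMn !expr2; lra.
  have i0 : 0 <= eta^-1 by rewrite invr_ge0 ltW.
  have := ler_wpM2l i0 app2; move: app2; rewrite !expr2; rewrite expr2 in amgm; lra.
have rhoT : (1 + eta^-1) * rho2 * (2 * T - T) <= 2 * B ^+ 2 * (T * eta).
  have -> : 2 * T - T = T by ring.
  have i1 : 1 + eta^-1 <= 2 * eta^-1.
    have : 1 <= eta^-1 by rewrite invf_ge1.
    lra.
  have r1 : rho2 <= B ^+ 2 * T^-1.
    by rewrite /rho2 ler_wpM2l ?sqr_ge0// lef_pV2 ?posrE.
  have i0 : 0 <= 1 + eta^-1 by rewrite addr_ge0// invr_ge0 ltW.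
  have := ler_pM i0 rho0 i1 r1 => q.
  apply: (@le_trans _ _ (2 * eta^-1 * (B ^+ 2 * T^-1) * T)).
    by rewrite ler_wpM2r// ltW.
  rewrite [leLHS](_ : _ = 2 * B ^+ 2 * eta^-1); last by field; rewrite !gt_eqF.
  apply: ler_wpM2l; first by rewrite mulr_ge0// sqr_ge0.
  by rewrite -[leLHS]div1r ler_pdivrMr// -mulrA -expr2.
have TS1 : T * S <= T * C by rewrite ler_wpM2l// ltW.
have TS2 : T * C <= T * S + 27 * (T * eta).
  have : T * C <= T * (S + 27 * 2 ^- K.+1) by rewrite ler_wpM2l// ltW.
  have : T * 2 ^- K.+1 <= T * eta by rewrite ler_wpM2l// ltW.
  lra.
have ID : eta * \int[mu]_(t in `[T, 2 * T]) nc (D t) ^+ 2 <= C * (T * eta) + E2.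
  move: DS; rewrite ler_norml => /andP[_ hi].
  have : eta * \int[mu]_(t in `[T, 2 * T]) nc (D t) ^+ 2 <= eta * (T * C + E2).
    by rewrite ler_wpM2l ?(ltW e0)//; lra.
  have : eta * E2 <= E2 by rewrite ler_piMl.
  lra.
move: cmp DS; rewrite !ler_norml => /andP[c1 c2] /andP[b1 b2].
by apply/andP; split; lra.
Qed.

End critical_line.

Theorem theorem9p10 (R : realType) :
  cvgn (series (C_nu_term R)) /\
  `|C_nu R - 1156 / 1000| <= 5 / 10000 /\
  exists L : R[i] -> R[i],
    entire_continuation (@nu_hat R) L /\
    exists K : R, \forall T \near +oo,
      `| (\int[lebesgue_measure]_(t in `[T, 2 * T])
           Normc.normc (L ((1 / 2) +i* t)) ^+ 2) - C_nu R * T |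
      <= K * T `^ (1 - cantor_dim R / 2).
Proof.
split; first exact: C_nu_cvg.
split; first exact: C_nu_value.
exists (continuation (iter_coef R)); split.
  rewrite -iter_coef0.
  exact: (continuation_entire (@iter_coef_sum R) (@iter_coef_le R)).
have [K hK] := mean_square_continuation R.
exists K; near=> T; apply: hK.
by near: T; apply: nbhs_pinfty_ge; rewrite num_real.
Unshelve. all: by end_near. Qed.
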